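(* The Dirichlet form $\mathcal{E}^\ast$ associated to the resolvent family $(R^\ast_\lambda)_{\lambda>0}$ (on $\overline{\mathrm{Ker}(B)\cap H^1}$) is the closed form with domain $\mathrm{Ker}(B)\cap H^1$ given by $$\mathcal{E}^\ast:(u,v)\mapsto\langle u,v\rangle_{H^1}=\int_M\nabla u\cdot\nabla v\,d\pi .$$
   Context: Setting. $(M,g)$ is a compact oriented $d$-dimensional Riemannian manifold without boundary, $U\in C^1(M)$ is such that $\pi(dx)=e^{-U(x)}\mathrm{vol}(dx)$ is a probability measure, $\langle f,h\rangle=\int_M fh\,d\pi$, and $v\cdot w$ denotes the Riemannian inner product of tangent vectors. $A$ is the Friedrichs extension in $L^2(M,\pi)$ of $f\mapsto\Delta f-\nabla U\cdot\nabla f$ on $C^\infty(M)$ ($\Delta$ has spectrum in $(-\infty,0]$). It is assumed that $A$ has discrete spectrum $0=\lambda_0>-\lambda_1\ge-\lambda_2\ge\dots$ with $\lambda_n\to\infty$ and a complete orthonormal basis of eigenvectors $\phi_0,\phi_1,\dots$ of $L^2(M,\pi)$, with $\phi_0$ spanning the constants. $H=L^2(M,\pi)$, $H^m=\{\varphi=\sum_{k\ge0}a_k\phi_k\in L^2(M,\pi):\ \sum_{k\ge0}|a_k|^2\lambda_k^m<\infty\}$, and $\langle f,h\rangle_{H^1}=\int_M\nabla f\cdot\nabla h\,d\pi$ on $H^1$. $b$ is a $C^1$ vector field on $M$ with $\mathrm{div}(e^{-U}b)=0$ and $H^1\subset\mathrm{Dom}(b\cdot\nabla)$. $B:H^1\to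 H$ is the continuous extension of $f\mapsto b\cdot\nabla f$ from smooth functions; it is antisymmetric. $\mathrm{Ker}(B)\cap H^1=\{\varphi\in H^1:B\varphi=0\}$, and the bar denotes closure in $H$. For $\lambda>0$, $g\in H$: $R^\ast_\lambda g:=-P_{1,\lambda}(A-\lambda)^{-1}g$, where $P_{1,\lambda}$ is the orthogonal projection of $H^1$ onto $\mathrm{Ker}(B)\cap H^1$ with respect to $\langle\psi,\varphi\rangle_{1,\lambda}=\langle\psi,\varphi\rangle_{H^1}+\lambda\langle\psi,\varphi\rangle$. Restricted to the Hilbert space $\overline{\mathrm{Ker}(B)\cap H^1}$, $(R^\ast_\lambda)_{\lambda>0}$ is a strongly continuous symmetric contraction resolvent. The form associated to such a resolvent is (Fukushima) $\mathcal{E}^\ast(u,v)=\lim_{\lambda\to\infty}\lambda\langle u-\lambda R^\ast_\lambda u,v\rangle$, with domain the set of $u\in\overline{\mathrm{Ker}(B)\cap H^1}$ for which $\lim_{\lambda\to\infty}\lambda\langle u-\lambda R^\ast_\lambda u,u\rangle<\infty$. *)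

(* Defs.v *)
From HB Require Import structures.
From mathcomp Require Import all_boot all_order all_algebra.
From mathcomp Require Import all_classical all_reals all_analysis.
From mathcomp Require Import measurable_realfun.

Set Implicit Arguments.
Unset Strict Implicit.
Unset Printing Implicit Defensive.

Import Order.TTheory GRing.Theory Num.Theory.
Import numFieldNormedType.Exports.

Local Open Scope classical_set_scope.
Local Open Scope ring_scope.

Section Euclidean.
Variable R : realType.

Definition basis_vec (d : nat) (i : 'I_d) : 'rV[R]_d := delta_mx ord0 i.

Definition partial (d : nat) (W : normedModType R) (i : 'I_d)
    (f : 'rV[R]_d -> W) (x : 'rV[R]_d) : W :=
  'D_(basis_vec i) f x.

Fixpoint Ck (d : nat) (W : normedModType R) (k : nat) (O : set 'rV[R]_d)
    (f : 'rV[R]_d -> W) : Prop :=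
  match k with
  | 0%N => forall x, O x -> {for x, continuous f}
  | k'.+1 => (forall x, O x -> differentiable f x) /\
             (forall i : 'I_d, Ck k' O (partial i f))
  end.

Definition Csmooth (d : nat) (W : normedModType R) (O : set 'rV[R]_d)
    (f : 'rV[R]_d -> W) : Prop :=
  forall k, Ck k O f.

(* Integral of a nonnegative Borel function over R^d, written, by Tonelli, as
   d successive one-dimensional Lebesgue integrals. *)
Fixpoint lebesgue_integral_rV (d : nat) : ('rV[R]_d -> \bar R) -> \bar R :=
  match d with
  | 0%N => fun F => F 0
  | d'.+1 => fun F => (\int[@lebesgue_measure R]_t
      lebesgue_integral_rV
        (fun y : 'rV[R]_d' => F (row_mx (const_mx t : 'rV[R]_1) y)))%E
  end.

End Euclidean.

Notation borel M := (g_sigma_algebraType (@open M)).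

Section Manifold.
Variables (R : realType) (M : ptopologicalType) (d : nat).

(* [chart_inv] is only meaningful on [chart_map @` chart_dom]. *)
Record chart := Chart {
  chart_dom : set M;
  chart_map : M -> 'rV[R]_d;
  chart_inv : 'rV[R]_d -> M;
  chart_dom_open : open chart_dom;
  chart_im_open : open (chart_map @` chart_dom);
  chart_mapK : forall p, chart_dom p -> chart_inv (chart_map p) = p;
  chart_map_continuous : forall p, chart_dom p -> {for p, continuous chart_map};
  chart_inv_continuous : forall x, (chart_map @` chart_dom) x ->
    {for x, continuous chart_inv} }.

Definition chart_im (c : chart) : set 'rV[R]_d := chart_map c @` chart_dom c.

Definition transition (c c' : chart) : 'rV[R]_d -> 'rV[R]_d :=
  chart_map c' \o chart_inv c.

(* Tangent vectors are row vectors of components: if v lists the components of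
   a tangent vector at p in the chart c, then v *m tchange c c' p lists its
   components in the chart c'. *)
Definition tchange (c c' : chart) (p : M) : 'M[R]_d :=
  'J (transition c c') (chart_map c p).

Record oriented_atlas := OrientedAtlas {
  charts : set chart;
  chart_at : M -> chart;
  chart_at_atlas : forall p, charts (chart_at p);
  chart_at_dom : forall p, chart_dom (chart_at p) p;
  transition_smooth : forall c c', charts c -> charts c' ->
    Csmooth (chart_map c @` (chart_dom c `&` chart_dom c')) (transition c c');
  transition_oriented : forall c c', charts c -> charts c' ->
    forall p, chart_dom c p -> chart_dom c' p -> 0 < \det (tchange c c' p) }.

Variable S : oriented_atlas.

Definition CkM (k : nat) (f : M -> R) : Prop :=
  forall c, charts S c -> Ck k (chart_im c) (f \o chart_inv c).

Definition smoothM (f : M -> R) : Prop := forall k, CkM k f.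

(* A vector field X is given by the components X p of its value at p in the
   distinguished chart [chart_at S p]; no regularity in p of these components
   is meant. Its components in a chart c are [field_in c X]. *)
Definition vfield := M -> 'rV[R]_d.

Definition field_in (c : chart) (X : vfield) (p : M) : 'rV[R]_d :=
  X p *m tchange (chart_at S p) c p.

Definition Ck_field (k : nat) (X : vfield) : Prop :=
  forall c, charts S c -> Ck k (chart_im c) (field_in c X \o chart_inv c).

(* Likewise, a metric is given at p by its Gram matrix in [chart_at S p];
   [gram_in] is the Gram matrix in the chart c. *)
Definition gram_in (g : M -> 'M[R]_d) (c : chart) (p : M) : 'M[R]_d :=
  tchange c (chart_at S p) p *m g p *m (tchange c (chart_at S p) p)^T.

Record riemannian_metric := RiemannianMetric {
  gram :> M -> 'M[R]_d;
  gram_sym : forall p, (gram p)^T = gram p;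
  gram_posdef : forall p (v : 'rV[R]_d), v != 0 ->
    0 < (v *m gram p *m v^T) ord0 ord0;
  gram_smooth : forall c, charts S c ->
    Csmooth (chart_im c) (gram_in gram c \o chart_inv c) }.

Variable g : riemannian_metric.

Definition inner (X Y : vfield) (p : M) : R :=
  (X p *m g p *m (Y p)^T) ord0 ord0.

Definition vol_density (c : chart) (x : 'rV[R]_d) : R :=
  Num.sqrt (\det (gram_in g c (chart_inv c x))).

Definition gradient (f : M -> R) : vfield := fun p =>
  let c := chart_at S p in
  (\row_i partial i (f \o chart_inv c) (chart_map c p)) *m invmx (g p).

(* div X = det(g)^(-1/2) sum_i d_i (det(g)^(1/2) X^i) in local coordinates. *)
Definition divergence (X : vfield) (p : M) : R :=
  let c := chart_at S p in
  (\sum_(i < d) partial i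
     (fun x => vol_density c x * field_in c X (chart_inv c x) ord0 i)
     (chart_map c p)) / vol_density c (chart_map c p).

Definition laplacian (f : M -> R) : M -> R := divergence (gradient f).

Definition riemannian_volume (vol : {measure set (borel M) -> \bar R}) : Prop :=
  forall c, charts S c ->
  forall F : borel M -> \bar R, (forall p, 0 <= F p)%E ->
    measurable_fun [set: borel M] F ->
    (\int[vol]_(p in (chart_dom c : set (borel M))) F p)%E =
    lebesgue_integral_rV ((fun x : 'rV[R]_d =>
      (F (chart_inv c x) * (vol_density c x)%:E)%E) \_ (chart_im c)).

End Manifold.

Section L2.
Variables (R : realType) (M : ptopologicalType).
Variable pi : probability (borel M) R.

(* Elements of L^2(M, pi) are represented by functions; equality in L^2
   is [eqL2]. *)
Definition L2 : set (M -> R) := [set f | (f : borel M -> R) \in Lfun pi 2%:E].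

Definition eqL2 (f h : M -> R) : Prop :=
  ae_eq pi setT (f : borel M -> R) (h : borel M -> R).

Definition ip (f h : M -> R) : R := \int[pi]_(p in [set: borel M]) (f p * h p).

Definition cvgL2 (f_ : nat -> M -> R) (f : M -> R) : Prop :=
  ip (f_ n \- f) (f_ n \- f) @[n --> \oo] --> 0.

Definition closureL2 (D : set (M -> R)) : set (M -> R) :=
  [set u | L2 u /\ exists2 f_, (forall n, D (f_ n)) & cvgL2 f_ u].

Definition cauchy_for (q : (M -> R) -> R) (f_ : nat -> M -> R) : Prop :=
  forall e, 0 < e -> exists N, forall m n, (N <= m)%N -> (N <= n)%N ->
    q (f_ m \- f_ n) < e.

(* The Friedrichs extension of a symmetric operator T <= 0 with domain D, as a
   graph: the restriction of the adjoint of T to the closure of D for the form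
   f, h |-> - <T f, h>. *)
Definition friedrichs (D : set (M -> R)) (T : (M -> R) -> M -> R)
    (u w : M -> R) : Prop :=
  [/\ L2 u, L2 w,
      exists f_, [/\ forall n, D (f_ n), cvgL2 f_ u &
                     cauchy_for (fun f => - ip (T f) f) f_] &
      forall f, D f -> ip u (T f) = ip w f].

Definition eigenbasis (A : (M -> R) -> (M -> R) -> Prop)
    (lam : nat -> R) (phi : nat -> M -> R) : Prop :=
  [/\ [/\ lam 0%N = 0, 0 < lam 1%N,
          (forall n, lam n <= lam n.+1) & lam n @[n --> \oo] --> +oo],
      (forall k, A (phi k) (fun p => - lam k * phi k p)),
      (forall j k, ip (phi j) (phi k) = (j == k)%:R),
      (forall f, L2 f ->
         cvgL2 (fun n p => \sum_(k < n) ip f (phi k) * phi k p) f) &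
      exists a : R, eqL2 (phi 0%N) (fun=> a)].

Definition Hm (lam : nat -> R) (phi : nat -> M -> R) (m : nat) :
    set (M -> R) :=
  [set u | L2 u /\
    (\sum_(0 <= k <oo) (`|ip u (phi k)| ^+ 2 * lam k ^+ m)%:E < +oo)%E].

(* A closed symmetric form E with domain D on the Hilbert space H. *)
Definition closed_form (H D : set (M -> R)) (E : (M -> R) -> (M -> R) -> R) :
    Prop :=
  [/\ [/\ D `<=` H, D (fun=> 0),
          (forall (a : R) u v, D u -> D v -> D (fun p => a * u p + v p)) &
          (forall u, H u -> exists2 f_, (forall n, D (f_ n)) & cvgL2 f_ u)],
      (forall u v, D u -> D v -> E u v = E v u),
      (forall (a : R) u v w, D u -> D v -> D w ->
         E (fun p => a * u p + v p) w = a * E u w + E v w),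
      (forall u, D u -> 0 <= E u u) &
      (forall f_, (forall n, D (f_ n)) ->
         cauchy_for (fun f => E f f + ip f f) f_ ->
         exists2 u, D u &
           (E (f_ n \- u) (f_ n \- u) + ip (f_ n \- u) (f_ n \- u))
             @[n --> \oo] --> 0)].

(* The form of a resolvent family G on the closed subspace H of L^2. *)
Definition approx_form (G : R -> (M -> R) -> M -> R) (u v : M -> R) (l : R) :
    R :=
  l * ip (fun p => u p - l * G l u p) v.

Definition form_dom (H : set (M -> R)) (G : R -> (M -> R) -> M -> R) :
    set (M -> R) :=
  [set u | H u /\ cvg (approx_form G u u l @[l --> +oo])].

Definition form_of (G : R -> (M -> R) -> M -> R) (u v : M -> R) : R :=
  lim (approx_form G u v l @[l --> +oo]).

End L2.

Section Setting.
Variables (R : realType) (M : ptopologicalType) (d : nat).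
Variables (S : oriented_atlas R M d) (g : riemannian_metric S).
Variable pi : probability (borel M) R.

Definition gibbs (vol : {measure set (borel M) -> \bar R}) (U : M -> R) : Prop :=
  forall A : set (borel M), measurable A ->
    pi A = (\int[vol]_(p in A) (expR (- U p))%:E)%E.

Definition drift_laplacian (U f : M -> R) (p : M) : R :=
  laplacian g f p - inner g (gradient g U) (gradient g f) p.

Definition generator (U : M -> R) : (M -> R) -> (M -> R) -> Prop :=
  friedrichs pi (smoothM S) (drift_laplacian U).

Definition L2_field (X : vfield R M d) : Prop :=
  (forall c, charts S c -> forall i : 'I_d,
     measurable_fun (chart_dom c : set (borel M))
       (fun p : borel M => field_in S c X p ord0 i)) /\
  pi.-integrable [set: borel M] (fun p => (inner g X X p)%:E).

(* The gradient of a Sobolev function: closure in L^2 of the gradient on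
   C^oo(M). *)
Definition is_sobolev_gradient (u : M -> R) (X : vfield R M d) : Prop :=
  L2_field X /\
  exists f_, [/\ forall n, smoothM S (f_ n), cvgL2 pi f_ u &
    \int[pi]_(p in [set: borel M])
      inner g (gradient g (f_ n) \- X) (gradient g (f_ n) \- X) p
      @[n --> \oo] --> 0].

Definition nabla (u : M -> R) : vfield R M d :=
  xget (fun=> 0) [set X | is_sobolev_gradient u X].

Definition ipH1 (u v : M -> R) : R :=
  \int[pi]_(p in [set: borel M]) inner g (nabla u) (nabla v) p.

Definition ip1 (l : R) (u v : M -> R) : R := ipH1 u v + l * ip pi u v.

Definition transport (b : vfield R M d) (f : M -> R) : M -> R :=
  inner g b (gradient g f).

Definition transport_dom (b : vfield R M d) : set (M -> R) :=
  [set u | L2 pi u /\ exists2 w, L2 pi w & exists f_,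
    [/\ forall n, smoothM S (f_ n), cvgL2 pi f_ u &
        cvgL2 pi (fun n => transport b (f_ n)) w]].

Definition transport_extension (b : vfield R M d) (H1 : set (M -> R))
    (B : (M -> R) -> M -> R) : Prop :=
  [/\ (forall u, H1 u -> L2 pi (B u)),
      (forall (a : R) u v, H1 u -> H1 v ->
         eqL2 pi (B (fun p => a * u p + v p)) (fun p => a * B u p + B v p)),
      (exists C, forall u, H1 u -> ip pi (B u) (B u) <= C * ip1 1 u u) &
      (forall f, smoothM S f -> eqL2 pi (B f) (transport b f))].

Definition kerB (H1 : set (M -> R)) (B : (M -> R) -> M -> R) : set (M -> R) :=
  [set u | H1 u /\ eqL2 pi (B u) (fun=> 0)].

(* w is the orthogonal projection of u onto K for <.,.>_{1,l}. *)
Definition is_projection (K : set (M -> R)) (l : R) (u w : M -> R) : Prop :=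
  K w /\ forall v, K v -> ip1 l (u \- w) v = 0.

(* w = - P_{1,l} (A - l)^-1 f, where r = (A - l)^-1 f is expressed as
   A r = f + l r. *)
Definition is_resolvent_star (A : (M -> R) -> (M -> R) -> Prop)
    (K : set (M -> R)) (l : R) (f w : M -> R) : Prop :=
  L2 pi w /\
  exists r p, [/\ A r (fun x => f x + l * r x), is_projection K l r p &
                  eqL2 pi w (\- p)].

End Setting.

(* Main.v *)
Require Import Defs.
From HB Require Import structures.
From mathcomp Require Import all_boot all_order all_algebra.
From mathcomp Require Import all_classical all_reals all_analysis.
From mathcomp Require Import measurable_realfun lra ring.

(* Write E for the energy form and w_l = l * R*_l u. By definition of the
   projection, R*_l u is the element of K with E (R*_l u) v + l <R*_l u, v> = <u, v>
   for all v in K, so that l <u - w_l, v> = E w_l v. For l <= m this gives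
   E (w_m - w_l) <= E w_m - E w_l, so a bounded energy forces w_l to converge in
   the form norm, and its limit can only be u. Completeness of K then identifies
   the domain and the limit of the approximating forms.

   This requires that K be complete for the form norm. Green's formula, from
   integration by parts in charts and a C^1 partition of unity, makes the gradient
   closable, so the closure W of the smooth functions is complete. The eigenvectors
   lie in W; Bessel's inequality for E and the convergence of the eigenvector
   expansion give H^1 = W, and the continuity of B on H^1 makes its kernel closed. *)

Set Implicit Arguments.
Unset Strict Implicit.
Unset Printing Implicit Defensive.

Import Order.TTheory GRing.Theory Num.Theory.
Import numFieldNormedType.Exports.

Local Open Scope classical_set_scope.
Local Open Scope ring_scope.

(** * Semi-inner products on spaces of functions *)

Section SemiInner.
Context {R : realType} {T : Type}.
Implicit Types (D : set (T -> R)) (Q : (T -> R) -> (T -> R) -> R).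

(** Two features of the encoding shape the proof. Functions are not identified almost everywhere,
    and [nabla], [B] and [Rstar] act on representatives. All spaces are therefore subspaces with a
    semi-definite form, limits are found only up to a null function, and it must be shown that K
    absorbs null modifications and that null functions have no energy; both rest on closability.
    Moreover [gradient] and [divergence] are computed at p in [chart_at S p], a chart that may jump
    with p, so their definitions show no regularity in p. The drift Laplacian has to be recognised
    in a fixed chart before it is even known to be continuous. Its independence of the chart is
    obtained weakly, from Green's formula for test functions supported in one chart, and only then
    can the local formulas be summed. Since a single derivative falls on the test functions, C^1
    cutoffs suffice, and a squared positive part is enough. The volume is specified only on
    nonnegative functions, by iterated integrals; integrals in charts are reduced to continuous
    functions of compact support, for which iterated integrals are finite and linear. *)

Definition subspace D :=
  D (fun=> 0) /\ forall (a : R) u v, D u -> D v -> D (fun p => a * u p + v p).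

(** Definiteness is not asked: functions that vanish almost everywhere have L^2 norm zero, and
    constants have zero energy. *)
Definition semi_inner D Q :=
  [/\ forall u v, D u -> D v -> Q u v = Q v u,
      forall (a : R) u v w, D u -> D v -> D w ->
        Q (fun p => a * u p + v p) w = a * Q u w + Q v w &
      forall u, D u -> 0 <= Q u u].

Lemma subspaceB D u v : subspace D -> D u -> D v -> D (u \- v).
Proof.
move=> [_ DL] Du Dv; have := DL (-1) v u Dv Du.
by congr D; apply/funext => p /=; rewrite mulN1r addrC.
Qed.

Lemma subspaceZ D a u : subspace D -> D u -> D (fun p => a * u p).
Proof.
move=> [D0 DL] Du; have := DL a u _ Du D0.
by congr D; apply/funext => p /=; rewrite addr0.
Qed.

Variables (D : set (T -> R)) (Q : (T -> R) -> (T -> R) -> R).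
Hypotheses (Dsub : subspace D) (Qsi : semi_inner D Q).

Lemma semi_innerC u v : D u -> D v -> Q u v = Q v u.
Proof. by case: Qsi => + _ _; exact. Qed.

Lemma semi_inner_ge0 u : D u -> 0 <= Q u u.
Proof. by case: Qsi => _ _; exact. Qed.

Lemma semi_innerBl u v w : D u -> D v -> D w -> Q (u \- v) w = Q u w - Q v w.
Proof.
move=> Du Dv Dw; case: Qsi => _ QL _.
have -> : u \- v = (fun p => -1 * v p + u p).
  by apply/funext => p /=; rewrite mulN1r addrC.
by rewrite QL// mulN1r addrC.
Qed.

Lemma semi_innerBr u v w : D u -> D v -> D w -> Q w (u \- v) = Q w u - Q w v.
Proof.
move=> Du Dv Dw; rewrite semi_innerC//; last exact: subspaceB.
by rewrite semi_innerBl// (semi_innerC Dw Du)// (semi_innerC Dw Dv).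
Qed.

Lemma semi_innerZl a u w : D u -> D w -> Q (fun p => a * u p) w = a * Q u w.
Proof.
case: Qsi => _ QL _ Du Dw; have D0 := Dsub.1.
have Q0 : Q (fun=> 0) w = 0.
  have /= := QL 1 (fun=> 0) (fun=> 0) w D0 D0 Dw.
  rewrite (_ : (fun=> _) = (fun=> 0) :> (T -> R)).
    lra.
  by apply/funext => p; rewrite mulr0 addr0.
have := QL a u (fun=> 0) w Du D0 Dw; rewrite Q0 addr0 => <-.
by congr Q; apply/funext => p; rewrite addr0.
Qed.

Lemma semi_innerBB u v : D u -> D v ->
  Q (u \- v) (u \- v) = Q u u - 2 * Q u v + Q v v.
Proof.
move=> Du Dv; have Duv := subspaceB Dsub Du Dv.
by rewrite semi_innerBl// !semi_innerBr// (semi_innerC Dv Du)//; ring.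
Qed.

Lemma semi_innerBBC u v : D u -> D v -> Q (u \- v) (u \- v) = Q (v \- u) (v \- u).
Proof. by move=> Du Dv; rewrite !semi_innerBB// (semi_innerC Dv Du); ring. Qed.

Lemma semi_inner_cauchy_schwarz u v : D u -> D v -> Q u v ^+ 2 <= Q u u * Q v v.
Proof.
move=> Du Dv.
have pol (t : R) : 0 <= Q u u - 2 * t * Q u v + t ^+ 2 * Q v v.
  have Dtv : D (fun p => t * v p) by exact: subspaceZ.
  have := semi_inner_ge0 (subspaceB Dsub Du Dtv).
  rewrite semi_innerBB// (semi_innerC Du Dtv) !semi_innerZl//.
  by rewrite (semi_innerC Dv Dtv)// semi_innerZl// (semi_innerC Dv Du)//; lra.
have v0 := semi_inner_ge0 Dv; have [vp|] := ltP 0 (Q v v).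
  (* The minimiser of the quadratic polynomial [pol] in t. *)
  have := pol (Q u v / Q v v).
  rewrite -(ler_pM2r vp) mul0r.
  have -> : (Q u u - 2 * (Q u v / Q v v) * Q u v + (Q u v / Q v v) ^+ 2 * Q v v) * Q v v
    = Q u u * Q v v - Q u v ^+ 2 by field; rewrite gt_eqF.
  lra.
move=> vn; have {vn}vE : Q v v = 0 by lra.
rewrite vE mulr0; have [->|Qn0] := eqVneq (Q u v) 0; first by rewrite expr0n.
(* With [Q v v = 0] the polynomial is affine, and this t gives it the value -1. *)
have := pol ((Q u u + 1) / (2 * Q u v)); rewrite vE mulr0 addr0.
have -> : 2 * ((Q u u + 1) / (2 * Q u v)) * Q u v = Q u u + 1 by field.
lra.
Qed.

(** The parallelogram identity for [u \- v] and [v \- w], with the square of their difference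
    dropped. Working with squares avoids square roots throughout. *)
Lemma semi_inner_triangle u v w : D u -> D v -> D w ->
  Q (u \- w) (u \- w) <= 2 * Q (u \- v) (u \- v) + 2 * Q (v \- w) (v \- w).
Proof.
move=> Du Dv Dw.
have Duv := subspaceB Dsub Du Dv; have Dvw := subspaceB Dsub Dv Dw.
have -> : u \- w = (u \- v) \- (w \- v).
  by apply/funext => p /=; ring.
have Dwv := subspaceB Dsub Dw Dv.
have e1 := semi_innerBBC Dw Dv.
rewrite (semi_innerBB Duv Dwv) -e1.
have := semi_inner_ge0 (subspaceB Dsub Duv Dvw).
rewrite (semi_innerBB Duv Dvw) -e1.
have : Q (u \- v) (w \- v) = - Q (u \- v) (v \- w) by rewrite !semi_innerBr//; ring.
lra.
Qed.

Lemma semi_innerZD_le (a : R) u v : D u -> D v ->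
  Q (fun p => a * u p + v p) (fun p => a * u p + v p) <=
  2 * a ^+ 2 * Q u u + 2 * Q v v.
Proof.
move=> Du Dv; have Dau := subspaceZ a Dsub Du.
have -> : (fun p => a * u p + v p) = (fun p => a * u p) \- (fun p => -1 * v p).
  by apply/funext => p /=; rewrite mulN1r opprK.
have Dnv := subspaceZ (-1) Dsub Dv.
have := semi_inner_ge0 (subspaceB Dsub Dau Dv).
rewrite !semi_innerBB// (semi_innerC Dau Dnv) !semi_innerZl//.
rewrite (semi_innerC Du Dau) (semi_innerC Dv Dnv) (semi_innerC Dv Dau).
rewrite !semi_innerZl//; lra.
Qed.

Lemma semi_inner_null u v : D u -> D v -> Q u u = 0 -> Q u v = 0.
Proof.
move=> Du Dv u0; have := semi_inner_cauchy_schwarz Du Dv.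
by rewrite u0 mul0r => h; apply/eqP; rewrite -sqrf_eq0 eq_le h sqr_ge0.
Qed.

Lemma semi_inner_cvg (f_ : nat -> T -> R) u v : (forall n, D (f_ n)) -> D u -> D v ->
  Q (f_ n \- u) (f_ n \- u) @[n --> \oo] --> 0 -> Q v (f_ n) @[n --> \oo] --> Q v u.
Proof.
move=> Df Du Dv cf; apply/cvgrPdist_lt => e e0.
have v0 := semi_inner_ge0 Dv.
have e1 : 0 < e ^+ 2 / (Q v v + 1) by rewrite divr_gt0 ?exprn_gt0// ltr_wpDl.
move/cvgrPdist_lt : cf => /(_ _ e1) [N _ hN]; exists N => // n Nn.
have := hN n Nn; rewrite /= sub0r normrN => h.
have Dd := subspaceB Dsub (Df n) Du.
have := semi_inner_ge0 Dd => d0; rewrite ger0_norm// in h.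
rewrite distrC -semi_innerBr//.
have cs := semi_inner_cauchy_schwarz Dv Dd.
have h5 : Q v (f_ n \- u) ^+ 2 < e ^+ 2.
  apply: le_lt_trans cs _; move: h; rewrite ltr_pdivlMr ?ltr_wpDl// mulrC.
  by apply: le_lt_trans; apply: ler_wpM2r => //; rewrite lerDl.
by rewrite -real_normK ?num_real// in h5; rewrite ltr_pXn2r ?nnegrE// ?ltW in h5.
Qed.

End SemiInner.

(** * Forms associated with resolvents *)

Section ResolventForm.
Context {R : realType} {M : ptopologicalType} (pi : probability (borel M) R).
Variables (K : set (M -> R)) (E : (M -> R) -> (M -> R) -> R).
Variable G : R -> (M -> R) -> M -> R.
Hypotheses (Lsub : subspace (L2 pi)) (Lsi : semi_inner (L2 pi) (ip pi)).
Hypotheses (KL : K `<=` L2 pi) (Ksub : subspace K) (Esi : semi_inner K E).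
Hypothesis GK : forall l u, 0 < l -> L2 pi u -> K (G l u).
Hypothesis GE : forall l u v, 0 < l -> L2 pi u -> K v ->
  E (G l u) v + l * ip pi (G l u) v = ip pi u v.
Hypothesis Kcomplete : forall f_, (forall n, K (f_ n)) ->
  cauchy_for (fun f => E f f + ip pi f f) f_ ->
  exists2 u, K u & E (f_ n \- u) (f_ n \- u) + ip pi (f_ n \- u) (f_ n \- u)
    @[n --> \oo] --> 0.
(* Functions are not identified almost everywhere; this hypothesis and the next
   say that K and E do not see modifications on null sets. *)
Hypothesis Ksat : forall u w, L2 pi u -> K w ->
  ip pi (u \- w) (u \- w) = 0 -> K u.
Hypothesis Eclosable : forall z, K z -> ip pi z z = 0 -> E z z = 0.

Let q := ip pi.
Let w u l : M -> R := fun p => l * G l u p.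

Let Kw u l : 0 < l -> L2 pi u -> K (w u l).
Proof. by move=> l0 Lu; apply: subspaceZ => //; exact: GK. Qed.

Let Ew u l v : 0 < l -> L2 pi u -> K v -> E (w u l) v = l * q (u \- w u l) v.
Proof.
move=> l0 Lu Kv; have Lv := KL Kv; have KG := GK l0 Lu.
have LG := KL KG; have Lw := KL (Kw l0 Lu).
rewrite /w (semi_innerZl Ksub Esi)// /q (semi_innerBl Lsi)//.
rewrite (semi_innerZl Lsub Lsi)// -(@GE l u v)//; ring.
Qed.

(* The difference of the two sides is
   2 * l * (ip (u - w_l) (u - w_l) - ip (u - w_l) (u - w_m)), and testing the two
   resolvent equations with w_m - w_l gives
   ip (u - w_m) (u - w_m) <= ip (u - w_l) (u - w_l). *)
Let Emono u l m : 0 < l -> l <= m -> L2 pi u ->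
  E (w u m \- w u l) (w u m \- w u l) <=
  E (w u m) (w u m) - E (w u l) (w u l).
Proof.
move=> l0 lm Lu; have m0 := lt_le_trans l0 lm.
have Kl := Kw l0 Lu; have Km := Kw m0 Lu.
have Ll := KL Kl; have Lm := KL Km.
have Kml := subspaceB Ksub Km Kl.
have La := subspaceB Lsub Lu Ll; have Lb := subspaceB Lsub Lu Lm.
set a := u \- w u l; set b := u \- w u m.
have dE : w u m \- w u l = a \- b by apply/funext => p; rewrite /a /b /=; ring.
have e1 : E (w u m) (w u m \- w u l) = m * (q a b - q b b).
  rewrite Ew// -/b dE /q (semi_innerBr Lsub Lsi)// (semi_innerC Lsi (u:=b) (v:=a))//.
have e2 : E (w u l) (w u m \- w u l) = l * (q a a - q a b).
  by rewrite Ew// -/a dE /q (semi_innerBr Lsub Lsi).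
have := semi_inner_ge0 Esi Kml.
have := semi_inner_ge0 Lsi (subspaceB Lsub La Lb).
rewrite -/a -/b (semi_innerBB Lsub Lsi)// -/q.
rewrite (semi_innerBl Esi)// e1 e2 => P1 P2.
have f1 := e1; have f2 := e2; rewrite !(semi_innerBr Ksub Esi)// in f1 f2.
rewrite (semi_innerC Esi (u:=w u l) (v:=w u m)) // in f2.
suff : 0 <= l * (q a a - q a b) by lra.
apply: mulr_ge0; first exact: ltW.
have [lmE|lmn] := eqVneq l m; first by rewrite /b -lmE -/a subrr.
have {}lm : 0 < m - l by rewrite subr_gt0 lt_neqAle lmn.
have P3 : 0 <= (m - l) * (q a a - q b b) by nra.
rewrite pmulr_rge0// in P3; lra.
Qed.

(** Bounded increasing energies have small gaps, and by [Emono] the gaps control the increments of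
    [w u l] in energy; the second bound makes [w u l] tend to u in L^2 at rate C / l. Completeness
    then yields a limit in K, which can only be compared with u almost everywhere. *)
Let resolvent_limit u l0 C : L2 pi u -> 0 < l0 ->
    (forall l, l0 <= l -> E (w u l) (w u l) <= C) ->
    (forall l, l0 <= l -> l * q (u \- w u l) (u \- w u l) <= C) ->
  exists u', [/\ K u', q (u \- u') (u \- u') = 0 &
    forall e, 0 < e -> exists2 l1, 0 < l1 & forall l, l1 <= l ->
      E (w u l \- u') (w u l \- u') < e].
Proof.
(* Unit steps suffice: the energy increases with l and every l lies below some [l0 + n%:R], so the
   supremum over the sequence dominates all energies. *)
move=> Lu l0p EC qC; pose f n := w u (l0 + n%:R).
have lp n : 0 < l0 + n%:R by rewrite ltr_wpDr// ler0n.
have l0l n : l0 <= l0 + n%:R by rewrite lerDl ler0n.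
have Kf n : K (f n) by exact: Kw.
have C0 : 0 <= C.
  apply: le_trans (EC _ (lexx _)); apply: (semi_inner_ge0 Esi); exact: Kw.
set X := [set E (f n) (f n) | n in [set: nat]].
have supX : has_sup X.
  split; first by exists (E (f 0%N) (f 0%N)); exists 0%N.
  by exists C => _ [n _ <-]; exact: EC.
have Esup n l : l0 + n%:R <= l -> E (w u l \- f n) (w u l \- f n) <= sup X - E (f n) (f n).
  move=> nl; apply: le_trans (Emono (lp n) nl Lu) _.
  rewrite lerD2r.
  have lp' : 0 < l := lt_le_trans (lp n) nl.
  pose k := Num.bound l.
  have lk : l <= l0 + k%:R.
    by rewrite ler_wpDl ?ltW// archi_boundP// ltW.
  have := Emono lp' lk Lu.
  have := semi_inner_ge0 Esi (subspaceB Ksub (Kf k) (Kw lp' Lu)).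
  move=> h1 h2; apply: (@le_trans _ _ (E (f k) (f k))); first by rewrite /f in h1 *; lra.
  by apply: sup_upper_bound => //; exists k.
have Ecv e : 0 < e -> exists N, sup X - E (f N) (f N) < e.
  move=> e0; have [_ [N _ <-] NX] := sup_adherent e0 supX.
  by exists N; lra.
have qf n : q (u \- f n) (u \- f n) <= C / (l0 + n%:R).
  by rewrite ler_pdivlMr// mulrC; exact: qC.
have qcv e : 0 < e -> exists N, forall n, (N <= n)%N -> q (u \- f n) (u \- f n) < e.
  move=> e0; exists (Num.bound (C / e)) => n Nn; apply: le_lt_trans (qf n) _.
  rewrite ltr_pdivrMr// mulrC -ltr_pdivrMr//.
  have := archi_boundP (divr_ge0 C0 (ltW e0)) => h; apply: lt_le_trans h _.
  by apply: (@le_trans _ _ n%:R); [rewrite ler_nat|rewrite lerDr ltW].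
have fn_mono n k : (n <= k)%N -> E (f k \- f n) (f k \- f n) <= sup X - E (f n) (f n).
  by move=> nk; apply: Esup; rewrite lerD2l ler_nat.
have Lf n := KL (Kf n).
have [u' Ku' cv] : exists2 u', K u' &
    E (f n \- u') (f n \- u') + q (f n \- u') (f n \- u') @[n --> \oo] --> 0.
  apply: Kcomplete => // e e0.
  have e4 : 0 < e / 8 by rewrite divr_gt0.
  have [N1 h1] := Ecv _ e4; have [N2 h2] := qcv _ e4.
  exists (maxn N1 N2) => m n; rewrite !geq_max => /andP[m1 m2] /andP[n1 n2].
  have := semi_inner_triangle Ksub Esi (Kf m) (Kf N1) (Kf n).
  have -> : E (f N1 \- f n) (f N1 \- f n) = E (f n \- f N1) (f n \- f N1).
    by rewrite !(semi_innerBB Ksub Esi)// (semi_innerC Esi (u:=(f n)) (v:=(f N1)))//; ring.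
  have := semi_inner_triangle Lsub Lsi (Lf m) Lu (Lf n).
  have -> : ip pi (f m \- u) (f m \- u) = q (u \- f m) (u \- f m).
    by rewrite /q !(semi_innerBB Lsub Lsi)// (semi_innerC Lsi (u:=(f m)) (v:=u))//; ring.
  have := fn_mono _ _ m1; have := fn_mono _ _ n1; have := h2 _ m2; have := h2 _ n2.
  rewrite -/q; lra.
have Lu' := KL Ku'.
have cvE e : 0 < e -> exists N, forall n, (N <= n)%N ->
   E (f n \- u') (f n \- u') + q (f n \- u') (f n \- u') < e.
  move=> e0; have := cv; move/cvgrPdist_lt/(_ _ e0) => [N _ hN].
  exists N => n Nn; have := hN n Nn; rewrite /= sub0r normrN => h.
  exact: le_lt_trans (ler_norm _) h.
have E0 n : 0 <= E (f n \- u') (f n \- u').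
  by apply: (semi_inner_ge0 Esi); exact: subspaceB.
have q0 n : 0 <= q (f n \- u') (f n \- u').
  by apply: (semi_inner_ge0 Lsi); exact: subspaceB.
exists u'; split => //.
  apply/eqP; rewrite eq_le; apply/andP; split; last first.
    by apply: (semi_inner_ge0 Lsi); exact: subspaceB.
  apply/ler_addgt0Pr => e e0; rewrite add0r.
  have e4 : 0 < e / 4 by rewrite divr_gt0.
  have [N1 h1] := cvE _ e4; have [N2 h2] := qcv _ e4.
  have := h1 _ (leq_maxl N1 N2); have := h2 _ (leq_maxr N1 N2).
  set n := maxn N1 N2; have := E0 n; have := q0 n.
  have := semi_inner_triangle Lsub Lsi Lu (Lf n) Lu'.
  rewrite -/q; lra.
move=> e e0; have e4 : 0 < e / 16 by rewrite divr_gt0.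
have [N1 h1] := cvE _ e4; have [N2 h2] := Ecv _ e4.
exists (l0 + N2%:R) => // l Nl.
have := h1 _ (leq_maxl N1 N2); set n := maxn N1 N2.
have l_0 : 0 < l := lt_le_trans (lp _) Nl; have Kwl := Kw l_0 Lu.
have := semi_inner_triangle Ksub Esi Kwl (Kf N2) Ku'.
have := semi_inner_triangle Ksub Esi (Kf N2) (Kf n) Ku'.
have -> : E (f N2 \- f n) (f N2 \- f n) = E (f n \- f N2) (f n \- f N2).
  by rewrite !(semi_innerBB Ksub Esi)// (semi_innerC Esi (u:=(f n)) (v:=(f N2)))//; ring.
have := fn_mono _ _ (leq_maxr N1 N2); have := Esup _ _ Nl; have := q0 n.
rewrite -/n; lra.
Qed.

Let EBC u v : K u -> K v -> E (u \- v) (u \- v) = E (v \- u) (v \- u).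
Proof.
exact: (semi_innerBBC Ksub Esi).
Qed.

Let approxE u v l : 0 < l -> L2 pi u -> K v -> approx_form pi G u v l = E (w u l) v.
Proof. by move=> l0 Lu Kv; rewrite Ew. Qed.

(** The approximating form is [E (w u l) v], so it is enough that [w u l] tends to u in energy, up
    to a null function. *)
Let approx_cvg u v : K u -> K v ->
  approx_form pi G u v l @[l --> +oo] --> E u v.
Proof.
move=> Ku Kv; have Lu := KL Ku.
(* Write w for [w u l]. Testing the equation of w with [u \- w] gives E w u = E w w + l <u - w, u -
   w>; hence 0 <= E (u - w) (u - w) = E u u - E w w - 2 l <u - w, u - w>, which contains both
   bounds. *)
have bnd l : 0 < l -> E (w u l) (w u l) <= E u u /\
    l * q (u \- w u l) (u \- w u l) <= E u u.
  move=> l0; have Kl := Kw l0 Lu; have Ka := subspaceB Ksub Ku Kl.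
  have := Ew l0 Lu Ka; rewrite (semi_innerBr Ksub Esi)// => e1.
  have : 0 <= l * q (u \- w u l) (u \- w u l).
    apply: mulr_ge0; first exact: ltW.
    by apply: (semi_inner_ge0 Lsi); exact: KL.
  have := semi_inner_ge0 Esi Ka; have := semi_inner_ge0 Esi Kl.
  have := semi_inner_ge0 Esi Ku.
  by rewrite (semi_innerBB Ksub Esi)// (semi_innerC Esi Ku Kl) -/q; lra.
have [||u' [Ku' qu' hE]] := @resolvent_limit u 1 (E u u) Lu ltr01.
- by move=> l l1; apply: (bnd _ _).1; exact: lt_le_trans l1.
- by move=> l l1; apply: (bnd _ _).2; exact: lt_le_trans l1.
(* The limit u' is only almost everywhere equal to u; closability removes the difference in
   energy. *)
have Euu' : E (u \- u') (u \- u') = 0.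
  by apply: Eclosable => //; exact: subspaceB.
apply/cvgrPdist_lt => e e0.
(* Half the Cauchy-Schwarz threshold, since the squared triangle inequality doubles. *)
pose e1 := e ^+ 2 / (E v v + 1) / 2.
have Ev := semi_inner_ge0 Esi Kv.
have e10 : 0 < e1 by rewrite !divr_gt0// ?exprn_gt0// ltr_wpDl.
have [l1 l10 hl1] := hE _ e10.
near=> l.
have ll1 : l1 <= l by near: l; exact: nbhs_pinfty_ge (num_real _).
have l0 := lt_le_trans l10 ll1.
have Kl := Kw l0 Lu; have Kd := subspaceB Ksub Ku Kl.
rewrite approxE// -(semi_innerBl Esi)//.
have := semi_inner_cauchy_schwarz Ksub Esi Kd Kv.
have := semi_inner_triangle Ksub Esi Ku Ku' Kl; rewrite Euu' mulr0 add0r.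
have := hl1 _ ll1; rewrite -(EBC Ku' Kl) => h1 h2 h3.
have h4 : E (u \- w u l) (u \- w u l) < e ^+ 2 / (E v v + 1).
  by apply: le_lt_trans h2 _; rewrite /e1 in h1; lra.
have Ev1 : 0 < E v v + 1 by rewrite ltr_wpDl.
have h5 : E (u \- w u l) v ^+ 2 < e ^+ 2.
  apply: le_lt_trans h3 _; move: h4; rewrite ltr_pdivlMr// => h4.
  apply: le_lt_trans h4; apply: ler_wpM2l; last by rewrite lerDl.
  exact: (semi_inner_ge0 Esi).
by rewrite -real_normK ?num_real// in h5; rewrite ltr_pXn2r ?nnegrE// ?ltW in h5.
Unshelve. all: by end_near. Qed.

Let KH : K `<=` closureL2 pi K.
Proof.
move=> u Ku; split; first exact: KL.
exists (fun=> u) => //; rewrite /cvgL2.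
have -> : (fun n : nat => ip pi (u \- u) (u \- u)) = (fun=> 0).
  by apply/funext => _; rewrite (semi_innerBB Lsub Lsi (KL Ku) (KL Ku)); ring.
exact: cvg_cst.
Qed.

(** For u in the form domain, [eqA] splits the approximating form into two nonnegative terms; its
    convergence bounds both, so [resolvent_limit] gives an element of K almost everywhere equal to
    u, and [Ksat] puts u itself in K. *)
Let form_dom_eq : form_dom pi (closureL2 pi K) G = K.
Proof.
apply/seteqP; split=> [u [[Lu _] cvu]|u Ku]; last first.
  by split; [exact: KH|apply/cvg_ex; exists (E u u); exact: approx_cvg].
move/cvg_ex : cvu => [/= x]; move/cvgrPdist_lt => /(_ _ ltr01) [l0 [_ hl0]].
(* Positive, and strictly above l0 because the neighbourhood of +oo is an open ray. *)
pose l1 := Num.max l0 0 + 1.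
have l1p : 0 < l1 by rewrite /l1 ltr_wpDl// le_max lexx orbT.
have eqA l : 0 < l -> approx_form pi G u u l =
    l * q (u \- w u l) (u \- w u l) + E (w u l) (w u l).
  move=> lp; have Kl := Kw lp Lu; have Ll := KL Kl; have La := subspaceB Lsub Lu Ll.
  have e := semi_innerBr Lsub Lsi Lu Ll La.
  by rewrite Ew// /approx_form -mulrDr /q e subrK.
have hA l : l1 <= l -> l * q (u \- w u l) (u \- w u l) + E (w u l) (w u l) <= x + 1.
  move=> ll; have lp := lt_le_trans l1p ll; rewrite -eqA//.
  have : `|x - approx_form pi G u u l| < 1.
    by apply: hl0; apply: lt_le_trans ll; rewrite /l1 ltr_pwDr// le_max lexx.
  by rewrite ltr_norml => /andP[+ _]; lra.
have E0 l : l1 <= l -> 0 <= E (w u l) (w u l).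
  by move=> ll; apply: (semi_inner_ge0 Esi); apply: Kw => //; exact: lt_le_trans ll.
have q0 l : l1 <= l -> 0 <= l * q (u \- w u l) (u \- w u l).
  move=> ll; have lp := lt_le_trans l1p ll; apply: mulr_ge0; first exact: ltW.
  by apply: (semi_inner_ge0 Lsi); apply: subspaceB => //; apply: KL; exact: Kw.
have [||u' [Ku' qu' _]] := @resolvent_limit u l1 (x + 1) Lu l1p.
- by move=> l ll; have := hA _ ll; have := q0 _ ll; lra.
- by move=> l ll; have := hA _ ll; have := E0 _ ll; lra.
exact: Ksat Lu Ku' qu'.
Qed.

Let form_ofE u v : K u -> K v -> form_of pi G u v = E u v.
Proof. by move=> Ku Kv; apply/cvg_lim => //; exact: approx_cvg. Qed.

Lemma form_of_resolvent : let H := closureL2 pi K in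
  [/\ form_dom pi H G = K,
      (forall u v, K u -> K v ->
         approx_form pi G u v l @[l --> +oo] --> E u v),
      (forall u v, K u -> K v -> form_of pi G u v = E u v) &
      closed_form pi H (form_dom pi H G) (form_of pi G)].
Proof.
move=> H; rewrite /H form_dom_eq; split=> //; have [K0 KZD] := Ksub; have [EC EZD E0] := Esi.
split=> //.
- by split=> // u [].
- by move=> u v Ku Kv; rewrite !form_ofE//; exact: EC.
- by move=> a u v z Ku Kv Kz; rewrite !form_ofE//; [exact: EZD|exact: KZD].
- by move=> u Ku; rewrite form_ofE//; exact: E0.
move=> f_ Kf cf; have [|u Ku cu] := Kcomplete Kf.
  move=> e e0; have [N hN] := cf e e0; exists N => m n Nm Nn.
  by have := hN m n Nm Nn; rewrite form_ofE//; exact: subspaceB.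
exists u => //; apply: cvg_trans cu; apply: near_eq_cvg; near=> n.
by rewrite form_ofE//; exact: subspaceB.
Unshelve. all: by end_near. Qed.

End ResolventForm.

(** * Integrals with densities and square integrable fields *)

Section Density.
Context {d : measure_display} {T : measurableType d} {R : realType}.
Variables (mu nu : {measure set T -> \bar R}) (e : T -> R).
Hypotheses (me : measurable_fun setT e) (e0 : forall x, 0 <= e x).
Hypothesis nuE : forall A, measurable A -> nu A = (\int[mu]_(x in A) (e x)%:E)%E.
Local Open Scope ereal_scope.

Import HBNNSimple.

Let me' : measurable_fun setT (EFin \o e).
Proof. exact/measurable_EFinP. Qed.

Let nnsfun_density (h : {nnsfun T >-> R}) :
  \int[nu]_x (h x)%:E = \int[mu]_x ((h x)%:E * (e x)%:E).
Proof.
have mind r : measurable_fun setT (fun x => (r * \1_(h @^-1` [set r]) x)%:E).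
  by apply/measurable_EFinP; exact: measurable_funM.
have hE x : (h x)%:E = \sum_(r \in range h) (r * \1_(h @^-1` [set r]) x)%:E.
  by rewrite fsumEFin// -fimfunE.
under eq_integral do rewrite hE.
rewrite ge0_integral_fsum//; last by move=> r x _; exact: nnfun_muleindic_ge0.
under [RHS]eq_integral.
  move=> x _; rewrite hE ge0_mule_fsuml; last first.
    by move=> r; exact: nnfun_muleindic_ge0.
  over.
rewrite ge0_integral_fsum//; last 2 first.
- by move=> r; exact: emeasurable_funM.
- by move=> r x _; rewrite mule_ge0 ?lee_fin// -?lee_fin nnfun_muleindic_ge0.
apply: eq_fsbigr => r /[!inE] -[x0 _ hx0].
have r0 : (0 <= r)%R by rewrite -hx0.
have mr : measurable (h @^-1` [set r]) by [].
under eq_integral do rewrite EFinM.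
under [RHS]eq_integral do rewrite EFinM -muleA.
rewrite !ge0_integralZl_EFin//; do ?[exact/measurable_EFinP|
  by apply: emeasurable_funM => //; exact/measurable_EFinP|
  by move=> x _; rewrite ?mule_ge0// lee_fin].
congr (_ * _); rewrite integral_indic// setIT nuE// integral_mkcond.
apply: eq_integral => x _; rewrite patchE indicE.
by case: (x \in _); rewrite ?mul1e ?mul0e.
Qed.

(** The density is known on sets only; simple functions and monotone convergence extend it. It later
    converts integrals against pi into integrals against the volume. *)
Lemma ge0_integral_density (F : T -> \bar R) : (forall x, 0 <= F x) ->
  measurable_fun setT F -> \int[nu]_x F x = \int[mu]_x (F x * (e x)%:E).
Proof.
move=> F0 mF; pose h := nnsfun_approx measurableT mF.
have hF x : (EFin \o h n) x @[n --> \oo] --> F x.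
  exact: cvg_nnsfun_approx.
have hmono x : {homo (fun n => (h n x)%:E) : m n / (m <= n)%N >-> m <= n}.
  by move=> m n mn; rewrite lee_fin; exact/lefP/nd_nnsfun_approx.
have -> : \int[nu]_x F x = limn (fun n => \int[nu]_x (h n x)%:E).
  have FE x : F x = limn (fun n => (h n x)%:E) by apply/esym/cvg_lim => //; exact: hF.
  under eq_integral do rewrite FE.
  apply: monotone_convergence => //.
  - by move=> n; apply/measurable_EFinP.
  - by move=> n x _; rewrite lee_fin.
have -> : \int[mu]_x (F x * (e x)%:E) = limn (fun n => \int[mu]_x ((h n x)%:E * (e x)%:E)).
  have FE x : F x * (e x)%:E = limn (fun n => (h n x)%:E * (e x)%:E).
    by apply/esym/cvg_lim => //; apply: cvgeZr => //; exact: hF.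
  under eq_integral do rewrite FE.
  apply: monotone_convergence => //.
  - by move=> n; apply: emeasurable_funM => //; apply/measurable_EFinP.
  - by move=> n x _; rewrite mule_ge0// lee_fin.
  - by move=> x _ m n mn; rewrite lee_wpmul2r ?lee_fin//; exact/lefP/nd_nnsfun_approx.
by under eq_fun do rewrite nnsfun_density.
Qed.

End Density.

Section Borel.
Context {R : realType} {M : ptopologicalType}.

Lemma open_borel (A : set M) : open A -> measurable (A : set (borel M)).
Proof. by move=> oA; apply: sub_sigma_algebra. Qed.

Lemma continuous_borel_measurable (D : set M) (f : M -> R) : open D ->
  (forall x, D x -> {for x, continuous f}) ->
  measurable_fun (D : set (borel M)) (f : borel M -> R).
Proof.
move=> oD cf; apply: (measurability (@RGenOpens.G R)).
  exact: RGenOpens.measurableE.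
move=> _ [_ [a [b ->]] <-]; apply: open_borel; rewrite openE => x [Dx abx].
apply: filterI; first exact: open_nbhs_nbhs.
by apply: (cf x Dx); apply: open_nbhs_nbhs; split=> //; exact: interval_open.
Qed.

End Borel.

Lemma cvg_bigsum (R : realType) (I : Type) (s : seq I) (F : I -> nat -> R) (l : I -> R) :
  (forall i, F i j @[j --> \oo] --> l i) ->
  (\sum_(i <- s) F i j) @[j --> \oo] --> \sum_(i <- s) l i.
Proof.
move=> h; elim: s => [|a s IH].
  rewrite big_nil; under eq_cvg do rewrite big_nil.
  exact: cvg_cst.
rewrite big_cons; under eq_cvg do rewrite big_cons.
exact: cvgD.
Qed.

Lemma geometric_increments_cvg (R : realType) (u : nat -> R) (D : R) :
  (forall j, `|u j.+1 - u j| <= D * 2 ^- j) -> cvgn u.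
Proof.
move=> h; have D0 : 0 <= D.
  by have := h 0%N; rewrite expr0 invr1 mulr1; exact: le_trans.
have cs : cvgn (series (fun j => u j.+1 - u j)).
  apply: normed_cvg.
  apply: (@series_le_cvg _ _ (geometric D 2^-1)).
  - by move=> j; exact: normr_ge0.
  - by move=> j; rewrite /geometric mulr_ge0// exprn_ge0// invr_ge0.
  - by move=> j; rewrite /geometric/= exprVn; exact: h.
  - by apply: is_cvg_geometric_series; rewrite ger0_norm ?invr_ge0// invf_lt1// ltr1n.
have -> : u = (fun n => u 0%N + series (telescope u) n).
  by apply/funext => n; exact: eq_sum_telescope.
by apply: is_cvgD; [exact: is_cvg_cst|exact: cs].
Qed.

(** * Almost everywhere bounds and limits *)

Section AeConvergence.
Context {dd : measure_display} {T : measurableType dd} {R : realType}.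
Variable mu : {measure set T -> \bar R}.

(** The functions 4^j a_j have integrals at most 4^-j, so their sum has integral at most 4/3 and is
    finite almost everywhere; it serves as C. The rates are chosen for squares: 16^-j in mean leaves
    4^-j pointwise, that is 2^-j for the increments themselves. *)
Lemma ae_geometric_bound (a : nat -> T -> R) :
  (forall j, measurable_fun setT (a j)) -> (forall j p, 0 <= a j p) ->
  (forall j, \int[mu]_p (a j p)%:E <= (16 ^- j)%:E)%E ->
  exists A, [/\ measurable A, mu (~` A) = 0%E &
    forall p, A p -> exists C, forall j, a j p <= C * 4 ^- j].
Proof.
move=> ma a0 ia.
pose b j p := ((4 ^+ j)%:E * (a j p)%:E)%E.
have b0 j p : (0 <= b j p)%E by rewrite /b -EFinM lee_fin mulr_ge0// exprn_ge0.
have mb j : measurable_fun setT (b j).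
  by apply: emeasurable_funM => //; exact/measurable_EFinP.
pose s p := (\sum_(j <oo) b j p)%E.
have ms : measurable_fun setT s by apply: ge0_emeasurable_sum.
have s0 p : (0 <= s p)%E by apply: nneseries_ge0.
have ib j : (\int[mu]_p b j p <= (4 ^- j)%:E)%E.
  rewrite ge0_integralZl_EFin//; do ?[exact/measurable_EFinP|exact: exprn_ge0|
    by move=> x _; rewrite lee_fin].
  apply: (@le_trans _ _ ((4 ^+ j)%:E * (16 ^- j)%:E)%E).
    by apply: lee_wpmul2l => //; rewrite lee_fin exprn_ge0.
  rewrite -EFinM lee_fin -exprVn -exprMn -exprVn.
  by rewrite (_ : 4 * 16^-1 = 4^-1 :> R)//; field.
have isum : (\int[mu]_p s p <= 2%:E)%E.
  rewrite /s integral_nneseries//.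
  apply: lime_le; first by apply: is_cvg_nneseries => j _ _; exact: integral_ge0.
  near=> k; apply: (@le_trans _ _ (\sum_(0 <= j < k) (4 ^- j)%:E)%E).
    by apply: lee_sum => j _; exact: ib.
  rewrite sumEFin lee_fin.
  have -> : \sum_(0 <= j < k) 4 ^- j = (1 - 4 ^- k) * (4 / 3) :> R.
    elim: (k) => [|m IH]; first by rewrite big_geq// expr0 invr1 subrr mul0r.
    rewrite big_nat_recr//= IH exprS invfM; field.
    by rewrite expf_neq0.
  have : 0 <= (4 ^- k : R) by rewrite invr_ge0 exprn_ge0.
  lra.
have sint : mu.-integrable setT s.
  apply/integrableP; split => //.
  under eq_integral do rewrite gee0_abs//.
  exact: le_lt_trans isum (ltry _).
have [N [mN N0 hN]] := integrable_ae measurableT sint.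
exists (~` N); split; [exact: measurableC|by rewrite setCK|].
move=> p Np; exists (fine (s p)) => j.
have sfin : s p \is a fin_num.
  by apply: contrapT => h; apply: Np; apply: hN => /= /(_ I).
rewrite -ler_pdivrMr ?invr_gt0 ?exprn_gt0// invrK mulrC.
rewrite -lee_fin fineK// EFinM.
apply: (@le_trans _ _ (\sum_(0 <= i < j.+1) b i p)%E); last first.
  by apply: nneseries_lim_ge => i _.
rewrite big_nat_recr//= -/(b j p) leeDr//.
by apply: sume_ge0 => i _.
Unshelve. all: by end_near. Qed.

Lemma fatou_le (A : set T) (b_ : nat -> T -> R) (b : T -> R) (e : \bar R) :
  measurable A -> (forall j, measurable_fun setT (b_ j)) ->
  (forall j p, 0 <= b_ j p) ->
  (forall p, A p -> b_ j p @[j --> \oo] --> b p) ->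
  (\forall j \near \oo, \int[mu]_(p in A) (b_ j p)%:E <= e)%E ->
  (\int[mu]_(p in A) (b p)%:E <= e)%E.
Proof.
move=> mA mb b0 cb [J _ hJ].
have -> : (\int[mu]_(p in A) (b p)%:E =
    \int[mu]_(p in A) limn_einf (fun j => (b_ j p)%:E))%E.
  apply: eq_integral => p /[!inE] Ap.
  have c : (b_ j p)%:E @[j --> \oo] --> (b p)%:E.
    by apply: cvg_EFin; [exact: nearW|exact: cb].
  by have [-> _] := cvg_limn_einf_sup c.
apply: (@le_trans _ _ (limn_einf (fun j => \int[mu]_(p in A) (b_ j p)%:E)%E)).
  apply: fatou => //.
  - by move=> j; apply/measurable_EFinP; exact: measurable_funS (mb j).
  - by move=> j p _; rewrite lee_fin.
rewrite limn_einf_lim; apply: lime_le; first exact: is_cvg_einfs.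
near=> n; apply: (@le_trans _ _ (\int[mu]_(p in A) (b_ (maxn n J) p)%:E)%E).
  by apply: ereal_inf_lbound; exists (maxn n J) => //=; exact: leq_maxl.
by apply: hJ; exact: leq_maxr.
Unshelve. all: by end_near. Qed.

End AeConvergence.

(** * Square integrable fields for a pointwise Gram matrix *)

Section FieldL2.
Context {dd : measure_display} {T : measurableType dd} {R : realType}.
Variables (mu : {measure set T -> \bar R}) (n : nat) (G : T -> 'M[R]_n).
Hypotheses (Gsym : forall p, (G p)^T = G p) (Gunit : forall p, G p \in unitmx).
Hypothesis Gge0 : forall p (v : 'rV[R]_n), 0 <= (v *m G p *m v^T) ord0 ord0.

Definition gram_form p (v w : 'rV[R]_n) : R := (v *m G p *m w^T) ord0 ord0.
Local Notation B := gram_form.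

Implicit Types (p : T) (u v w : 'rV[R]_n) (a t : R) (X Y Z : T -> 'rV[R]_n).

Lemma gram_formC p v w : B p v w = B p w v.
Proof.
rewrite /B -[v *m G p *m w^T]trmxK mxE !trmx_mul trmxK Gsym.
by rewrite mulmxA.
Qed.

Lemma gram_formZDl p a u v w : B p (a *: u + v) w = a * B p u w + B p v w.
Proof. by rewrite /B !mulmxDl -!scalemxAl mxE [X in X + _]mxE. Qed.

Lemma gram_formZDr p a u v w : B p w (a *: u + v) = a * B p w u + B p w v.
Proof. by rewrite gram_formC gram_formZDl !(gram_formC p _ w). Qed.

Lemma gram_formBB p u v : B p (u - v) (u - v) = B p u u - 2 * B p u v + B p v v.
Proof.
rewrite -[u - v]addrC -scaleN1r gram_formZDl !gram_formZDr (gram_formC p v u); ring.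
Qed.

(** Nonnegativity of the form at [v - t s u], where s is the sign of [B p u v]. *)
Lemma gram_form_amgm p u v t : 0 < t -> 2 * `|B p u v| <= t * B p u u + t^-1 * B p v v.
Proof.
move=> t0.
have h (s : R) : s ^+ 2 = 1 -> 2 * (s * B p u v) <= t * B p u u + t^-1 * B p v v.
  move=> s1; have := Gge0 p ((- t * s) *: u + v).
  rewrite -/(B p _ _) gram_formZDl !gram_formZDr (gram_formC p v u) => h.
  have {}h : 2 * t * (s * B p u v) <= t ^+ 2 * (s ^+ 2 * B p u u) + B p v v by lra.
  rewrite s1 mul1r in h; rewrite -(ler_pM2l t0) mulrDr !mulrA mulfV ?gt_eqF// mul1r.
  by rewrite -expr2; lra.
have [b0|b0] := leP 0 (B p u v).
  by rewrite ger0_norm//; have := h 1 (expr1n _ _); rewrite mul1r.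
by rewrite ltr0_norm//; have := h (-1) (sqrr_sign _ 1); rewrite mulN1r.
Qed.

(** The i-th coordinate is the product of v with the row i of the inverse Gram matrix, so this is
    Cauchy-Schwarz; the [+ 1] only keeps a denominator positive. It turns pointwise convergence for
    the form into convergence of coordinates. *)
Lemma gram_form_coord p v (i : 'I_n) :
  (v ord0 i) ^+ 2 <= (invmx (G p) i i + 1) * B p v v.
Proof.
pose w : 'rV[R]_n := delta_mx ord0 i *m invmx (G p).
have vw : B p v w = v ord0 i.
  rewrite gram_formC /B /w -mulmxA mulmxA -(mulmxA _ (invmx _)) mulVmx// mulmx1.
  rewrite mxE (bigD1 i)//= big1 => [|j ji]; rewrite !mxE ?eqxx/=.
    by rewrite mul1r addr0.
  by rewrite (negbTE ji) mul0r.
have ww : B p w w = invmx (G p) i i.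
  rewrite /B {1}/w -(mulmxA _ (invmx _)) mulVmx// mulmx1 /w.
  rewrite mxE (bigD1 i)//= big1 => [|j ji]; rewrite !mxE ?eqxx/=.
    rewrite mul1r addr0 (bigD1 i)//= big1 => [|k ki]; rewrite !mxE ?eqxx ?mul1r ?addr0//.
    by rewrite (negbTE ki) mul0r.
  by rewrite (negbTE ji) mul0r.
have k0 : 0 <= invmx (G p) i i by rewrite -ww; exact: Gge0.
set k := invmx (G p) i i in ww k0 *; set x := v ord0 i in vw *.
have k1 : 0 < k + 1 by rewrite ltr_wpDl.
have := Gge0 p (- (x / (k + 1)) *: w + v).
rewrite -/(B p _ _) gram_formZDl !gram_formZDr (gram_formC p w v) vw ww.
set t := x / (k + 1).
have xE : x = t * (k + 1) by rewrite /t divfK// gt_eqF.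
rewrite xE => h; nra.
Qed.

(** Measurability is kept abstract because the components of a vector field at p refer to a chart
    depending on p, and only its components in a fixed chart can be expected to be measurable. The
    section serves both vector fields and, with n = 1, scalar functions. *)
Variable meas : set (T -> 'rV[R]_n).
Hypothesis measZD : forall (a : R) X Y, meas X -> meas Y -> meas (fun p => a *: X p + Y p).
Hypothesis meas_form : forall X Y, meas X -> meas Y ->
  measurable_fun setT (fun p => B p (X p) (Y p)).
Hypothesis meas_lim : forall (Y : nat -> T -> 'rV[R]_n) X A,
  (forall j, meas (Y j)) -> measurable A ->
  (forall p i, A p -> Y j p ord0 i @[j --> \oo] --> X p ord0 i) ->
  (forall p, ~ A p -> X p = 0) -> meas X.

Definition fieldL2 (X : T -> 'rV[R]_n) :=
  meas X /\ mu.-integrable setT (fun p => (B p (X p) (X p))%:E).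

Definition field_ip (X Y : T -> 'rV[R]_n) : R := \int[mu]_p B p (X p) (Y p).

Lemma field_ip_integrable X Y : fieldL2 X -> fieldL2 Y ->
  mu.-integrable setT (fun p => (B p (X p) (Y p))%:E).
Proof.
move=> [mX iX] [mY iY]; apply: (le_integrable _ _ _ (integrableD _ iX iY)) => //.
  by apply/measurable_EFinP; exact: meas_form.
move=> p _ /=; rewrite lee_fin [leRHS]ger0_norm ?addr_ge0 ?Gge0//.
have := gram_form_amgm p (X p) (Y p) ltr01; rewrite invr1 !mul1r.
have := normr_ge0 (B p (X p) (Y p)); lra.
Qed.

Lemma fieldL2ZD a X Y : fieldL2 X -> fieldL2 Y -> fieldL2 (fun p => a *: X p + Y p).
Proof.
move=> LX LY; split; first by apply: measZD; [exact: LX.1|exact: LY.1].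
have iXX := field_ip_integrable LX LX; have iXY := field_ip_integrable LX LY.
have iYY := field_ip_integrable LY LY.
have := integrableD measurableT (integrableZl measurableT (a ^+ 2) iXX)
  (integrableD measurableT (integrableZl measurableT (2 * a) iXY) iYY).
apply: eq_integrable => // p _ /=.
rewrite gram_formZDl !gram_formZDr (gram_formC p (Y p)) -!EFinM -!EFinD; congr EFin; ring.
Qed.

Lemma fieldL2B X Y : fieldL2 X -> fieldL2 Y -> fieldL2 (fun p => X p - Y p).
Proof.
move=> LX LY; have := fieldL2ZD (-1) LY LX; congr fieldL2.
by apply/funext => p; rewrite scaleN1r addrC.
Qed.

Lemma field_ipC X Y : field_ip X Y = field_ip Y X.
Proof. by apply: eq_Rintegral => p _; exact: gram_formC. Qed.

Lemma field_ip_ge0 X : 0 <= field_ip X X.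
Proof. by apply: Rintegral_ge0 => p _; exact: Gge0. Qed.

Lemma field_ipZD a X Y Z : fieldL2 X -> fieldL2 Y -> fieldL2 Z ->
  field_ip (fun p => a *: X p + Y p) Z = a * field_ip X Z + field_ip Y Z.
Proof.
move=> LX LY LZ; rewrite /field_ip.
under eq_Rintegral do rewrite gram_formZDl.
rewrite RintegralD//; last 2 first.
- exact: (integrableZl measurableT a (field_ip_integrable LX LZ)).
- exact: field_ip_integrable.
by rewrite RintegralZl//; exact: field_ip_integrable.
Qed.

Lemma field_ipB X Y Z : fieldL2 X -> fieldL2 Y -> fieldL2 Z ->
  field_ip (fun p => X p - Y p) Z = field_ip X Z - field_ip Y Z.
Proof.
move=> LX LY LZ; rewrite (_ : (fun p => _) = (fun p => -1 *: Y p + X p)).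
  by rewrite field_ipZD// mulN1r addrC.
by apply/funext => p; rewrite scaleN1r addrC.
Qed.

Lemma field_ip_amgm X Y t : 0 < t -> fieldL2 X -> fieldL2 Y ->
  2 * `|field_ip X Y| <= t * field_ip X X + t^-1 * field_ip Y Y.
Proof.
move=> t0 LX LY.
have iXX := field_ip_integrable LX LX; have iXY := field_ip_integrable LX LY.
have iYY := field_ip_integrable LY LY.
rewrite /field_ip -!RintegralZl// -RintegralD//; last 2 first.
- exact: (integrableZl measurableT t iXX).
- exact: (integrableZl measurableT t^-1 iYY).
apply: (@le_trans _ _ (\int[mu]_p (2 * `|B p (X p) (Y p)|))).
  have iN : mu.-integrable setT (EFin \o (fun p => `|B p (X p) (Y p)|)).
    exact: (integrable_norm iXY).
  rewrite RintegralZl//; apply: ler_wpM2l => //.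
  exact: le_normr_Rintegral.
apply: le_Rintegral => //.
- exact: (integrableZl measurableT 2 (integrable_norm iXY)).
- exact: (integrableD measurableT (integrableZl measurableT t iXX)
    (integrableZl measurableT t^-1 iYY)).
- by move=> p _; exact: gram_form_amgm.
Qed.

Lemma field_ip_triangle X Y Z : fieldL2 X -> fieldL2 Y -> fieldL2 Z ->
  field_ip (fun p => X p - Z p) (fun p => X p - Z p) <=
  2 * field_ip (fun p => X p - Y p) (fun p => X p - Y p) +
  2 * field_ip (fun p => Y p - Z p) (fun p => Y p - Z p).
Proof.
move=> LX LY LZ; have LXY := fieldL2B LX LY; have LYZ := fieldL2B LY LZ.
have LXZ := fieldL2B LX LZ.
have i1 := field_ip_integrable LXY LXY; have i2 := field_ip_integrable LYZ LYZ.
rewrite /field_ip -!RintegralZl// -RintegralD//; last 2 first.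
- exact: (integrableZl measurableT 2 i1).
- exact: (integrableZl measurableT 2 i2).
apply: le_Rintegral => //; first exact: field_ip_integrable.
  exact: (integrableD measurableT (integrableZl measurableT 2 i1)
    (integrableZl measurableT 2 i2)).
move=> p _; have := Gge0 p ((X p - Y p) - (Y p - Z p)).
rewrite -/(B p _ _) gram_formBB.
have -> : X p - Z p = 1 *: (X p - Y p) + (Y p - Z p) by rewrite scale1r addrA subrK.
rewrite gram_formZDl !gram_formZDr (gram_formC p (Y p - Z p) (X p - Y p)); lra.
Qed.

Lemma field_ip_cvg (X_ : nat -> T -> 'rV[R]_n) X Y :
  (forall k, fieldL2 (X_ k)) -> fieldL2 X -> fieldL2 Y ->
  field_ip (fun p => X_ k p - X p) (fun p => X_ k p - X p) @[k --> \oo] --> 0 ->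
  field_ip (X_ k) Y @[k --> \oo] --> field_ip X Y.
Proof.
move=> LX_ LX LY cX; apply/cvgrPdist_le => e e0.
(* Balances the weighted inequality: the Y term is at most e for this t, and the other one once the
   distance is below [e / t]. *)
pose t := (field_ip Y Y + 1) / e.
have Y0 := field_ip_ge0 Y.
have t0 : 0 < t by rewrite divr_gt0// ltr_wpDl.
move/cvgrPdist_le : cX => /(_ (e / t) (divr_gt0 e0 t0)) [N _ hN].
exists N => // k Nk; have := hN k Nk; rewrite /= sub0r normrN.
rewrite ger0_norm ?field_ip_ge0// => h.
rewrite distrC -field_ipB//.
have := field_ip_amgm t0 (fieldL2B (LX_ k) LX) LY.
have h1 : t * field_ip (fun p => X_ k p - X p) (fun p => X_ k p - X p) <= e.
  by rewrite mulrC -ler_pdivlMr.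
have h2 : t^-1 * field_ip Y Y <= e.
  by rewrite /t invfM invrK -mulrA ler_pdivrMl ?ltr_wpDl//; lra.
lra.
Qed.

Lemma gram_form_cvg p (v_ : nat -> 'rV[R]_n) v :
  (forall i, v_ j ord0 i @[j --> \oo] --> v ord0 i) ->
  B p (v_ j) (v_ j) @[j --> \oo] --> B p v v.
Proof.
move=> h; have BE (w : 'rV[R]_n) :
    B p w w = \sum_(k <- index_enum 'I_n)
      (\sum_(l <- index_enum 'I_n) w ord0 l * G p l k) * w ord0 k.
  by rewrite /B mxE; apply: eq_bigr => k _; rewrite !mxE.
rewrite BE; under eq_cvg do rewrite BE.
apply: cvg_bigsum => k; apply: cvgM; last exact: h.
by apply: cvg_bigsum => l; apply: cvgM; [exact: h|exact: cvg_cst].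
Qed.

(** Riesz-Fischer: a fast subsequence converges in coordinates outside a null set, and Fatou's lemma
    carries the Cauchy bounds of the whole sequence to the limit. *)
Lemma fieldL2_complete (X_ : nat -> T -> 'rV[R]_n) : (forall k, fieldL2 (X_ k)) ->
  (forall e : R, 0 < e -> exists N, forall m k, (N <= m)%N -> (N <= k)%N ->
    field_ip (fun p => X_ m p - X_ k p) (fun p => X_ m p - X_ k p) < e) ->
  exists2 X, fieldL2 X &
    field_ip (fun p => X_ k p - X p) (fun p => X_ k p - X p) @[k --> \oo] --> 0.
Proof.
move=> LX cX.
have /choice [K hK] : forall j, exists N, forall m k, (N <= m)%N -> (N <= k)%N ->
    field_ip (fun p => X_ m p - X_ k p) (fun p => X_ m p - X_ k p) < 16 ^- j.
  by move=> j; apply: cX; rewrite invr_gt0 exprn_gt0.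
(* Cumulative sums make the indices monotone and at least [K j]; the summand j makes them tend to
   infinity. *)
pose K' j := (j + \sum_(i < j.+1) K i)%N.
have KK' j : (K j <= K' j)%N by rewrite /K' big_ord_recr/= addnA leq_addl.
have K'S j : (K' j <= K' j.+1)%N.
  by rewrite /K' [X in (_ <= _ + X)%N]big_ord_recr/= leq_add// leq_addr.
pose Y j := X_ (K' j).
have LY j : fieldL2 (Y j) by exact: LX.
have ipE Z : fieldL2 Z -> (\int[mu]_p (B p (Z p) (Z p))%:E = (field_ip Z Z)%:E)%E.
  move=> LZ; rewrite /field_ip /Rintegral fineK//.
  exact: integrable_fin_num (field_ip_integrable LZ LZ).
have mZ Z : meas Z -> measurable_fun setT (fun p => B p (Z p) (Z p)).
  by move=> mZ'; exact: meas_form.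
have LYY j := fieldL2B (LY j.+1) (LY j).
pose a j p := B p (Y j.+1 p - Y j p) (Y j.+1 p - Y j p).
have [||j|A [mA A0 hA]] := @ae_geometric_bound _ _ _ mu a.
- by move=> j; apply: mZ; exact: (LYY j).1.
- by move=> j p; exact: Gge0.
- rewrite /a (ipE _ (LYY j)) lee_fin; apply: ltW; apply: hK => //.
  exact: leq_trans (KK' j) (K'S j).
(* The value 0 on the exceptional set is what [meas_lim] requires. *)
pose X p : 'rV[R]_n := if p \in A then \row_i limn (fun j => Y j p ord0 i) else 0.
have YX p i : A p -> Y j p ord0 i @[j --> \oo] --> X p ord0 i.
  move=> Ap; rewrite /X mem_set// mxE.
  have [C hC] := hA _ Ap.
  have k0 : 0 <= invmx (G p) i i + 1.
    have := gram_form_coord p (delta_mx ord0 i) i; rewrite mxE !eqxx/= expr1n.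
    have := Gge0 p (delta_mx ord0 i); rewrite -/(B p _ _) => h1 h2.
    by rewrite leNgt; apply/negP => h3; have := ltr01 (R := R); nra.
  have C0 : 0 <= C by have := le_trans (Gge0 p _) (hC 0%N); rewrite expr0 invr1 mulr1.
  apply: (@geometric_increments_cvg _ _ (Num.sqrt ((invmx (G p) i i + 1) * C))) => j.
  rewrite -(ler_pXn2r (_ : 0 < 2)%N)// ?nnegrE ?mulr_ge0 ?sqrtr_ge0 ?invr_ge0 ?exprn_ge0//.
  rewrite real_normK ?num_real// exprMn sqr_sqrtr ?mulr_ge0//.
  rewrite (_ : (2 ^- j) ^+ 2 = 4 ^- j); last first.
    by rewrite -!exprVn -exprM mulnC exprM exprVn -natrX.
  have := gram_form_coord p (Y j.+1 p - Y j p) i; rewrite !mxE => h.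
  by apply: le_trans h _; rewrite -mulrA ler_wpM2l//; exact: hC.
have mX : meas X.
  apply: (@meas_lim Y X A) => //.
  - by move=> j; exact: (LY j).1.
  - by move=> p Ap; rewrite /X memNset.
have mB Z W : meas Z -> meas W -> meas (fun p => Z p - W p).
  move=> h1 h2; have := measZD (-1) h2 h1; congr meas.
  by apply/funext => p; rewrite scaleN1r addrC.
(* Stated for the extended integral, since X is not yet known to be square integrable; that is
   deduced afterwards from [X_ N - X]. *)
have key e m : 0 < e -> (forall k, (m <= k)%N ->
      field_ip (fun p => X_ m p - X_ k p) (fun p => X_ m p - X_ k p) <= e) ->
    (\int[mu]_p (B p (X_ m p - X p) (X_ m p - X p))%:E <= e%:E)%E.
  move=> e0 he.
  have mXm : measurable_fun setT (fun p => (B p (X_ m p - X p) (X_ m p - X p))%:E).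
    by apply/measurable_EFinP; apply: mZ; apply: mB => //; exact: (LX m).1.
  rewrite (@ge0_negligible_integral _ _ _ mu setT (~` A))//; last 2 first.
  - exact: measurableC.
  - by move=> p _; rewrite lee_fin; exact: Gge0.
  rewrite setDE setCK setTI.
  apply: (@fatou_le _ _ _ mu A (fun j p => B p (X_ m p - Y j p) (X_ m p - Y j p))) => //.
  - by move=> j; apply: mZ; apply: mB; [exact: (LX m).1|exact: (LY j).1].
  - by move=> j p; exact: Gge0.
  - move=> p Ap; apply: gram_form_cvg => i.
    under eq_cvg do rewrite !mxE.
    by rewrite !mxE; apply: cvgB; [exact: cvg_cst|exact: YX].
  exists m => // j mj.
  apply: (@le_trans _ _ (\int[mu]_p (B p (X_ m p - Y j p) (X_ m p - Y j p))%:E)%E).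
    apply: ge0_subset_integral => //.
      by apply/measurable_EFinP; apply: mZ; apply: mB; [exact: (LX m).1|exact: (LY j).1].
    by move=> p _; rewrite lee_fin; exact: Gge0.
  rewrite (ipE _ (fieldL2B (LX m) (LY j))) lee_fin; apply: he.
  by apply: leq_trans mj _; exact: leq_addr.
have [N hN] := cX 1 ltr01.
have LZ : fieldL2 (fun p => X_ N p - X p).
  have m1 : meas (fun p => X_ N p - X p) by apply: mB => //; exact: (LX N).1.
  split => //; apply/integrableP; split; first by apply/measurable_EFinP; exact: mZ.
  apply: (@le_lt_trans _ _ 1%:E); last exact: ltry.
  under eq_integral do rewrite gee0_abs ?lee_fin ?Gge0//.
  by apply: key => // k Nk; apply: ltW; exact: hN.
have LX' : fieldL2 X.
  have := fieldL2ZD (-1) LZ (LX N); congr fieldL2.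
  by apply/funext => p; rewrite scaleN1r opprB subrK.
exists X => //; apply/cvgrPdist_le => e e0; have [N' hN'] := cX e e0.
exists N' => // m Nm; rewrite /= sub0r normrN ger0_norm ?field_ip_ge0//.
rewrite -lee_fin -(ipE _ (fieldL2B (LX m) LX')); apply: key => // k mk.
by apply: ltW; apply: hN' => //; exact: leq_trans mk.
Qed.

End FieldL2.

(** * Calculus in coordinates *)

Section MatrixNorm.
Context {R : realType}.

Lemma mx_entry_le_norm m n (x : 'M[R]_(m, n)) i j : `|x i j| <= `|x|.
Proof.
by rewrite [leRHS]/Num.Def.normr/= mx_normrE; exact: (le_bigmax _ _ (i, j)).
Qed.

Lemma mx_norm_le m n (x : 'M[R]_(m, n)) (e : R) : 0 <= e ->
  (forall i j, `|x i j| <= e) -> `|x| <= e.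
Proof.
move=> e0 xe; rewrite /Num.Def.normr/= mx_normrE.
by apply: bigmax_le => // -[i j] _; exact: xe.
Qed.

End MatrixNorm.

(** * Splitting off the first coordinate *)

Section Cons.
Context {R : realType} (d : nat).

(** The scalar is placed in front, exactly as in the recursion of [lebesgue_integral_rV]. *)
Definition rcons_mx (t : R) (y : 'rV[R]_d) : 'rV[R]_d.+1 :=
  row_mx (const_mx t : 'rV[R]_1) y.

Lemma rcons_mxE (t : R) (y : 'rV[R]_d) (i : 'I_d.+1) :
  rcons_mx t y ord0 i = match fintype.split (i : 'I_(1 + d)) with
    | inl _ => t | inr j => y ord0 j end.
Proof. by rewrite /rcons_mx mxE; case: fintype.split => // a; rewrite mxE. Qed.

Lemma rcons_mx_lin (h a b : R) (y z : 'rV[R]_d) :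
  h *: rcons_mx a y + rcons_mx b z = rcons_mx (h * a + b) (h *: y + z).
Proof.
apply/matrixP => i j; rewrite (ord1 i) [LHS]mxE [X in X + _]mxE !rcons_mxE.
by case: fintype.split => // k; rewrite !mxE.
Qed.

Lemma rcons_mx_norm_le (t : R) (y : 'rV[R]_d) e : `|t| <= e -> `|y| <= e ->
  `|rcons_mx t y| <= e.
Proof.
move=> te ye; apply: mx_norm_le => [|i j]; first exact: le_trans te.
rewrite (ord1 i) rcons_mxE; case: fintype.split => // k.
exact: le_trans (mx_entry_le_norm _ _ _) ye.
Qed.

Lemma rcons_mx_normr (t : R) (y : 'rV[R]_d) : `|y| <= `|rcons_mx t y|.
Proof.
apply: mx_norm_le => // i j; rewrite (ord1 i).
have := mx_entry_le_norm (rcons_mx t y) ord0 (rshift 1 j).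
by rewrite rcons_mxE (unsplitK (inr j : 'I_1 + 'I_d)).
Qed.

Lemma rcons_mx_norml (t : R) (y : 'rV[R]_d) : `|t| <= `|rcons_mx t y|.
Proof.
have := mx_entry_le_norm (rcons_mx t y) ord0 (lshift d (ord0 : 'I_1)).
by rewrite rcons_mxE (unsplitK (inl ord0 : 'I_1 + 'I_d)).
Qed.

Lemma rcons_mx_continuous : continuous (fun ty : R * 'rV[R]_d => rcons_mx ty.1 ty.2).
Proof.
move=> [t y]; apply/cvgrPdist_le => e e0.
near=> z.
have -> : rcons_mx (t, y).1 (t, y).2 - rcons_mx z.1 z.2 =
    rcons_mx (t - z.1) (y - z.2).
  rewrite addrC -scaleN1r rcons_mx_lin; congr rcons_mx; first by rewrite mulN1r addrC.
  by rewrite scaleN1r addrC.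
apply: rcons_mx_norm_le; near: z.
  have : (fun z : R * 'rV[R]_d => z.1) z @[z --> (t, y)] --> t by exact: cvg_fst.
  by move/cvgrPdist_le; exact.
have : (fun z : R * 'rV[R]_d => z.2) z @[z --> (t, y)] --> y by exact: cvg_snd.
by move/cvgrPdist_le; exact.
Unshelve. all: by end_near. Qed.

Lemma rcons_mx_continuousr (t : R) : continuous (rcons_mx t).
Proof.
move=> y; suff : rcons_mx t z @[z --> nbhs y] --> rcons_mx t y by [].
apply/cvgrPdist_le => e e0.
apply: filterS (nbhsx_ballx y e e0) => z; rewrite -ball_normE /= => /ltW yz.
rewrite addrC -scaleN1r rcons_mx_lin mulN1r addNr scaleN1r addrC.
by apply: rcons_mx_norm_le => //; rewrite normr0 ltW.
Qed.

Lemma rcons_mx_lshift (t : R) (y : 'rV[R]_d) (j : 'I_1) :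
  rcons_mx t y ord0 (lshift d j) = t.
Proof. by rewrite (rcons_mxE _ _ (unsplit (inl j : 'I_1 + 'I_d))) unsplitK. Qed.

Lemma rcons_mx_rshift (t : R) (y : 'rV[R]_d) (j : 'I_d) :
  rcons_mx t y ord0 (rshift 1 j) = y ord0 j.
Proof. by rewrite (rcons_mxE _ _ (unsplit (inr j : 'I_1 + 'I_d))) unsplitK. Qed.

Lemma basis_vec_lshift (j : 'I_1) : basis_vec R (lshift d j) = rcons_mx 1 0.
Proof.
apply/matrixP => a b; rewrite (ord1 a) mxE /= (ord1 j).
case: (split_ordP b) => k ->; first by rewrite rcons_mx_lshift (ord1 k) eqxx.
by rewrite rcons_mx_rshift eq_rlshift mxE.
Qed.

Lemma basis_vec_rshift (j : 'I_d) :
  basis_vec R (rshift 1 j) = rcons_mx 0 (basis_vec R j).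
Proof.
apply/matrixP => a b; rewrite (ord1 a) mxE /=.
case: (split_ordP b) => k ->; first by rewrite rcons_mx_lshift eq_lrshift.
by rewrite rcons_mx_rshift eq_rshift mxE eqxx.
Qed.

(** Joint continuity gives for each y a neighbourhood of (t, y); compactness of K leaves finitely
    many of them and so makes the closeness of s to t uniform in y. *)
Lemma near_slice (G : 'rV[R]_d.+1 -> R) (K : set 'rV[R]_d) (t e : R) :
  continuous G -> compact K -> 0 < e ->
  \forall s \near t, forall y, K y ->
    `|G (rcons_mx t y) - G (rcons_mx s y)| < e.
Proof.
move=> cG /compact_near_coveringP cK e0.
apply: (cK _ (nbhs t) (fun s y => `|G (rcons_mx t y) - G (rcons_mx s y)| < e) _) => y Ky.
have cGc : {for (t, y), continuous (fun ty : R * 'rV[R]_d => G (rcons_mx ty.1 ty.2))}.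
  exact: (continuous_comp (@rcons_mx_continuous (t, y)) (@cG _)).
have e2 : 0 < e / 2 by rewrite divr_gt0.
move/cvgrPdist_lt : cGc => /(_ _ e2) [[/= A B] [At By] AB].
exists (B, A) => //= -[y' s] /= [By' As].
have := AB (s, y') (conj As By'); have := AB (t, y') (conj (nbhs_singleton At) By').
rewrite /= => h1 h2.
rewrite (splitr e) -(subrKA (G (rcons_mx t y))).
by rewrite (le_lt_trans (ler_normD _ _))// ltrD// distrC.
Qed.

End Cons.

(** * Compactly supported functions of one variable *)

Section OneDim.
Context {R : realType}.
Notation mu := (@lebesgue_measure R).
Variables (r : R) (f : R -> R).
Hypotheses (r0 : 0 <= r) (cf : continuous f) (f0 : forall t, r < `|t| -> f t = 0).

Let fE : f = f \_ `[- r, r].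
Proof.
apply/funext => t; rewrite patchE; case: ifPn => // /negP tr; apply: f0.
rewrite ltNge; apply/negP => /ler_normlP [h1 h2]; apply: tr.
by rewrite inE/= in_itv/= h2 andbT lerNl.
Qed.

Lemma ccts1_integrable : mu.-integrable setT (EFin \o f).
Proof.
rewrite fE -restrict_EFin; apply/(integrable_mkcond _ _).1 => //.
apply: continuous_compact_integrable; first exact: segment_compact.
exact: continuous_subspaceT.
Qed.

Lemma ccts1_Rintegral_le (B : R) : (forall t, `|f t| <= B) ->
  `|\int[mu]_t f t| <= 2 * r * B.
Proof.
move=> fB; have B0 : 0 <= B by exact: le_trans (fB 0).
rewrite fE -Rintegral_mkcond.
have mI : measurable (`[- r, r] : set R) by exact: measurable_itv.
have iI : mu.-integrable `[- r, r] (EFin \o f).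
  apply: continuous_compact_integrable; first exact: segment_compact.
  exact: continuous_subspaceT.
apply: (le_trans (le_normr_Rintegral _ iI)) => //.
apply: (@le_trans _ _ (\int[mu]_(t in `[- r, r]) B)).
  apply: le_Rintegral => //.
    exact: (integrable_norm iI).
  apply: continuous_compact_integrable; first exact: segment_compact.
  by apply: continuous_subspaceT => x; exact: cvg_cst.
have := @lebesgue_measure_itv R `[- r, r]%R; rewrite Rintegral_cst//= => ->.
rewrite lte_fin.
case: ifPn => _ /=; last first.
  by rewrite mulr0 !mulr_ge0.
by rewrite opprK mulrC ler_wpM2r//; lra.
Qed.

Lemma ccts1_Rintegral_gt0 t0 : (forall t, 0 <= f t) -> 0 < f t0 ->
  0 < \int[mu]_t f t.
Proof.
move=> fp ft0.
have e2 : 0 < f t0 / 2 by rewrite divr_gt0.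
have := @cf t0; move/cvgrPdist_lt => /(_ _ e2) [e /= e0 he].
pose a := t0 - e / 2; pose b := t0 + e / 2.
have mI : measurable (`[a, b] : set R) by exact: measurable_itv.
have icst : mu.-integrable (`[a, b] : set R) (EFin \o (fun=> f t0 / 2)).
  apply: continuous_compact_integrable; first exact: segment_compact.
  by apply: continuous_subspaceT => x; exact: cvg_cst.
apply: (@lt_le_trans _ _ (\int[mu]_(t in `[a, b]) (f t0 / 2))).
  have := @lebesgue_measure_itv R `[a, b]%R; rewrite Rintegral_cst//= => ->.
  rewrite lte_fin ifT; last first.
    by rewrite /a /b; lra.
  by rewrite /= mulr_gt0// /a /b; lra.
rewrite Rintegral_mkcond; apply: le_Rintegral => //.
- by rewrite -restrict_EFin; apply/(integrable_mkcond _ _).1.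
- exact: ccts1_integrable.
move=> t _; rewrite patchE; case: ifPn => // /[!inE]/= /[!in_itv]/= /andP[h1 h2].
have : `|f t0 - f t| < f t0 / 2.
  apply: he; rewrite /= ltr_norml; apply/andP; rewrite /a /b in h1 h2; lra.
rewrite ltr_norml => /andP[_ ?]; lra.
Qed.

Lemma ccts1_Rintegral_derive (F : R -> R) :
  (forall t : R, is_derive t (1 : R) F (f t)) -> (forall t : R, r < `|t| -> F t = 0) ->
  \int[mu]_t f t = 0.
Proof.
(* One unit beyond r, because F is only known to vanish where [r < |t|]; both boundary terms are
   then zero. *)
move=> dF F0; pose a := - (r + 1); pose b := r + 1.
have ab : a < b by rewrite /a /b gtrN// ltr_wpDl.
have cF : continuous F.
  by move=> t; apply/differentiable_continuous/derivable1_diffP; case: (dF t).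
have -> : f = f \_ `[a, b].
  apply/funext => t; rewrite patchE; case: ifPn => // /negP tr; apply: f0.
  rewrite ltNge; apply/negP => /ler_normlP [h1 h2]; apply: tr.
  rewrite inE/= in_itv/=; apply/andP; split.
    by rewrite /a lerNl (le_trans h1)// lerDl.
  by rewrite /b (le_trans h2)// lerDl.
rewrite -Rintegral_mkcond /Rintegral (@continuous_FTC2 _ f F)//.
- have Fa : F a = 0 by apply: F0; rewrite /a normrN ger0_norm ?ltrDl// addr_ge0.
  have Fb : F b = 0 by apply: F0; rewrite /b ger0_norm ?ltrDl// addr_ge0.
  by rewrite Fa Fb/= subrr.
- exact: continuous_subspaceT.
- split; [by move=> t _; case: (dF t)| |].
  + by apply: cvg_at_right_filter; exact: cF.
  + by apply: cvg_at_left_filter; exact: cF.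
- by move=> t _; rewrite derive1E; apply: derive_val.
Qed.

End OneDim.

(** * Iterated integrals of continuous functions with compact support *)

Section IteratedIntegral.
Context {R : realType}.
Notation mu := (@lebesgue_measure R).

(** Real-valued counterpart of [lebesgue_integral_rV], meaningful for signed functions; the two
    agree on [ccts] functions. *)
Fixpoint iterated_Rintegral (d : nat) : ('rV[R]_d -> R) -> R :=
  match d with
  | 0%N => fun F => F 0
  | d'.+1 => fun F => \int[mu]_t iterated_Rintegral (fun y => F (rcons_mx t y))
  end.

Local Notation rI := iterated_Rintegral.

(** The norm is the maximum norm, so the support lies in a cube and every slice is again [ccts] with
    the same r. *)
Definition ccts d (r : R) (F : 'rV[R]_d -> R) :=
  continuous F /\ forall x, r < `|x| -> F x = 0.

Lemma ccts0 d (r : R) : ccts r ((fun=> 0) : 'rV[R]_d -> R).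
Proof. by split=> // x; exact: cst_continuous. Qed.

Lemma cctsZD d (r a : R) (F G : 'rV[R]_d -> R) : ccts r F -> ccts r G ->
  ccts r (fun x => a * F x + G x).
Proof.
move=> [cF F0] [cG G0]; split=> [x|x rx]; last by rewrite F0// G0// mulr0 addr0.
exact: (cvgD (cvgM (cvg_cst a) (@cF x)) (@cG x)).
Qed.

Lemma ccts_slice d (r : R) (F : 'rV[R]_d.+1 -> R) t : ccts r F ->
  ccts r (fun y => F (rcons_mx t y)).
Proof.
move=> [cF F0]; split=> [y|y ry].
  exact: (continuous_comp (@rcons_mx_continuousr _ _ t y) (@cF _)).
by apply: F0; apply: lt_le_trans ry _; exact: rcons_mx_normr.
Qed.

Lemma closed_ball_compact d (r : R) : compact [set y : 'rV[R]_d | `|y| <= r].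
Proof.
apply: bounded_closed_compact.
  exists r; split; first exact: num_real.
  by move=> s rs y /= yr; apply: le_trans yr (ltW rs).
apply: (@closed_comp _ _ (fun y : 'rV[R]_d => `|y|) [set s | s <= r]).
  by move=> y _; exact: norm_continuous.
exact: closed_le.
Qed.

Lemma near_slice_ccts d (r : R) (F : 'rV[R]_d.+1 -> R) (t e : R) : ccts r F -> 0 < e ->
  \forall s \near t, forall y, `|F (rcons_mx t y) - F (rcons_mx s y)| <= e.
Proof.
move=> [cF F0] e0; near=> s => y.
have [yr|yr] := leP `|y| r.
  apply: ltW; move: y yr; near: s.
  exact: (@near_slice _ _ F _ _ _ cF (@closed_ball_compact d r) e0).
by rewrite !F0 ?subrr ?normr0 ?ltW//; apply: lt_le_trans yr _; exact: rcons_mx_normr.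
Unshelve. all: by end_near. Qed.

(** Bundled for a single induction: in dimension d + 1 each fact reduces to one about the slice
    integral as a function of the first coordinate, whose continuity already rests on the bound and
    the linearity in dimension d. *)
Let facts d (r : R) := [/\
  forall F (B : R), @ccts d r F -> (forall x, `|F x| <= B) -> `|rI F| <= (2 * r) ^+ d * B,
  forall (a : R) F G, @ccts d r F -> @ccts d r G ->
    rI (fun x => a * F x + G x) = a * rI F + rI G,
  forall F, @ccts d r F -> lebesgue_integral_rV (fun x => (F x)%:E) = (rI F)%:E &
  forall F, @ccts d r F -> (forall x, 0 <= F x) -> 0 <= rI F /\
    ((exists x, 0 < F x) -> 0 < rI F)].

Lemma ccts_iterated_slice d (r : R) (F : 'rV[R]_d.+1 -> R) : 0 <= r -> facts d r ->
  ccts r F -> continuous (fun t => rI (fun y => F (rcons_mx t y))) /\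
    forall t, r < `|t| -> rI (fun y => F (rcons_mx t y)) = 0.
Proof.
move=> r0 [bnd lin _ _] cF.
have rIB G H : @ccts d r G -> @ccts d r H -> rI G - rI H = rI (fun y => G y - H y).
  move=> cG cH; rewrite (_ : (fun y => _) = (fun y => -1 * H y + G y)).
    by rewrite lin// mulN1r addrC.
  by apply/funext => y; rewrite mulN1r addrC.
split=> [t|t rt]; last first.
  (* The slice is zero; writing it as -G + G lets linearity give integral zero in every
     dimension. *)
  have -> : (fun y => F (rcons_mx t y)) = (fun y => -1 * F (rcons_mx t y) + F (rcons_mx t y)).
    apply/funext => y; rewrite cF.2 ?mulr0 ?addr0//.
    by apply: lt_le_trans rt _; exact: rcons_mx_norml.
  by rewrite lin ?mulN1r ?addNr//; exact: ccts_slice.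
apply/cvgrPdist_le => e e0.
have c0 : 0 <= (2 * r) ^+ d by rewrite exprn_ge0// mulr_ge0.
pose e' := e / ((2 * r) ^+ d + 1).
have e'0 : 0 < e' by rewrite divr_gt0// ltr_wpDl.
near=> s.
rewrite rIB; [|exact: ccts_slice..].
have -> : (fun y => F (rcons_mx t y) - F (rcons_mx s y)) =
    (fun y => -1 * F (rcons_mx s y) + F (rcons_mx t y)).
  by apply/funext => y; rewrite mulN1r addrC.
apply: (@le_trans _ _ ((2 * r) ^+ d * e')).
  apply: bnd; first by apply: cctsZD; exact: ccts_slice.
  move=> y; rewrite mulN1r addrC; move: y; near: s.
  exact: near_slice_ccts cF e'0.
rewrite /e' mulrCA ger_pMr// ler_pdivrMr ?mul1r; last by rewrite ltr_wpDl.
by rewrite lerDl.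
Unshelve. all: by end_near. Qed.

Lemma iterated_facts d (r : R) : 0 <= r -> facts d r.
Proof.
move=> r0; elim: d => [|d IH].
  split.
  - by move=> F B _ FB; rewrite expr0 mul1r; exact: FB.
  - by move=> a F G _ _ /=.
  - by [].
  - move=> F _ F0; split; first exact: F0.
    by move=> [x]; rewrite (_ : x = 0)//; apply/matrixP => i [].
have [bnd lin ext pos] := IH.
have sl F t : @ccts d.+1 r F -> @ccts d r (fun y => F (rcons_mx t y)).
  by move=> ?; exact: ccts_slice.
have c1 F : @ccts d.+1 r F -> _ := @ccts_iterated_slice d r F r0 IH.
split.
- move=> F B cF FB /=; have [h1 h2] := c1 _ cF.
  have := @ccts1_Rintegral_le R r _ r0 h1 h2 ((2 * r) ^+ d * B).
  rewrite (_ : _ ^+ d.+1 * B = 2 * r * ((2 * r) ^+ d * B)); last by rewrite exprS; ring.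
  apply => t.
  by apply: bnd => [|y]; [exact: sl|exact: FB].
- move=> a F G cF cG /=; have [h1 h2] := c1 _ cF; have [h3 h4] := c1 _ cG.
  transitivity (\int[mu]_t (a * rI (fun y => F (rcons_mx t y)) + rI (fun y => G (rcons_mx t y)))).
    by apply: eq_Rintegral => t _; rewrite lin//; exact: sl.
  have iF := ccts1_integrable h1 h2; have iG := ccts1_integrable h3 h4.
  rewrite RintegralD//; last exact: (integrableZl _ a iF).
  by rewrite RintegralZl.
- move=> F cF /=; have [h1 h2] := c1 _ cF.
  rewrite /Rintegral fineK; last exact: integrable_fin_num (ccts1_integrable h1 h2).
  by apply: eq_integral => t _; rewrite -ext//; exact: sl.
- move=> F cF F0 /=; have [h1 h2] := c1 _ cF.
  have h5 t : 0 <= rI (fun y => F (rcons_mx t y)) by apply: (pos _ (sl _ _ cF) _).1.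
  split; first by apply: Rintegral_ge0 => t _; exact: h5.
  move=> [x Fx].
  pose t0 := x ord0 (lshift d (ord0 : 'I_1)).
  pose y0 : 'rV[R]_d := \row_j x ord0 (rshift 1 j).
  have xE : x = rcons_mx t0 y0.
    apply/matrixP => i j; rewrite (ord1 i); case: (split_ordP (j : 'I_(1 + d))) => k ->.
      by rewrite rcons_mx_lshift (ord1 k).
    by rewrite rcons_mx_rshift mxE.
  apply: (@ccts1_Rintegral_gt0 _ r _ h1 h2 t0 h5).
  by apply: (pos _ (sl _ _ cF) _).2 => //; exists y0; rewrite -xE.
Qed.

Section Facts.
Variables (d : nat) (r : R).
Hypothesis r0 : 0 <= r.
Implicit Types F G : 'rV[R]_d -> R.

Lemma iterated_Rintegral_le F (B : R) : ccts r F -> (forall x, `|F x| <= B) ->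
  `|rI F| <= (2 * r) ^+ d * B.
Proof. by case: (iterated_facts d r0) => + _ _ _; exact. Qed.

Lemma iterated_RintegralZD (a : R) F G : ccts r F -> ccts r G ->
  rI (fun x => a * F x + G x) = a * rI F + rI G.
Proof. by case: (iterated_facts d r0) => _ + _ _; exact. Qed.

Lemma lebesgue_integral_rV_ccts F : ccts r F ->
  lebesgue_integral_rV (fun x => (F x)%:E) = (rI F)%:E.
Proof. by case: (iterated_facts d r0) => _ _ + _; exact. Qed.

Lemma iterated_Rintegral_gt0 F x : ccts r F -> (forall x, 0 <= F x) ->
  0 < F x -> 0 < rI F.
Proof.
case: (iterated_facts d r0) => _ _ _ + cF F0 Fx => /(_ F cF F0)[_]; apply.
by exists x.
Qed.

End Facts.

Lemma MVT_between (f g : R -> R) a b : (forall t : R, is_derive t (1 : R) f (g t)) ->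
  exists2 c, `|a - c| <= `|a - b| & f b - f a = g c * (b - a).
Proof.
move=> df; have cf : continuous f.
  by move=> t; apply/differentiable_continuous/derivable1_diffP; case: (df t).
have [ab|/ltW ba] := leP a b.
  have [c /[!in_itv]/= /andP[ac cb] E] := MVT_segment ab (fun t _ => df t) (continuous_subspaceT cf).
  by exists c => //; rewrite ![`|a - _|]distrC !ger0_norm ?subr_ge0// lerD2r.
have [c /[!in_itv]/= /andP[bc ca] E] := MVT_segment ba (fun t _ => df t) (continuous_subspaceT cf).
exists c; first by rewrite !ger0_norm ?subr_ge0// lerD2l lerN2.
by rewrite -opprB E -mulrN opprB.
Qed.

Lemma partial_ccts_eq0 d (r : R) (F : 'rV[R]_d -> R) i x : ccts r F -> r < `|x| ->
  partial i F x = 0.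
Proof.
move=> [cF F0] rx; rewrite /partial.
have [->|v0] := eqVneq (basis_vec R i) 0; first by rewrite derive0.
rewrite (@near_eq_derive _ _ _ F (cst 0)) ?derive_cst//.
have : \forall y \near x, r < `|y|.
  have := @norm_continuous _ _ x; move/cvgr_gt; exact.
by apply: filterS => y ry; rewrite F0.
Qed.

(** For the first coordinate, the slice integral of the derivative is the derivative of the slice
    integral, which has compact support, and the fundamental theorem of calculus applies. For
    another coordinate, the induction hypothesis makes every slice integral zero. *)
Lemma iterated_Rintegral_partial d (r : R) (F : 'rV[R]_d -> R) i : 0 <= r -> ccts r F ->
  (forall x : 'rV[R]_d, derivable F x (basis_vec R i)) -> continuous (partial i F) ->
  rI (partial i F) = 0.
Proof.
move=> r0; elim: d F i => [F []//|d IH] F i cF dF cG.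
have cGr : ccts r (partial i F).
  by split=> // x rx; exact: partial_ccts_eq0 cF rx.
have [h1 h2] := ccts_iterated_slice r0 (iterated_facts d r0) cF.
have [h3 h4] := ccts_iterated_slice r0 (iterated_facts d r0) cGr.
rewrite /=; move: (dF) (cG) (cGr) (h3) (h4); case: (split_ordP (i : 'I_(1 + d)))
  => j -> {}dF {}cG {}cGr {}h3 {}h4.
- (* Differentiation under the integral sign: the difference quotients of the
     slices converge uniformly, by the mean value theorem and compact support. *)
  have dslice y t : is_derive (t : R) (1 : R) (fun t => F (rcons_mx t y))
      (partial (lshift d j) F (rcons_mx t y)).
    have E : (fun h : R => h^-1 *: (F (rcons_mx (h *: 1 + t) y) - F (rcons_mx t y))) =
        (fun h => h^-1 *: (F (h *: basis_vec R (lshift d j) + rcons_mx t y) -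
          F (rcons_mx t y))).
      by apply/funext => h; rewrite basis_vec_lshift rcons_mx_lin scaler0 add0r.
    have := dF (rcons_mx t y); rewrite /derivable -E => dv.
    by split; [exact: dv|rewrite /partial /derive -E].
  apply: (ccts1_Rintegral_derive r0 h3 h4 _ h2) => t.
  suff cv : h^-1 *: (rI (fun y => F (rcons_mx (h *: 1 + t) y)) - rI (fun y => F (rcons_mx t y)))
      @[h --> 0^'] --> rI (fun y => partial (lshift d j) F (rcons_mx t y)).
    by split; [apply/cvg_ex; eexists; exact: cv|exact: cvg_lim cv].
  apply/cvgrPdist_le => e e0.
  have c0 : 0 <= (2 * r) ^+ d by rewrite exprn_ge0// mulr_ge0.
  pose e' := e / ((2 * r) ^+ d + 1).
  have e'0 : 0 < e' by rewrite divr_gt0// ltr_wpDl.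
  have [dl /= dl0 hdl] := near_slice_ccts t cGr e'0.
  near=> h.
  have h0 : h != 0 by near: h; exact: nbhs_dnbhs_neq.
  have hd : `|h| < dl by near: h; exact: dnbhs0_lt.
  (* The combination is nested, with a final [+ 0], so that linearity in the shape [a * F + G]
     applies to each summand. *)
  have -> : rI (fun y => partial (lshift d j) F (rcons_mx t y)) -
      h^-1 *: (rI (fun y => F (rcons_mx (h *: 1 + t) y)) - rI (fun y => F (rcons_mx t y))) =
      rI (fun y => 1 * partial (lshift d j) F (rcons_mx t y) +
        (- h^-1 * F (rcons_mx (h *: 1 + t) y) + (h^-1 * F (rcons_mx t y) + 0))).
    have sl G s : @ccts d.+1 r G -> @ccts d r (fun y => G (rcons_mx s y)).
      by move=> ?; exact: ccts_slice.
    rewrite !(iterated_RintegralZD r0)//; do ?[exact: sl|exact: ccts0|apply: cctsZD].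
    have -> : rI (fun y : 'rV[R]_d => 0) = 0.
      have := iterated_RintegralZD r0 (-1) (@ccts0 d r) (@ccts0 d r).
      have -> : (fun x : 'rV[R]_d => -1 * 0 + 0) = (fun=> 0 : R).
        by apply/funext => y; rewrite mulr0 addr0.
      by move=> ->; rewrite mulN1r addNr.
    by rewrite /GRing.scale/=; ring.
  apply: (@le_trans _ _ ((2 * r) ^+ d * e')).
    apply: (iterated_Rintegral_le r0).
      by do ?[exact: ccts_slice|exact: ccts0|apply: cctsZD].
    move=> y; rewrite addr0 mul1r.
    have [c ct E] := MVT_between t (h *: 1 + t) (dslice y).
    have -> : - h^-1 * F (rcons_mx (h *: 1 + t) y) + h^-1 * F (rcons_mx t y) =
        - partial (lshift d j) F (rcons_mx c y).
      rewrite mulNr addrC -mulNr -[LHS]opprK; congr (- _).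
      rewrite opprD -!mulNr opprK mulNr addrC -mulrBr E.
      by rewrite addrK /GRing.scale/= mulr1 mulrCA mulVf ?mulr1.
    apply: hdl => /=; apply: le_lt_trans ct _.
    by rewrite opprD addrCA subrr addr0 normrN /GRing.scale/= mulr1.
  rewrite /e' mulrCA ger_pMr// ler_pdivrMr ?mul1r; last by rewrite ltr_wpDl.
  by rewrite lerDl.
- have bv (h t : R) (y : 'rV[R]_d) : h *: basis_vec R (rshift 1 j) + rcons_mx t y =
      rcons_mx t (h *: basis_vec R j + y) :> 'rV[R]_d.+1.
    by rewrite basis_vec_rshift rcons_mx_lin mulr0 add0r.
  have bvE (t : R) (y : 'rV[R]_d) :
      (fun h : R => h^-1 *: (F (h *: basis_vec R (rshift 1 j) + rcons_mx t y) - F (rcons_mx t y))) =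
      (fun h => h^-1 *: (F (rcons_mx t (h *: basis_vec R j + y)) - F (rcons_mx t y))).
    by apply/funext => h; congr (_ *: (F _ - _)); exact: bv.
  have E t : (fun y => partial (rshift 1 j) F (rcons_mx t y)) =
      partial j (fun y => F (rcons_mx t y)).
    by apply/funext => y; rewrite /partial /derive; have /= -> := bvE t y.
  transitivity (\int[mu]_(t in setT) (0 : R)); last by rewrite Rintegral_cst// mul0r.
  apply: eq_Rintegral => t _; rewrite E IH//; first exact: ccts_slice.
  + by move=> y; have := dF (rcons_mx t y); rewrite /derivable; have /= -> := bvE t y.
  + by rewrite -E; exact: (ccts_slice t cGr).1.
Unshelve. all: by end_near. Qed.

End IteratedIntegral.

Lemma near_eq_continuous_at (T U : topologicalType) (f g : T -> U) (x : T) :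
  (\forall y \near x, f y = g y) -> {for x, continuous f} -> {for x, continuous g}.
Proof.
move=> fg cf; rewrite /prop_for /continuous_at -(nbhs_singleton fg).
by apply: cvg_trans cf; apply: near_eq_cvg.
Qed.

Lemma near_eq_differentiable (R : realType) (V W : normedModType R) (f g : V -> W) (x : V) :
  (\forall y \near x, f y = g y) -> differentiable f x -> differentiable g x.
Proof.
move=> fg /diff_locallyP [cdf fE].
have gE : g \o shift x = cst (g x) + 'd f x +o_ 0 id.
  apply/eqaddoP => e e0; move/eqaddoP : fE => /(_ e e0) h.
  have fg0 : \forall h \near (0 : V), f (h + x) = g (h + x).
    by move: fg; rewrite (near_shift 0 x)/= subr0.
  near=> z; have /= zE : f (z + x) = g (z + x) by near: z.
  rewrite [leLHS](_ : _ = `|f (z + x) - (f x + 'd f x z)|); first by near: z.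
  change (`|g (z + x) - (g x + 'd f x z)| = `|f (z + x) - (f x + 'd f x z)|).
  by rewrite -zE (nbhs_singleton fg).
have dE : 'd g x = 'd f x :> (V -> W) by exact: diff_unique.
by apply/diff_locallyP; rewrite dE.
Unshelve. all: by end_near. Qed.

Lemma continuous_at_sum (R : realType) (T : topologicalType) (I : Type) (s : seq I)
    (P : pred I) (F : I -> T -> R) (x : T) : (forall i, {for x, continuous (F i)}) ->
  continuous_at x (fun y => \sum_(i <- s | P i) F i y).
Proof.
move=> h; elim: s => [|a s IH].
  have -> : (fun y => \sum_(i <- [::] | P i) F i y) = (fun=> 0).
    by apply/funext => y; rewrite big_nil.
  exact: (@cst_continuous T R 0 x).
have -> : (fun y => \sum_(i <- a :: s | P i) F i y) =
    if P a then (fun y => F a y + \sum_(i <- s | P i) F i y)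
    else (fun y => \sum_(i <- s | P i) F i y).
  by apply/funext => y; rewrite big_cons; case: (P a).
case: (P a); last exact: IH.
exact: (cvgD (h a) IH).
Qed.

(** * Functions of class C^1 on open sets *)

Section C1.
Context {R : realType} {d : nat}.
Implicit Types (f g : 'rV[R]_d -> R) (O : set 'rV[R]_d).

Lemma diff_partial f x v : differentiable f x ->
  'd f x v = \sum_(j < d) v ord0 j * partial j f x.
Proof.
move=> df; rewrite {1}(row_sum_delta v) linear_sum; apply: eq_bigr => j _.
by rewrite linearZ /partial deriveE.
Qed.

Lemma C1_continuous O (W : normedModType R) (f : 'rV[R]_d -> W) x :
  Ck 1 O f -> O x -> {for x, continuous f}.
Proof. by move=> [df _] Ox; apply: differentiable_continuous; exact: df. Qed.

Lemma C1_subset O O' (W : normedModType R) (f : 'rV[R]_d -> W) :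
  O' `<=` O -> Ck 1 O f -> Ck 1 O' f.
Proof.
by move=> OO [df cf]; split=> [x /OO|i x /OO]; [exact: df|exact: cf].
Qed.

Lemma C1_setU O O' f : Ck 1 O f -> Ck 1 O' f -> Ck 1 (O `|` O') f.
Proof.
move=> [df cf] [df' cf']; split=> [x [|]|i x [|]];
  [exact: df|exact: df'|exact: cf|exact: cf'].
Qed.

(** Continuity at a point is local, so a formula for the partial derivatives valid on the open set O
    alone is enough. *)
Lemma C1_intro O f (G : 'I_d -> 'rV[R]_d -> R) : open O ->
  (forall x, O x -> differentiable f x) ->
  (forall i x, O x -> partial i f x = G i x) ->
  (forall i x, O x -> {for x, continuous (G i)}) -> Ck 1 O f.
Proof.
move=> oO df fG cG; split=> // i x Ox.
apply: (near_eq_continuous_at _ (cG i x Ox)).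
by apply: filterS (open_nbhs_nbhs (conj oO Ox)) => y Oy; rewrite fG.
Qed.

Lemma C1_eq O f g : open O -> (forall x, O x -> f x = g x) -> Ck 1 O f -> Ck 1 O g.
Proof.
move=> oO fg [df cf].
have nfg x : O x -> \forall y \near x, f y = g y.
  by move=> Ox; apply: filterS (open_nbhs_nbhs (conj oO Ox)) => y /fg.
apply: (@C1_intro O g (fun i => partial i f)) => //.
- by move=> x Ox; exact: near_eq_differentiable (nfg x Ox) (df x Ox).
- move=> i x Ox; rewrite /partial.
  have [->|v0] := eqVneq (basis_vec R i) 0; first by rewrite !derive0.
  by apply: near_eq_derive => //; apply: filterS (nfg x Ox) => y ->.
Qed.

Lemma C1_cst O (a : R) : Ck 1 O (fun=> a).
Proof.
split=> [x _|i x _]; first exact: differentiable_cst.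
have -> : partial i (fun=> a) = (fun=> 0) :> ('rV[R]_d -> R).
  by apply/funext => y; rewrite /partial; exact: derive_cst.
exact: cst_continuous.
Qed.

Section open.
Variables (O : set 'rV[R]_d) (oO : open O).

Lemma partialD i f g x : differentiable f x -> differentiable g x ->
  partial i (fun x => f x + g x) x = partial i f x + partial i g x.
Proof. by move=> df dg; rewrite /partial deriveD//; exact: diff_derivable. Qed.

Lemma partialM i f g x : differentiable f x -> differentiable g x ->
  partial i (fun x => f x * g x) x = f x * partial i g x + g x * partial i f x.
Proof. by move=> df dg; rewrite /partial deriveM//; exact: diff_derivable. Qed.

Lemma partial_comp1 i f (phi : R -> R) (l : R) x : differentiable f x ->
  is_derive (f x) (1 : R) phi l ->
  partial i (fun x => phi (f x)) x = l * partial i f x.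
Proof.
move=> df [dphi <-]; have dphi' := (derivable1_diffP _ _).1 dphi.
have dc : differentiable (phi \o f) x by exact: differentiable_comp.
rewrite /partial deriveE// diff_comp//= deriv1E// derive1E -deriveE//.
by rewrite /GRing.scale/= mulrC.
Qed.

Lemma C1D f g : Ck 1 O f -> Ck 1 O g -> Ck 1 O (fun x => f x + g x).
Proof.
move=> [df cf] [dg cg]; apply: (@C1_intro _ _ (fun i x => partial i f x + partial i g x)) => //.
- by move=> x Ox; apply: differentiableD; [exact: df|exact: dg].
- by move=> i x Ox; apply: partialD; [exact: df|exact: dg].
- by move=> i x Ox; exact: (cvgD (cf i x Ox) (cg i x Ox)).
Qed.

Lemma C1M f g : Ck 1 O f -> Ck 1 O g -> Ck 1 O (fun x => f x * g x).
Proof.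
move=> [df cf] [dg cg].
apply: (@C1_intro _ _ (fun i x => f x * partial i g x + g x * partial i f x)) => //.
- by move=> x Ox; apply: differentiableM; [exact: df|exact: dg].
- by move=> i x Ox; apply: partialM; [exact: df|exact: dg].
- move=> i x Ox; have cfx := differentiable_continuous (df x Ox).
  have cgx := differentiable_continuous (dg x Ox).
  exact: (cvgD (cvgM cfx (cg i x Ox)) (cvgM cgx (cf i x Ox))).
Qed.

Lemma C1_comp1 f (phi phi' : R -> R) : Ck 1 O f ->
  (forall x, O x -> is_derive (f x) (1 : R) phi (phi' (f x))) ->
  (forall x, O x -> {for f x, continuous phi'}) ->
  Ck 1 O (fun x => phi (f x)).
Proof.
move=> [df cf] dphi cphi.
apply: (@C1_intro _ _ (fun i x => phi' (f x) * partial i f x)) => //.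
- move=> x Ox; apply: (@differentiable_comp _ _ _ _ f phi); first exact: df.
  by apply/derivable1_diffP; case: (dphi x Ox).
- by move=> i x Ox; apply: partial_comp1; [exact: df|exact: dphi].
- move=> i x Ox; have cfx := differentiable_continuous (df x Ox).
  have c1 : {for x, continuous (phi' \o f)}.
    by apply: continuous_comp => //; exact: cphi.
  exact: (cvgM c1 (cf i x Ox)).
Qed.

Lemma C1_sum (I : Type) (s : seq I) (P : pred I) (F : I -> 'rV[R]_d -> R) :
  (forall i, Ck 1 O (F i)) -> Ck 1 O (fun x => \sum_(i <- s | P i) F i x).
Proof.
move=> h; elim: s => [|a s IH].
  by under eq_fun do rewrite big_nil; exact: C1_cst.
under eq_fun do rewrite big_cons.
case Pa : (P a); last exact: IH.
exact: (C1D (h a) IH).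
Qed.

Lemma C1_prod (I : Type) (s : seq I) (P : pred I) (F : I -> 'rV[R]_d -> R) :
  (forall i, Ck 1 O (F i)) -> Ck 1 O (fun x => \prod_(i <- s | P i) F i x).
Proof.
move=> h; elim: s => [|a s IH].
  by under eq_fun do rewrite big_nil; exact: C1_cst.
under eq_fun do rewrite big_cons.
case Pa : (P a); last exact: IH.
exact: (C1M (h a) IH).
Qed.

Lemma C1N f : Ck 1 O f -> Ck 1 O (fun x => - f x).
Proof.
move=> cf; have := C1M (C1_cst O (-1)) cf.
by apply: C1_eq => // x _; rewrite mulN1r.
Qed.

Lemma C1V f : (forall x, O x -> f x != 0) -> Ck 1 O f -> Ck 1 O (fun x => (f x)^-1).
Proof.
move=> f0 cf; apply: (@C1_comp1 f (fun t => t^-1) (fun t => - t ^- 2)) => // x Ox.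
  have h := @is_deriveV R (@id R) (f x) 1 1 (f0 x Ox) (is_derive_id _ _).
  by apply: is_derive_eq h _; rewrite /GRing.scale/= mulr1.
apply: cvgN; apply: cvgV; first by rewrite expf_neq0// f0.
exact: exprn_continuous.
Qed.

Lemma C1_sqrt f : (forall x, O x -> 0 < f x) -> Ck 1 O f ->
  Ck 1 O (fun x => Num.sqrt (f x)).
Proof.
move=> f0 cf; apply: (@C1_comp1 f Num.sqrt (fun t => (2 * Num.sqrt t)^-1)) => // x Ox.
  exact: is_derive1_sqrt (f0 x Ox).
apply: cvgV; first by rewrite mulf_neq0// gt_eqF// sqrtr_gt0 f0.
by apply: cvgMr; exact: sqrt_continuous.
Qed.

Lemma C1_expR f : Ck 1 O f -> Ck 1 O (fun x => expR (f x)).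
Proof.
move=> cf; apply: (@C1_comp1 f expR expR) => // x Ox.
exact: continuous_expR.
Qed.

Lemma C1_det n (A : 'rV[R]_d -> 'M[R]_n) :
  (forall i j, Ck 1 O (fun x => A x i j)) -> Ck 1 O (fun x => \det (A x)).
Proof.
move=> cA; rewrite /determinant; apply: C1_sum => s.
by apply: C1M; [exact: C1_cst|apply: C1_prod => i; exact: cA].
Qed.

(** Cramer's rule expresses the entries of the inverse by determinants. *)
Lemma C1_invmx n (A : 'rV[R]_d -> 'M[R]_n) i j :
  (forall x, O x -> \det (A x) != 0) ->
  (forall i j, Ck 1 O (fun x => A x i j)) -> Ck 1 O (fun x => invmx (A x) i j).
Proof.
move=> A0 cA.
have : Ck 1 O (fun x => (\det (A x))^-1 * cofactor (A x) j i).
  apply: C1M; first by apply: C1V => //; exact: C1_det.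
  rewrite /cofactor; apply: C1M; first exact: C1_cst.
  by apply: C1_det => k l; under eq_fun do rewrite !mxE; exact: cA.
apply: C1_eq => // x Ox; rewrite /invmx unitmxE unitfE A0//.
by rewrite !mxE.
Qed.

End open.

Lemma C1_coord m n O (F : 'rV[R]_d -> 'M[R]_(m, n)) i j : open O ->
  Ck 1 O F -> Ck 1 O (fun x => F x i j).
Proof.
move=> oO [dF cF]; apply: (@C1_intro _ _ (fun k x => partial k F x i j)) => //.
- move=> x Ox.
  apply: (@differentiable_comp _ _ _ _ F (fun M : 'M[R]_(m, n) => M i j)).
    exact: dF.
  exact: differentiable_coord.
- move=> k x Ox; rewrite /partial derive_mx ?mxE//.
  by apply: diff_derivable; exact: dF.
- move=> k x Ox; apply: (@continuous_comp _ _ _ (partial k F) (fun M : 'M[R]_(m, n) => M i j)).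
    exact: cF.
  exact: coord_continuous.
Qed.

Lemma partial_comp i (tau : 'rV[R]_d -> 'rV[R]_d) f x :
  differentiable tau x -> differentiable f (tau x) ->
  partial i (f \o tau) x =
    \sum_(j < d) partial i tau x ord0 j * partial j f (tau x).
Proof.
move=> dt df; rewrite {1}/partial deriveE; last exact: differentiable_comp.
have -> : partial i tau x = 'd tau x (basis_vec R i) by exact: deriveE.
by rewrite diff_comp//= diff_partial.
Qed.

Lemma C1_comp O O' (tau : 'rV[R]_d -> 'rV[R]_d) f : open O ->
  Ck 1 O tau -> (forall x, O x -> O' (tau x)) -> Ck 1 O' f -> Ck 1 O (f \o tau).
Proof.
move=> oO ct tO cf.
apply: (@C1_intro _ _ (fun i x =>
  \sum_(j < d) partial i tau x ord0 j * partial j f (tau x))) => //.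
- by move=> x Ox; apply: differentiable_comp; [exact: ct.1|apply: cf.1; exact: tO].
- by move=> i x Ox; apply: partial_comp; [exact: ct.1|apply: cf.1; exact: tO].
- move=> i x Ox; apply: continuous_at_sum => j.
  have c1 : {for x, continuous (fun x => partial i tau x ord0 j)}.
    apply: (@continuous_comp _ _ _ (partial i tau) (fun M : 'M[R]_(1, d) => M ord0 j)).
      exact: ct.2.
    exact: coord_continuous.
  have c2 : {for x, continuous (fun x => partial j f (tau x))}.
    apply: (@continuous_comp _ _ _ tau (partial j f)); first exact: C1_continuous Ox.
    by apply: cf.2; exact: tO.
  exact: (cvgM c1 c2).
Qed.

(** O and the complement of K are open and cover the space; on the latter f is zero. *)
Lemma C1_extend O (K : set 'rV[R]_d) f : open O -> closed K -> K `<=` O ->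
  (forall x, ~ K x -> f x = 0) -> Ck 1 O f -> Ck 1 setT f.
Proof.
move=> oO cK KO f0 cf.
have c2 : Ck 1 (~` K) f.
  apply: (@C1_eq _ (fun=> 0)); [exact: closed_openC| |exact: C1_cst].
  by move=> x /f0.
apply: C1_subset (C1_setU cf c2) => x _.
by have [/KO|] := pselect (K x); [left|right].
Qed.

End C1.

(** * A bump function of class C^1 *)

Section Bump.
Context {R : realType}.

(** Squaring makes the positive part C^1, with continuous derivative [2 * Num.max 0 s]; this
    replaces a smooth cutoff. *)
Definition pos_sqr (s : R) : R := Num.max 0 s ^+ 2.

Lemma is_derive_pos_sqr (s : R) : is_derive s (1 : R) pos_sqr (2 * Num.max 0 s).
Proof.
(* A quadratic remainder, uniform in s, checked on the signs of s and h + s; dividing by h gives the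
   derivative. *)
have key (h : R) : `|pos_sqr (h + s) - pos_sqr s - h * (2 * Num.max 0 s)| <= h ^+ 2.
  rewrite ler_norml /pos_sqr; case: (leP 0 (h + s)) => h1; case: (leP 0 s) => h2;
    apply/andP; split; nra.
suff cv : h^-1 *: (pos_sqr (h *: 1 + s) - pos_sqr s) @[h --> 0^'] --> 2 * Num.max 0 s.
  by split; [apply/cvg_ex; eexists; exact: cv|exact: cvg_lim cv].
apply/cvgrPdist_le => e e0; near=> h.
have h0 : h != 0 by near: h; exact: nbhs_dnbhs_neq.
have he : `|h| < e by near: h; exact: dnbhs0_lt.
have -> : h *: 1 = h :> R by rewrite /GRing.scale/= mulr1.
apply: le_trans (ltW he); rewrite distrC -(ler_pM2l (_ : 0 < `|h|)) ?normr_gt0//.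
rewrite -[leLHS]normrM -[leRHS]normrM -expr2 [leRHS]ger0_norm ?sqr_ge0// mulrBr.
by have := key h; congr (`|_ - _| <= _); rewrite /GRing.scale/= mulrA mulfV ?mul1r.
Unshelve. all: by end_near. Qed.

Definition bump (d : nat) (a : 'rV[R]_d) (rho : R) (x : 'rV[R]_d) : R :=
  pos_sqr (rho ^+ 2 - \sum_(i < d) (x ord0 i - a ord0 i) ^+ 2).

Variables (d : nat) (a : 'rV[R]_d) (rho : R).

Lemma bump_C1 : Ck 1 setT (bump a rho).
Proof.
have oT : open [set: 'rV[R]_d] by exact: openT.
apply: (@C1_comp1 _ _ _ oT _ pos_sqr (fun s => 2 * Num.max 0 s)).
- apply: C1D => //; first exact: C1_cst.
  apply: C1N => //; apply: C1_sum => // i; under eq_fun do rewrite expr2.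
  have c : Ck 1 setT (fun x : 'rV[R]_d => x ord0 i - a ord0 i).
    apply: C1D => //; last exact: C1_cst.
    apply: C1_coord => //; split=> [x _|j x _]; first exact: ex_diff.
    have -> : partial j id = (fun=> basis_vec R j) :> ('rV[R]_d -> 'rV[R]_d).
      by apply/funext => y; rewrite /partial derive_id.
    exact: cst_continuous.
  exact: C1M.
- by move=> x _; exact: is_derive_pos_sqr.
- move=> x _; set y := _ - _.
  have c : {for y, continuous (fun s : R => Num.max 0 s)}.
    exact: (@continuous_max _ _ (fun=> 0) id y (@cst_continuous _ _ _ _) (@cvg_id _ _)).
  exact: (cvgM (@cvg_cst _ (2 : R) _ (nbhs y) _) c).
Qed.

Lemma bump_ge0 x : 0 <= bump a rho x.
Proof. exact: sqr_ge0. Qed.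

Lemma bump_center : 0 < rho -> 0 < bump a rho a.
Proof.
move=> r0; rewrite /bump big1 => [|i _]; last by rewrite subrr expr0n.
by rewrite subr0 /pos_sqr exprn_gt0// lt_max exprn_gt0 ?orbT.
Qed.

(** The bump lives on a Euclidean ball, while the norm is the maximum norm, which is the smaller of
    the two. *)
Lemma bump_out x : 0 <= rho -> rho < `|x - a| -> bump a rho x = 0.
Proof.
move=> r0 xa; rewrite /bump /pos_sqr max_l ?expr0n//.
rewrite subr_le0 leNgt; apply/negP => h.
move: xa; apply/negP; rewrite -leNgt; apply: mx_norm_le => // k j.
rewrite (ord1 k) !mxE -(ler_pXn2r (_ : 0 < 2)%N) ?nnegrE//.
rewrite real_normK ?num_real// (le_trans _ (ltW h))//.
by rewrite (bigD1 j)//= lerDl sumr_ge0// => l _; exact: sqr_ge0.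
Qed.

End Bump.

(** * Metric and gradient in charts *)

Section Jacobian.
Context {R : realType}.

Lemma jacobian_row (m n : nat) (f : 'rV[R]_m -> 'rV[R]_n) x i j :
  differentiable f x -> 'J f x i j = partial i f x ord0 j.
Proof.
move=> df; rewrite /partial deriveEjacobian// /basis_vec.
by rewrite -rowE [RHS]mxE.
Qed.

Lemma jacobian_comp (m n p : nat) (f : 'rV[R]_m -> 'rV[R]_n) (h : 'rV[R]_n -> 'rV[R]_p) x :
  differentiable f x -> differentiable h (f x) ->
  'J (h \o f) x = 'J f x *m 'J h (f x).
Proof.
move=> df dh; have dhf : differentiable (h \o f) x by exact: differentiable_comp.
apply/row_matrixP => i; rewrite !rowE mulmxA -!deriveEjacobian//.
by rewrite !deriveE// diff_comp.
Qed.

Lemma near_eq_jacobian (m n : nat) (f h : 'rV[R]_m -> 'rV[R]_n) x :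
  (\forall y \near x, f y = h y) -> differentiable f x -> 'J f x = 'J h x.
Proof.
move=> fh df; have dh := near_eq_differentiable fh df.
apply/matrixP => i j; suff e : partial i f x = partial i h x.
  exact: (etrans (jacobian_row i j df) (etrans
    (congr1 (fun v : 'rV[R]_n => v ord0 j) e) (esym (jacobian_row i j dh)))).
rewrite /partial.
have [->|v0] := eqVneq (basis_vec R i) 0; first by rewrite !derive0.
by apply: near_eq_derive => //; apply: filterS fh => y ->.
Qed.

Lemma jacobian_id (m : nat) (x : 'rV[R]_m) : 'J id x = 1%:M.
Proof.
apply/row_matrixP => i; rewrite !rowE -deriveEjacobian; last exact: ex_diff.
by rewrite derive_id mulmx1.
Qed.

(** Components of vectors change by T' and Gram matrices by its inverse on both sides: this is the
    independence of the inner product from the chart. *)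
Lemma congr_mx_bilin (n : nat) (T T' G : 'M[R]_n) (X Y : 'rV[R]_n) : T' *m T = 1%:M ->
  (X *m T') *m (T *m G *m T^T) *m (Y *m T')^T = X *m G *m Y^T.
Proof.
move=> TT; rewrite trmx_mul !mulmxA -(mulmxA X T' T) TT mulmx1.
by rewrite -(mulmxA (X *m G) T^T T'^T) -trmx_mul TT trmx1 mulmx1.
Qed.

Lemma congr_mx_inv (n : nat) (T T' G G' : 'M[R]_n) : T' *m T = 1%:M ->
  T *m T' = 1%:M -> G *m G' = 1%:M ->
  (T *m G *m T^T) *m (T'^T *m G' *m T') = 1%:M.
Proof.
move=> TT TT' GG; rewrite !mulmxA -(mulmxA (T *m G) T^T T'^T) -trmx_mul TT trmx1 mulmx1.
by rewrite -(mulmxA T G G') GG mulmx1.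
Qed.

(** Along the segment from the identity to A all matrices are positive definite, hence invertible;
    the determinant is continuous there, equals 1 at the start, and so keeps its sign. *)
Lemma posdef_det_gt0 (n : nat) (A : 'M[R]_n) : A^T = A ->
  (forall v : 'rV[R]_n, v != 0 -> 0 < (v *m A *m v^T) ord0 ord0) -> 0 < \det A.
Proof.
move=> sA pA.
pose B (t : R) : 'M[R]_n := (1 - t)%:M + t *: A.
have pB (t : R) (v : 'rV[R]_n) : 0 <= t -> t <= 1 -> v != 0 -> 0 < (v *m B t *m v^T) ord0 ord0.
  move=> t0 t1 v0; rewrite /B mulmxDr mulmxDl mul_mx_scalar -scalemxAl -scalemxAr -scalemxAl.
  have vv : 0 < (v *m v^T) ord0 ord0.
    have : exists j, v ord0 j != 0.
      apply: contrapT => /forallNP h; move/eqP : v0; apply.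
      by apply/matrixP => i j; rewrite (ord1 i) mxE; apply/eqP/negP => h'; apply: (h j); exact/negP.
    move=> [j vj]; rewrite mxE (bigD1 j)//= ltr_wpDr//.
      by apply: sumr_ge0 => k _; rewrite mxE -expr2 sqr_ge0.
    by rewrite mxE -expr2 exprn_even_gt0.
  have vA := pA v v0; rewrite mxE [X in X + _]mxE [X in _ + X]mxE.
  have [->|tn0] := eqVneq t 0; first by rewrite subr0 mul1r mul0r addr0.
  have t0' : 0 < t by rewrite lt_neqAle eq_sym tn0.
  by rewrite ltr_wpDl ?mulr_gt0// mulr_ge0 ?subr_ge0// ltW.
have dB (t : R) : 0 <= t -> t <= 1 -> \det (B t) != 0.
  move=> t0 t1; apply/negP => /det0P [v v0 vB].
  by have := pB _ _ t0 t1 v0; rewrite vB mul0mx mxE ltxx.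
rewrite ltNge; apply/negP => dA.
(* The same segment over polynomials in t, so that the intermediate value theorem for polynomials
   applies to its determinant; the sign is changed to fit the theorem's orientation. *)
pose Bp : 'M[{poly R}]_n := \matrix_(i, j) ((1 - 'X) * (i == j)%:R%:P + (A i j)%:P * 'X).
have BpE (t : R) : (\det Bp).[t] = \det (B t).
  rewrite -[LHS]/(horner_eval t (\det Bp)) -det_map_mx; congr (\det _).
  apply/matrixP => i j; rewrite [LHS]mxE; change ((Bp i j).[t] = B t i j).
  by rewrite mxE !hornerE !mxE mulr_natr [A i j * t]mulrC.
have [||x /andP[x0 x1] rx] := @poly_ivt R (- \det Bp) 0 1.
- exact: ler01.
- rewrite !hornerN !BpE /B subr0 scale0r addr0 det1 subrr scale1r.
  by rewrite raddf0 add0r oppr_le0 ler01 oppr_ge0.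
- by have := dB _ x0 x1; move: rx; rewrite rootE hornerN BpE oppr_eq0 => ->.
Qed.

End Jacobian.

Section Charts.
Context {R : realType} {M : ptopologicalType} {d : nat}.
Variable S : oriented_atlas R M d.
Implicit Types (c : chart R M d) (p q : M).

Lemma chart_invK c x : chart_im c x -> chart_map c (chart_inv c x) = x.
Proof. by move=> [p cp <-]; rewrite chart_mapK. Qed.

Lemma chart_inv_dom c x : chart_im c x -> chart_dom c (chart_inv c x).
Proof. by move=> [p cp <-]; rewrite chart_mapK. Qed.

Lemma chart_map_im c p : chart_dom c p -> chart_im c (chart_map c p).
Proof. by move=> cp; exists p. Qed.

Lemma near_chart c p : chart_dom c p -> \forall q \near p, chart_dom c q.
Proof. by move=> cp; apply: open_nbhs_nbhs; split=> //; exact: chart_dom_open. Qed.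

Lemma near_chart_im c x : chart_im c x -> \forall y \near x, chart_im c y.
Proof. by move=> cx; apply: open_nbhs_nbhs; split=> //; exact: chart_im_open. Qed.

Lemma open_chart_im c (W : set M) : open W ->
  open [set x | chart_im c x /\ W (chart_inv c x)].
Proof.
move=> oW; rewrite openE => x [cx Wx].
have := chart_inv_continuous cx; move/(_ W) => /= h.
have := h (open_nbhs_nbhs (conj oW Wx)) => h'.
by apply: filterI => //; exact: near_chart_im.
Qed.

Lemma continuous_at_chart (T : topologicalType) c p (f : M -> T) : chart_dom c p ->
  {for chart_map c p, continuous (f \o chart_inv c)} -> {for p, continuous f}.
Proof.
move=> cp cf; apply: (@near_eq_continuous_at _ _ ((f \o chart_inv c) \o chart_map c)).
  by apply: filterS (near_chart cp) => q cq /=; rewrite chart_mapK.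
by apply: continuous_comp => //; exact: chart_map_continuous.
Qed.

Lemma continuous_at_chart_inv (T : topologicalType) c x (f : M -> T) : chart_im c x ->
  {for chart_inv c x, continuous f} -> {for x, continuous (f \o chart_inv c)}.
Proof. by move=> cx cf; apply: continuous_comp => //; exact: chart_inv_continuous. Qed.

Lemma transition_differentiable c c' p : charts S c -> charts S c' ->
  chart_dom c p -> chart_dom c' p -> differentiable (transition c c') (chart_map c p).
Proof.
move=> Sc Sc' cp c'p; have [+ _] := transition_smooth Sc Sc' 1.
by apply; exists p.
Qed.

Lemma overlapE c c' : chart_map c @` (chart_dom c `&` chart_dom c') =
  [set x | chart_im c x /\ chart_dom c' (chart_inv c x)].
Proof.
apply/seteqP; split=> [_ [p [cp c'p] <-]|x [cx c'x]].
  by split; [exact: chart_map_im|rewrite chart_mapK].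
by exists (chart_inv c x); [split => //; exact: chart_inv_dom|exact: chart_invK].
Qed.

Lemma near_overlap c c' p : chart_dom c p -> chart_dom c' p ->
  \forall x \near chart_map c p, chart_im c x /\ chart_dom c' (chart_inv c x).
Proof.
move=> cp c'p; apply: (open_nbhs_nbhs (conj (open_chart_im (chart_dom_open c')) _)).
by split; [exact: chart_map_im|rewrite chart_mapK].
Qed.

Lemma tchange_comp c c' c'' p : charts S c -> charts S c' -> charts S c'' ->
  chart_dom c p -> chart_dom c' p -> chart_dom c'' p ->
  tchange c c' p *m tchange c' c'' p = tchange c c'' p.
Proof.
move=> Sc Sc' Sc'' cp c'p c''p.
have tE : transition c c' (chart_map c p) = chart_map c' p.
  by rewrite /transition /= chart_mapK.
rewrite /tchange -tE -jacobian_comp; last 2 first.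
- exact: transition_differentiable.
- by rewrite tE; exact: transition_differentiable.
apply: near_eq_jacobian.
  apply: filterS (near_overlap cp c'p) => x [cx c'x].
  by rewrite /transition/= chart_mapK.
apply: differentiable_comp; first exact: transition_differentiable.
by rewrite tE; exact: transition_differentiable.
Qed.

Lemma tchange_id c p : charts S c -> chart_dom c p -> tchange c c p = 1%:M.
Proof.
move=> Sc cp; rewrite -(jacobian_id (chart_map c p)); apply: near_eq_jacobian.
  by apply: filterS (near_chart_im (chart_map_im cp)) => x cx; rewrite /transition/= chart_invK.
exact: transition_differentiable.
Qed.

Lemma tchangeK c c' p : charts S c -> charts S c' -> chart_dom c p -> chart_dom c' p ->
  tchange c c' p *m tchange c' c p = 1%:M.
Proof. by move=> Sc Sc' cp c'p; rewrite tchange_comp// tchange_id. Qed.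

Lemma CkM_continuous f : CkM S 1 f -> continuous f.
Proof.
move=> cf p; have cp := chart_at_dom S p.
apply: (continuous_at_chart cp).
exact: C1_continuous (cf _ (chart_at_atlas S p)) (chart_map_im cp).
Qed.

Lemma smoothM_C1 f : smoothM S f -> CkM S 1 f.
Proof. exact. Qed.

Definition chart_diff c (f : M -> R) p : 'rV[R]_d :=
  \row_i partial i (f \o chart_inv c) (chart_map c p).

(** The chain rule for [transition c c']; differentials are covectors, whence the transposed matrix
    in the direction opposite to that of tangent vectors. *)
Lemma chart_diff_change c c' f p : CkM S 1 f -> charts S c -> charts S c' ->
  chart_dom c p -> chart_dom c' p ->
  chart_diff c f p = chart_diff c' f p *m (tchange c c' p)^T.
Proof.
move=> cf Sc Sc' cp c'p.
have tE : transition c c' (chart_map c p) = chart_map c' p.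
  by rewrite /transition /= chart_mapK.
have dt := transition_differentiable Sc Sc' cp c'p.
have df' : differentiable (f \o chart_inv c') (transition c c' (chart_map c p)).
  by rewrite tE; apply: (cf c' Sc').1; exact: chart_map_im.
apply/matrixP => k i; rewrite (ord1 k) [LHS]mxE.
transitivity (partial i ((f \o chart_inv c') \o transition c c') (chart_map c p)).
  rewrite /partial; have [->|v0] := eqVneq (basis_vec R i) 0; first by rewrite !derive0.
  apply: near_eq_derive => //.
  by apply: filterS (near_overlap cp c'p) => x [cx c'x]; rewrite /transition/= chart_mapK.
rewrite partial_comp// tE [RHS]mxE; apply: eq_bigr => j _.
rewrite mulrC; congr (_ * _); first by rewrite mxE.
by rewrite [RHS]mxE /tchange jacobian_row.
Qed.

Lemma chart_diff_eq0 c f p : (\forall q \near p, f q = 0) -> chart_dom c p ->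
  chart_diff c f p = 0.
Proof.
move=> f0 cp; apply/matrixP => k i; rewrite (ord1 k) !mxE /partial.
have [->|v0] := eqVneq (basis_vec R i) 0; first by rewrite derive0.
rewrite (@near_eq_derive _ _ _ _ (fun=> 0))//; first exact: derive_cst.
have := chart_inv_continuous (chart_map_im cp).
rewrite /prop_for /continuous_at chart_mapK// => h.
exact: (h _ f0).
Qed.

Section Metric.
Variable g : riemannian_metric S.

Section at_point.
Variables (c : chart R M d) (p : M).
Hypotheses (Sc : charts S c) (cp : chart_dom c p).

Let c0 := chart_at S p.
Let Sc0 : charts S c0 := chart_at_atlas S p.
Let c0p : chart_dom c0 p := chart_at_dom S p.

Lemma gram_in_sym : (gram_in S g c p)^T = gram_in S g c p.
Proof. by rewrite /gram_in !trmx_mul trmxK gram_sym mulmxA. Qed.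

Lemma gram_in_posdef (v : 'rV[R]_d) : v != 0 ->
  0 < (v *m gram_in S g c p *m v^T) ord0 ord0.
Proof.
move=> v0; pose w := v *m tchange c c0 p.
have -> : v *m gram_in S g c p *m v^T = w *m g p *m w^T.
  by rewrite /w /gram_in trmx_mul !mulmxA.
apply: gram_posdef; apply: contraNneq v0 => w0.
by rewrite -[v]mulmx1 -(tchangeK Sc Sc0 cp c0p) mulmxA -/w w0 mul0mx.
Qed.

Lemma det_gram_in_gt0 : 0 < \det (gram_in S g c p).
Proof. by apply: posdef_det_gt0; [exact: gram_in_sym|exact: gram_in_posdef]. Qed.

Lemma gram_in_unit : gram_in S g c p \in unitmx.
Proof. by rewrite unitmxE unitfE gt_eqF// det_gram_in_gt0. Qed.

Lemma invmx_gram_in :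
  invmx (gram_in S g c p) = (tchange c0 c p)^T *m invmx (g p) *m tchange c0 c p.
Proof.
have gu : g p \in unitmx.
  have := @posdef_det_gt0 R d (g p) (gram_sym g p) (fun v => @gram_posdef _ _ _ _ g p v).
  by rewrite unitmxE unitfE => /gt_eqF ->.
have e : gram_in S g c p *m ((tchange c0 c p)^T *m invmx (g p) *m tchange c0 c p) = 1%:M
  := congr_mx_inv (tchangeK Sc0 Sc c0p cp) (tchangeK Sc Sc0 cp c0p) (mulmxV gu).
have := mulKmx gram_in_unit ((tchange c0 c p)^T *m invmx (g p) *m tchange c0 c p).
by rewrite e mulmx1.
Qed.

Lemma gradient_in f : CkM S 1 f ->
  field_in S c (gradient g f) p = chart_diff c f p *m invmx (gram_in S g c p).
Proof.
move=> cf; rewrite /field_in /gradient -/c0 -[\row_i _]/(chart_diff c0 f p).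
rewrite (chart_diff_change cf Sc0 Sc c0p cp) invmx_gram_in.
by rewrite !mulmxA.
Qed.

Lemma inner_in X Y : inner g X Y p =
  (field_in S c X p *m gram_in S g c p *m (field_in S c Y p)^T) ord0 ord0.
Proof.
rewrite /inner /field_in /gram_in -/c0.
by rewrite (congr_mx_bilin _ _ _ (tchangeK Sc0 Sc c0p cp)).
Qed.

(** The metric cancels against its inverse in the gradient and leaves the differential of f applied
    to X, in any chart around p. *)
Lemma inner_gradient f X : CkM S 1 f ->
  inner g (gradient g f) X p = \sum_(i < d) chart_diff c f p ord0 i * field_in S c X p ord0 i.
Proof.
move=> cf; rewrite inner_in gradient_in// (mulmxKV gram_in_unit) mxE; apply: eq_bigr => i _.
by rewrite [X in _ * X]mxE.
Qed.

End at_point.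

Lemma vol_density_gt0 c x : charts S c -> chart_im c x -> 0 < vol_density g c x.
Proof.
by move=> Sc cx; rewrite sqrtr_gt0 det_gram_in_gt0//; exact: chart_inv_dom.
Qed.

Lemma gram_C1 c i j : charts S c ->
  Ck 1 (chart_im c) (fun x => gram_in S g c (chart_inv c x) i j).
Proof.
move=> Sc; apply: (C1_coord i j (@chart_im_open _ _ _ c)).
exact: (gram_smooth g Sc 1).
Qed.

Lemma vol_density_C1 c : charts S c -> Ck 1 (chart_im c) (vol_density g c).
Proof.
move=> Sc; apply: C1_sqrt; first exact: chart_im_open.
  by move=> x cx; apply: det_gram_in_gt0 => //; exact: chart_inv_dom.
apply: C1_det; first exact: chart_im_open.
by move=> i j; exact: gram_C1.
Qed.

(** The quantity differentiated by the divergence. One derivative of f is already spent in the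
    gradient, so C^1 here asks for two derivatives of f. *)
Lemma gradient_density_C1 c f i : smoothM S f -> charts S c ->
  Ck 1 (chart_im c) (fun x =>
    vol_density g c x * field_in S c (gradient g f) (chart_inv c x) ord0 i).
Proof.
move=> sf Sc; have oc := @chart_im_open _ _ _ c.
apply: C1M => //; first exact: vol_density_C1.
apply: (@C1_eq _ _ _ (fun x => \sum_(j < d) partial j (f \o chart_inv c) x *
    invmx (gram_in S g c (chart_inv c x)) j i)) => //.
  move=> x cx; rewrite (gradient_in Sc (chart_inv_dom cx) (smoothM_C1 sf)).
  by rewrite mxE; apply: eq_bigr => j _; rewrite mxE chart_invK.
apply: C1_sum => // j; apply: C1M => //.
  by have [_ +] := sf 2 c Sc; apply.
apply: C1_invmx => //.
  by move=> x cx; rewrite gt_eqF// det_gram_in_gt0//; exact: chart_inv_dom.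
by move=> k l; exact: gram_C1.
Qed.

(** The formula of [divergence] in a chart fixed in advance instead of [chart_at S p]; only in this
    form is regularity in p accessible. *)
Definition divergence_in c (X : vfield R M d) (p : M) : R :=
  (\sum_(i < d) partial i
     (fun x => vol_density g c x * field_in S c X (chart_inv c x) ord0 i)
     (chart_map c p)) / vol_density g c (chart_map c p).

End Metric.

End Charts.

Lemma iterated_Rintegral_sum (R : realType) (d : nat) (r : R) (I : Type) (s : seq I)
    (F : I -> 'rV[R]_d -> R) : 0 <= r -> (forall i, ccts r (F i)) ->
  ccts r (fun x => \sum_(i <- s) F i x) /\
  iterated_Rintegral (fun x => \sum_(i <- s) F i x) = \sum_(i <- s) iterated_Rintegral (F i).
Proof.
move=> r0 cF; elim: s => [|a s [c IH]].
  have -> : (fun x => \sum_(i <- [::]) F i x) = (fun=> 0).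
    by apply/funext => x; rewrite big_nil.
  split; first exact: ccts0.
  have := iterated_RintegralZD r0 (-1) (@ccts0 R d r) (@ccts0 R d r).
  have -> : (fun x : 'rV[R]_d => -1 * 0 + 0) = (fun=> 0 : R).
    by apply/funext => y; rewrite mulr0 addr0.
  by move=> ->; rewrite mulN1r addNr big_nil.
have -> : (fun x => \sum_(i <- a :: s) F i x) = (fun x => 1 * F a x + \sum_(i <- s) F i x).
  by apply/funext => x; rewrite big_cons mul1r.
split; first exact: cctsZD.
by rewrite (iterated_RintegralZD r0)// IH mul1r big_cons.
Qed.

Lemma near_eq_partial (R : realType) (d : nat) (f h : 'rV[R]_d -> R) i x :
  (\forall y \near x, f y = h y) -> partial i f x = partial i h x.
Proof.
move=> fh; rewrite /partial.
have [->|v0] := eqVneq (basis_vec R i) 0; first by rewrite !derive0.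
by apply: near_eq_derive => //; apply: filterS fh => y ->.
Qed.

(** * Green's formula *)

Section Green.
Context {R : realType} {M : ptopologicalType} {d : nat}.
Hypotheses (M_hausdorff : hausdorff_space M) (M_compact : compact [set: M]).
Variables (S : oriented_atlas R M d) (g : riemannian_metric S).
Variables (vol : {measure set (borel M) -> \bar R}) (vol_g : riemannian_volume g vol).
Variables (U : M -> R) (U_C1 : CkM S 1 U).
Variables (pi : probability (borel M) R) (pi_gibbs : gibbs pi vol U).
Implicit Types (c : chart R M d) (p q : M) (C : set M).

Lemma closed_compactM C : closed C -> compact C.
Proof. by move=> cC; apply: (subclosed_compact cC M_compact). Qed.

Lemma continuous_bounded (f : M -> R) : continuous f ->
  exists B : R, forall p, `|f p| <= B.
Proof.
move=> cf; have cK : compact (f @` [set: M]).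
  by apply: continuous_compact => //; exact: continuous_subspaceT.
have [B [_ hB]] := compact_bounded cK.
by exists (B + 1) => p; apply: (hB (B + 1)); [rewrite ltrDl|exists p].
Qed.

Lemma continuous_measurable (f : M -> R) : continuous f ->
  measurable_fun [set: borel M] (f : borel M -> R).
Proof.
move=> cf; apply: (@continuous_borel_measurable R M setT f) => [|x _]; [exact: openT|exact: cf].
Qed.

Lemma continuous_integrable (f : M -> R) : continuous f ->
  pi.-integrable [set: borel M] (EFin \o (f : borel M -> R)).
Proof.
move=> cf; apply: measurable_bounded_integrable => //.
- by rewrite (le_lt_trans (probability_le1 pi _))// ltry.
- exact: continuous_measurable.
- have [B hB] := continuous_bounded cf.
  by exists B; split; [exact: num_real|move=> s Bs p _; apply: le_trans (hB p) (ltW Bs)].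
Qed.

Lemma Rintegral_sub0 (a b : M -> R) : continuous a -> continuous b ->
  \int[pi]_(p in [set: borel M]) a p = 0 -> \int[pi]_(p in [set: borel M]) b p = 0 ->
  \int[pi]_(p in [set: borel M]) (a p - b p) = 0.
Proof.
move=> ca cb a0 b0.
by rewrite RintegralB//; [rewrite a0 b0 subrr|exact: continuous_integrable..].
Qed.

(** The density of pi in the coordinates of c with respect to Lebesgue measure. *)
Definition chart_weight c (x : 'rV[R]_d) : R :=
  expR (- U (chart_inv c x)) * vol_density g c x.

Definition pullback c (f : M -> R) : 'rV[R]_d -> R :=
  (fun x => f (chart_inv c x) * chart_weight c x) \_ (chart_im c).

Lemma chart_weight_C1 c : charts S c -> Ck 1 (chart_im c) (chart_weight c).
Proof.
move=> Sc; have oc := @chart_im_open _ _ _ c.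
apply: C1M => //; last exact: vol_density_C1.
by apply: C1_expR => //; apply: C1N => //; exact: U_C1.
Qed.

Lemma chart_weight_gt0 c x : charts S c -> chart_im c x -> 0 < chart_weight c x.
Proof. by move=> Sc cx; rewrite mulr_gt0 ?expR_gt0//; exact: vol_density_gt0. Qed.

Lemma chart_image_compact c C : closed C -> C `<=` chart_dom c ->
  compact (chart_map c @` C).
Proof.
move=> cC Cc; apply: continuous_compact; last exact: closed_compactM.
apply: continuous_in_subspaceT => p /[!inE] /Cc; exact: chart_map_continuous.
Qed.

Lemma chart_image_closed c C : closed C -> C `<=` chart_dom c ->
  closed (chart_map c @` C).
Proof.
move=> cC Cc; apply: compact_closed; first exact: norm_hausdorff.
exact: chart_image_compact.
Qed.

Lemma chart_image_bounded c C : closed C -> C `<=` chart_dom c ->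
  exists2 r : R, 0 <= r & forall x, (chart_map c @` C) x -> `|x| <= r.
Proof.
move=> cC Cc; have [B [_ hB]] := compact_bounded (chart_image_compact cC Cc).
exists (Num.max 0 (B + 1)); first by rewrite le_max lexx.
by move=> x Cx; rewrite le_max; apply/orP; right; apply: (hB (B + 1)) => //; rewrite ltrDl.
Qed.

Lemma chart_image_notin c C x : chart_im c x -> ~ (chart_map c @` C) x ->
  ~ C (chart_inv c x).
Proof. by move=> cx nC Cx; apply: nC; exists (chart_inv c x) => //; exact: chart_invK. Qed.

Lemma chart_extension_C1 c C (F : 'rV[R]_d -> R) : closed C -> C `<=` chart_dom c ->
  Ck 1 (chart_im c) F ->
  (forall x, chart_im c x -> ~ C (chart_inv c x) -> F x = 0) ->
  Ck 1 setT (F \_ (chart_im c)).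
Proof.
move=> cC Cc cF F0; have oc := @chart_im_open _ _ _ c.
apply: (C1_extend oc (chart_image_closed cC Cc)).
- by move=> x [p Cp <-]; apply: chart_map_im; exact: Cc.
- move=> x nx; rewrite patchE; case: ifPn => // /[!inE] cx.
  by apply: F0 => //; exact: chart_image_notin nx.
- by apply: C1_eq cF => // x cx; rewrite patchE mem_set.
Qed.

Lemma pullback_continuous c C (f : M -> R) : charts S c -> closed C -> C `<=` chart_dom c ->
  continuous f -> (forall p, ~ C p -> f p = 0) -> continuous (pullback c f).
Proof.
move=> Sc cC Cc cf f0 x; have [Kx|nKx] := pselect ((chart_map c @` C) x).
  have cx : chart_im c x by case: Kx => p Cp <-; apply: chart_map_im; exact: Cc.
  apply: (near_eq_continuous_at (f := fun x => f (chart_inv c x) * chart_weight c x)).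
    by apply: filterS (near_chart_im cx) => y cy; rewrite /pullback patchE mem_set.
  have c1 := continuous_at_chart_inv cx (@cf (chart_inv c x)).
  exact: (cvgM c1 (C1_continuous (chart_weight_C1 Sc) cx)).
apply: (near_eq_continuous_at (f := fun=> 0)); last exact: (@cst_continuous _ _ 0 x).
have := open_nbhs_nbhs (conj (closed_openC (chart_image_closed cC Cc)) nKx).
apply: filterS => y nKy; rewrite /pullback patchE; case: ifPn => // /[!inE] cy.
by rewrite f0 ?mul0r//; exact: chart_image_notin nKy.
Qed.

Lemma pullback_out c C (f : M -> R) x : (forall p, ~ C p -> f p = 0) ->
  ~ (chart_map c @` C) x -> pullback c f x = 0.
Proof.
move=> f0 nKx; rewrite /pullback patchE; case: ifPn => // /[!inE] cx.
by rewrite f0 ?mul0r//; exact: chart_image_notin nKx.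
Qed.

Section supported.
Variables (c : chart R M d) (C : set M).
Hypotheses (Sc : charts S c) (cC : closed C) (Cc : C `<=` chart_dom c).

Lemma pullback_ccts r (f : M -> R) : (forall x, (chart_map c @` C) x -> `|x| <= r) ->
  continuous f -> (forall p, ~ C p -> f p = 0) -> ccts r (pullback c f).
Proof.
move=> hr cf f0; split; first exact: (pullback_continuous Sc cC Cc).
move=> x rx; apply: (pullback_out f0) => Kx; have := hr _ Kx.
by rewrite leNgt rx.
Qed.

Let ge0_integral_chart r (f : M -> R) : 0 <= r ->
  (forall x, (chart_map c @` C) x -> `|x| <= r) ->
  continuous f -> (forall p, ~ C p -> f p = 0) -> (forall p, 0 <= f p) ->
  \int[pi]_(p in [set: borel M]) f p = iterated_Rintegral (pullback c f).
Proof.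
move=> r0 hr cf f0 fp; have cp := pullback_ccts hr cf f0.
have mf := continuous_measurable cf.
have cU : continuous (fun p => expR (- U p)).
  move=> p; apply: continuous_comp; last exact: continuous_expR.
  by apply: cvgN; exact: (CkM_continuous U_C1).
have mU := continuous_measurable cU.
rewrite /Rintegral (@ge0_integral_density _ _ _ vol pi (fun p => expR (- U p)));
  do ?[exact: mU|by move=> p; exact: expR_ge0|by move=> p; rewrite lee_fin|
       exact/measurable_EFinP|exact: pi_gibbs].
have -> : (\int[vol]_(p in [set: borel M]) ((f p)%:E * (expR (- U p))%:E) =
    \int[vol]_(p in (chart_dom c : set (borel M))) ((f p)%:E * (expR (- U p))%:E))%E.
  rewrite [RHS]integral_mkcond; apply: eq_integral => p _.
  rewrite patchE; case: ifPn => // /negP np; rewrite f0 ?mul0e// => /Cc cpp.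
  by apply: np; rewrite inE.
rewrite (vol_g Sc (F := fun p => ((f p)%:E * (expR (- U p))%:E)%E)); last 2 first.
- by move=> p; rewrite mule_ge0 ?lee_fin ?expR_ge0.
- by apply: emeasurable_funM; exact/measurable_EFinP.
rewrite (_ : _ \_ _ = fun x => (pullback c f x)%:E).
  by rewrite (lebesgue_integral_rV_ccts r0 cp).
apply/funext => x; rewrite /pullback !patchE; case: ifPn => // _.
by rewrite /chart_weight -!EFinM mulrA.
Qed.

(** The volume is specified on nonnegative functions, so f is split into its positive and negative
    parts, which are still continuous and supported in C. *)
Lemma integral_chart (f : M -> R) :
  continuous f -> (forall p, ~ C p -> f p = 0) ->
  \int[pi]_(p in [set: borel M]) f p = iterated_Rintegral (pullback c f).
Proof.
move=> cf f0; have [r r0 hr] := chart_image_bounded cC Cc.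
pose fp p := Num.max (f p) 0; pose fn p := Num.max (- f p) 0.
have cfp : continuous fp.
  by move=> p; apply: (@continuous_max _ _ f (fun=> 0) p (@cf p)); exact: cst_continuous.
have cfn : continuous fn.
  move=> p; apply: (@continuous_max _ _ (fun p => - f p) (fun=> 0) p); last exact: cst_continuous.
  by apply: cvgN; exact: cf.
have fE p : f p = fp p - fn p.
  by rewrite /fp /fn; case: (leP (f p) 0) => h1; case: (leP (- f p) 0) => h2; lra.
have fp0 p : ~ C p -> fp p = 0 by move=> nC; rewrite /fp f0// maxxx.
have fn0 p : ~ C p -> fn p = 0 by move=> nC; rewrite /fn f0// oppr0 maxxx.
have -> : \int[pi]_(p in [set: borel M]) f p =
    \int[pi]_(p in [set: borel M]) fp p - \int[pi]_(p in [set: borel M]) fn p.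
  rewrite -RintegralB//; try exact: continuous_integrable.
  by apply: eq_Rintegral => p _; exact: fE.
rewrite (ge0_integral_chart r0 hr cfp fp0); last by move=> p; rewrite le_max lexx orbT.
rewrite (ge0_integral_chart r0 hr cfn fn0); last by move=> p; rewrite le_max lexx orbT.
have -> : pullback c f = (fun x => -1 * pullback c fn x + pullback c fp x).
  apply/funext => x; rewrite /pullback !patchE; case: ifPn => _; last by rewrite mulr0 addr0.
  by rewrite fE; ring.
rewrite (iterated_RintegralZD r0); [|exact: pullback_ccts..].
by rewrite mulN1r addrC.
Qed.

(** With bump functions as factors, this is what separates continuous functions by their
    integrals. *)
Lemma integral_gt0 (f : M -> R) p : continuous f -> (forall p, ~ C p -> f p = 0) ->
  (forall p, 0 <= f p) -> 0 < f p -> 0 < \int[pi]_(p in [set: borel M]) f p.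
Proof.
move=> cf f0 fge0 fp; have [r r0 hr] := chart_image_bounded cC Cc.
rewrite (integral_chart cf f0).
have Cp : C p by apply: contrapT => nC; move: fp; rewrite f0// ltxx.
have cx : chart_im c (chart_map c p) by apply: chart_map_im; exact: Cc.
apply: (iterated_Rintegral_gt0 (x := chart_map c p) r0 (pullback_ccts hr cf f0)).
  move=> x; rewrite /pullback patchE; case: ifPn => // /[!inE] cx'.
  by rewrite mulr_ge0// ltW// chart_weight_gt0.
rewrite /pullback patchE mem_set// chart_mapK; last exact: Cc.
by rewrite mulr_gt0// chart_weight_gt0.
Qed.

End supported.

Definition drift_in c (f : M -> R) (p : M) : R :=
  divergence_in g c (gradient g f) p - inner g (gradient g U) (gradient g f) p.

(** * Green's formula for test functions supported in one chart *)

Section local_green.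
Variables (c : chart R M d) (C : set M).
Hypotheses (Sc : charts S c) (cC : closed C) (Cc : C `<=` chart_dom c).
Variables (f h : M -> R).
Hypotheses (sf : smoothM S f) (ch : CkM S 1 h) (h0 : forall p, ~ C p -> h p = 0).

Let phi p := drift_in c f p * h p + inner g (gradient g h) (gradient g f) p.

Let V i x := vol_density g c x * field_in S c (gradient g f) (chart_inv c x) ord0 i.
(** The components of the field h e^{-U} sqrt(det g) grad f, whose Euclidean divergence is the
    integrand of Green's formula times the density of pi. *)
Let Psi i x := h (chart_inv c x) * expR (- U (chart_inv c x)) * V i x.

Let oc : open (chart_im c). Proof. exact: chart_im_open. Qed.

Let Psi_C1 i : Ck 1 (chart_im c) (Psi i).
Proof.
apply: C1M => //; last exact: gradient_density_C1.
apply: C1M => //; first exact: ch.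
by apply: C1_expR => //; apply: C1N => //; exact: U_C1.
Qed.

(** Product rule: the derivative of V gives the divergence of the gradient, that of e^{-U} the
    drift, and that of h the pairing of the two gradients. *)
Let phiE x : chart_im c x ->
  phi (chart_inv c x) * chart_weight c x = \sum_(i < d) partial i (Psi i) x.
Proof.
move=> cx; set p := chart_inv c x; have cp : chart_dom c p := chart_inv_dom cx.
have xE : chart_map c p = x := chart_invK cx.
have r0 := vol_density_gt0 g Sc cx.
have dh : differentiable (h \o chart_inv c) x by apply: (ch Sc).1.
have dU : differentiable (U \o chart_inv c) x by apply: (U_C1 Sc).1.
have dV i : differentiable (V i) x by apply: (gradient_density_C1 g i sf Sc).1.
have dN : differentiable (fun x => - U (chart_inv c x)) x by exact: differentiableN.
have dE : differentiable (fun x => expR (- U (chart_inv c x))) x.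
  apply: (@differentiable_comp _ _ _ _ (fun x => - U (chart_inv c x)) expR) => //.
  by apply/derivable1_diffP; have := is_derive_expR (- U (chart_inv c x)); case.
have PE i : partial i (Psi i) x =
    h p * expR (- U p) * partial i (V i) x +
    V i x * (h p * - (expR (- U p) * partial i (U \o chart_inv c) x) +
      expR (- U p) * partial i (h \o chart_inv c) x).
  rewrite /Psi partialM//; last exact: differentiableM.
  rewrite [in LHS]partialM//; congr (_ + _ * (_ * _ + _)).
  rewrite (@partial_comp1 _ _ _ (fun x => - U (chart_inv c x)) expR (expR (- U p)))//.
  rewrite -mulrN; congr (_ * _).
  have := partialM i (differentiable_cst (-1 : R) x) dU.
  have -> : (fun x => -1 * (U \o chart_inv c) x) = (fun x => - U (chart_inv c x)).
    by apply/funext => y; rewrite mulN1r.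
  move=> ->; rewrite /partial derive_cst mulr0 addr0 mulN1r//.
under eq_bigr do rewrite PE.
rewrite /phi /drift_in /divergence_in xE.
rewrite (inner_gradient g Sc cp _ U_C1) (inner_gradient g Sc cp _ ch).
rewrite /chart_weight -/p.
have -> : (\sum_(i < d) partial i (V i) x) / vol_density g c x =
    \sum_(i < d) partial i (V i) x / vol_density g c x by rewrite mulr_suml.
rewrite -/(V _) -sumrB mulr_suml -big_split/= mulr_suml; apply: eq_bigr => i _.
set F := field_in S c (gradient g f) p ord0 i.
rewrite !mxE xE; set a := partial i (V i) x.
set u' := partial i (U \o _) x; set h' := partial i (h \o _) x.
rewrite /V -/p -/F.
by field; exact: lt0r_neq0.
Qed.

Let phi0 p : ~ C p -> phi p = 0.
Proof.
move=> nC; have nCn : \forall q \near p, h q = 0.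
  have := open_nbhs_nbhs (conj (closed_openC cC) nC).
  by apply: filterS => q; exact: h0.
rewrite /phi h0// mulr0 add0r.
rewrite (inner_gradient g (chart_at_atlas S p) (chart_at_dom S p) _ ch).
rewrite (chart_diff_eq0 nCn (chart_at_dom S p)).
by rewrite big1// => i _; rewrite mxE mul0r.
Qed.

Let Psi0 i x : chart_im c x -> ~ C (chart_inv c x) -> Psi i x = 0.
Proof. by move=> _ nC; rewrite /Psi h0// !mul0r. Qed.

Let Psi_ext_C1 i := chart_extension_C1 cC Cc (Psi_C1 i) (@Psi0 i).

Let near_Psi i x : chart_im c x -> \forall y \near x, (Psi i \_ (chart_im c)) y = Psi i y.
Proof.
by move=> cx; apply: filterS (near_chart_im cx) => y cy; rewrite patchE mem_set.
Qed.

(** Within the chart, [phiE] presents phi as a continuous sum over a positive weight; elsewhere phi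
    vanishes nearby, since C is closed. *)
Lemma local_green_continuous : continuous phi.
Proof.
move=> p; have [cp|ncp] := pselect (chart_dom c p).
  apply: (continuous_at_chart cp); set x := chart_map c p.
  have cx : chart_im c x by exact: chart_map_im.
  apply: (near_eq_continuous_at (f := fun x =>
     (\sum_(i < d) partial i (Psi i) x) * (chart_weight c x)^-1)).
    apply: filterS (near_chart_im cx) => y cy /=.
    by rewrite -phiE// mulfK// gt_eqF// chart_weight_gt0.
  have c1 : {for x, continuous (fun x => \sum_(i < d) partial i (Psi i) x)}.
    apply: continuous_at_sum => i.
    by have [_ cP] := Psi_C1 i; exact: cP.
  apply: (cvgM c1).
  apply: cvgV; first by rewrite gt_eqF// chart_weight_gt0.
  exact: C1_continuous (chart_weight_C1 Sc) cx.
have nC : ~ C p by move/Cc.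
apply: (near_eq_continuous_at (f := fun=> 0)); last exact: (@cst_continuous _ _ 0 p).
have := open_nbhs_nbhs (conj (closed_openC cC) nC).
by apply: filterS => q nCq; rewrite phi0.
Qed.

Lemma local_green : \int[pi]_(p in [set: borel M]) phi p = 0.
Proof.
rewrite (integral_chart Sc cC Cc local_green_continuous phi0).
have [r r0 hr] := chart_image_bounded cC Cc.
have ext0 i x : ~ (chart_map c @` C) x -> (Psi i \_ (chart_im c)) x = 0.
  move=> nKx; rewrite patchE; case: ifPn => // /[!inE] cx.
  by apply: Psi0 => //; exact: chart_image_notin nKx.
have -> : pullback c phi = (fun x => \sum_(i < d) partial i (Psi i \_ (chart_im c)) x).
  apply/funext => x; rewrite /pullback patchE; case: ifPn => [/[!inE] cx|/negP ncx].
    by rewrite phiE//; apply: eq_bigr => i _; apply/esym/near_eq_partial; exact: near_Psi.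
  rewrite big1// => i _.
  have nKx : ~ (chart_map c @` C) x.
    by move=> [p Cp pE]; apply: ncx; rewrite inE -pE; apply: chart_map_im; exact: Cc.
  rewrite (@near_eq_partial _ _ _ (fun=> 0)); first by rewrite /partial; exact: derive_cst.
  have := open_nbhs_nbhs (conj (closed_openC (chart_image_closed cC Cc)) nKx).
  by apply: filterS => y; exact: ext0.
have cP i : ccts r (Psi i \_ (chart_im c)).
  split=> [x|x rx]; first exact: C1_continuous (Psi_ext_C1 i) I.
  by apply: ext0 => Kx; have := hr _ Kx; rewrite leNgt rx.
have cdP i : continuous (partial i (Psi i \_ (chart_im c))).
  by move=> x; exact: (Psi_ext_C1 i).2.
rewrite (iterated_Rintegral_sum _ r0 _).2; last first.
  move=> i; split; first exact: cdP.
  by move=> x rx; exact: partial_ccts_eq0 (cP i) rx.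
rewrite big1// => i _; apply: (iterated_Rintegral_partial r0 (cP i)) => //.
by move=> x; apply: diff_derivable; exact: (Psi_ext_C1 i).1.
Qed.

End local_green.

(** A coordinate bump is carried to M and extended by zero. Its support C is the image of a compact
    ball, hence closed in the Hausdorff space M, so in any chart c' the overlap with c and the
    complement of C are open and cover. *)
Lemma exists_bump c (W : set M) p0 : charts S c -> open W -> W `<=` chart_dom c -> W p0 ->
  exists h C, [/\ CkM S 1 h, closed C, C `<=` W, (forall p, ~ C p -> h p = 0) &
    (forall p, 0 <= h p) /\ 0 < h p0].
Proof.
move=> Sc oW Wc Wp0; set x0 := chart_map c p0.
have cx0 : chart_im c x0 by apply: chart_map_im; exact: Wc.
have oO : open [set x | chart_im c x /\ W (chart_inv c x)] by exact: open_chart_im.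
have Ox0 : [set x | chart_im c x /\ W (chart_inv c x)] x0.
  by split=> //; rewrite /x0 chart_mapK//; exact: Wc.
have [rho /= rho0 hrho] := (nbhs_ballP _ _).1 (open_nbhs_nbhs (conj oO Ox0)).
(* Halved so that the closed ball Q stays inside the open ball of radius rho. *)
pose r := rho / 2; have r0 : 0 < r by rewrite divr_gt0.
pose Q := [set x : 'rV[R]_d | `|x - x0| <= r].
have QO x : Q x -> chart_im c x /\ W (chart_inv c x).
  move=> /= Qx; apply: hrho; rewrite -ball_normE/= distrC (le_lt_trans Qx)//.
  by rewrite /r ltr_pdivrMr// ltr_pMr// ltr1n.
have cQ : compact Q.
  apply: bounded_closed_compact.
    exists (r + `|x0|); split; first exact: num_real.
    move=> s rs y /= yr; rewrite -(subrK x0 y) (le_trans (ler_normD _ _))//.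
    by apply: le_trans (ltW rs); rewrite lerD2r.
  apply: (@closed_comp _ _ (fun y : 'rV[R]_d => `|y - x0|) [set s | s <= r]).
    move=> y _; have cy : {for y, continuous (fun y : 'rV[R]_d => y - x0)}.
      apply: differentiable_continuous; apply: differentiableB; first exact: ex_diff.
      exact: differentiable_cst.
    exact: (continuous_comp cy (@norm_continuous _ _ _)).
  exact: closed_le.
pose C := chart_inv c @` Q.
have cC : closed C.
  apply: compact_closed => //; apply: continuous_compact => //.
  apply: continuous_in_subspaceT => x /[!inE] /QO [cx _].
  exact: chart_inv_continuous.
have CW : C `<=` W by move=> _ [x /QO [_ Wx] <-].
pose h p := if p \in chart_dom c then bump x0 r (chart_map c p) else 0.
have h0 p : ~ C p -> h p = 0.
  move=> nC; rewrite /h; case: ifPn => // /[!inE] cp; apply: bump_out; first exact: ltW.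
  rewrite ltNge; apply/negP => Qx; apply: nC; exists (chart_map c p) => //.
  exact: chart_mapK.
exists h, C; split => //; last first.
  split; first by move=> p; rewrite /h; case: ifPn => // _; exact: bump_ge0.
  by rewrite /h mem_set; [exact: bump_center|exact: Wc].
move=> c' Sc'.
have o1 : open [set x | chart_im c' x /\ chart_dom c (chart_inv c' x)].
  by apply: open_chart_im; exact: chart_dom_open.
have o2 : open [set x | chart_im c' x /\ (~` C) (chart_inv c' x)].
  by apply: open_chart_im; exact: closed_openC.
have C1 : Ck 1 [set x | chart_im c' x /\ chart_dom c (chart_inv c' x)] (h \o chart_inv c').
  apply: (@C1_eq _ _ _ (bump x0 r \o transition c' c)) => //.
    by move=> x [c'x cx]; rewrite /= /h mem_set.
  apply: (@C1_comp _ _ _ setT) => //; last exact: bump_C1.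
  by rewrite -overlapE; exact: (transition_smooth Sc' Sc 1).
have C2 : Ck 1 [set x | chart_im c' x /\ (~` C) (chart_inv c' x)] (h \o chart_inv c').
  apply: (@C1_eq _ _ _ (fun=> 0)) => //; last exact: C1_cst.
  by move=> x [_ nC] /=; rewrite h0.
apply: C1_subset (C1_setU C1 C2) => x c'x.
have [Cx|nCx] := pselect (C (chart_inv c' x)); [left|right]; split=> //.
by apply: Wc; exact: CW.
Qed.

Lemma drift_in_continuous c f p : charts S c -> smoothM S f -> chart_dom c p ->
  {for p, continuous (drift_in c f)}.
Proof.
move=> Sc sf cp; apply: (continuous_at_chart cp); set x := chart_map c p.
have cx : chart_im c x by exact: chart_map_im.
pose F i x := field_in S c (gradient g f) (chart_inv c x) ord0 i.
pose V i x := vol_density g c x * F i x.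
have cV i : Ck 1 (chart_im c) (V i) by exact: gradient_density_C1.
have cr := vol_density_C1 g Sc.
have r0 y : chart_im c y -> vol_density g c y != 0.
  by move=> cy; rewrite gt_eqF// vol_density_gt0.
apply: (near_eq_continuous_at (f := fun y =>
   (\sum_(i < d) partial i (V i) y) * (vol_density g c y)^-1 -
   \sum_(i < d) partial i (U \o chart_inv c) y * (V i y * (vol_density g c y)^-1))).
  apply: filterS (near_chart_im cx) => y cy /=.
  rewrite /drift_in /divergence_in chart_invK//; congr (_ - _).
  rewrite (inner_gradient g Sc (chart_inv_dom cy) _ U_C1); apply: eq_bigr => i _.
  by rewrite [X in _ = X * _]mxE chart_invK// /V -/(F i y) mulrAC mulfV ?r0// mul1r.
have cri : {for x, continuous (fun y => (vol_density g c y)^-1)}.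
  exact: (cvgV (r0 x cx) (C1_continuous cr cx)).
have c1 : {for x, continuous (fun y => \sum_(i < d) partial i (V i) y)}.
  by apply: continuous_at_sum => i; have [_ h] := cV i; exact: h.
have c2 : {for x, continuous (fun y => \sum_(i < d) partial i (U \o chart_inv c) y *
    (V i y * (vol_density g c y)^-1))}.
  apply: continuous_at_sum => i.
  have h1 : {for x, continuous (partial i (U \o chart_inv c))}.
    by have [_ h] := U_C1 Sc; exact: h.
  exact: (cvgM h1 (cvgM (C1_continuous (cV i) cx) cri)).
exact: (cvgB (cvgM c1 cri) c2).
Qed.

(* Both sides satisfy Green's formula against C^1 functions supported in the
   overlap of the charts, and bump functions separate continuous functions; this
   avoids differentiating the transition map twice. *)
Lemma drift_in_change c c' f p : charts S c -> charts S c' -> smoothM S f ->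
  chart_dom c p -> chart_dom c' p -> drift_in c f p = drift_in c' f p.
Proof.
move=> Sc Sc' sf; wlog : c c' Sc Sc' / drift_in c' f p <= drift_in c f p.
  move=> wl cp c'p; have [le|/ltW le] := leP (drift_in c' f p) (drift_in c f p).
    exact: wl.
  by apply/esym; exact: wl.
move=> le cp c'p; apply/eqP; rewrite eq_le; apply/andP; split; last exact: le.
rewrite leNgt; apply/negP => lt.
pose D q := drift_in c f q - drift_in c' f q.
have D0 : 0 < D p by rewrite subr_gt0.
have cD q : chart_dom c q -> chart_dom c' q -> {for q, continuous D}.
  by move=> cq c'q; apply: cvgB; exact: drift_in_continuous.
have : nbhs p [set q | [/\ chart_dom c q, chart_dom c' q & 0 < D q]].
  have h : \forall q \near p, 0 < D q by apply: (cvgr_gt (D p)) => //; exact: cD.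
  near=> q; split; near: q; [exact: near_chart|exact: near_chart|exact: h].
rewrite nbhsE => -[W [oW Wp] hW].
have [h [C [ch cC CW h0 [hge0 hp]]]] :=
  exists_bump Sc oW (fun q Wq => let: And3 cq _ _ := hW q Wq in cq) Wp.
have Cc : C `<=` chart_dom c by move=> q /CW /hW[].
have Cc' : C `<=` chart_dom c' by move=> q /CW /hW[].
have i1 := local_green Sc cC Cc sf ch h0.
have i2 := local_green Sc' cC Cc' sf ch h0.
have k1 := local_green_continuous Sc cC Cc sf ch h0.
have k2 := local_green_continuous Sc' cC Cc' sf ch h0.
have E q : (drift_in c f q * h q + inner g (gradient g h) (gradient g f) q) -
    (drift_in c' f q * h q + inner g (gradient g h) (gradient g f) q) = D q * h q.
  have aux (x y z w : R) : (x * z + w) - (y * z + w) = (x - y) * z by ring.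
  exact: aux.
have Dh : (fun q => D q * h q) = (fun q =>
    (drift_in c f q * h q + inner g (gradient g h) (gradient g f) q) -
    (drift_in c' f q * h q + inner g (gradient g h) (gradient g f) q)).
  by apply/funext => q; rewrite E.
have ck : continuous (fun q => D q * h q).
  by rewrite Dh => q; exact: (cvgB (k1 q) (k2 q)).
have D0' : \int[pi]_(q in [set: borel M]) (D q * h q) = 0.
  by rewrite Dh; exact: (Rintegral_sub0 k1 k2 i1 i2).
have : 0 < \int[pi]_(q in [set: borel M]) (D q * h q).
  apply: (integral_gt0 Sc cC Cc (p := p)) => //.
  - by move=> q nC; rewrite h0// mulr0.
  - move=> q; have [/CW /hW [_ _ Dq]|nC] := pselect (C q); first by rewrite mulr_ge0// ltW.
    by rewrite h0// mulr0.
  - exact: mulr_gt0.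
by rewrite D0' ltxx.
Unshelve. all: by end_near. Qed.

(** Replaces the chart that varies with p by a fixed one around p, which makes continuity and
    [local_green] available. *)
Lemma drift_laplacianE c f p : charts S c -> smoothM S f -> chart_dom c p ->
  drift_laplacian g U f p = drift_in c f p.
Proof.
by move=> Sc sf cp; apply: (drift_in_change (chart_at_atlas S p)) => //; exact: chart_at_dom.
Qed.

Lemma drift_laplacian_continuous f : smoothM S f -> continuous (drift_laplacian g U f).
Proof.
move=> sf p; set c := chart_at S p; have Sc := chart_at_atlas S p; have cp := chart_at_dom S p.
apply: (near_eq_continuous_at (f := drift_in c f)); last exact: drift_in_continuous.
by apply: filterS (near_chart cp) => q cq; rewrite (drift_laplacianE Sc).
Qed.

Lemma CkMM f h : CkM S 1 f -> CkM S 1 h -> CkM S 1 (fun p => f p * h p).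
Proof.
by move=> cf ch c Sc; apply: C1M; [exact: chart_im_open|exact: cf|exact: ch].
Qed.

Lemma CkM_sum (I : Type) (s : seq I) (F : I -> M -> R) : (forall i, CkM S 1 (F i)) ->
  CkM S 1 (fun p => \sum_(i <- s) F i p).
Proof.
by move=> cF c Sc; apply: C1_sum => [|i]; [exact: chart_im_open|exact: cF].
Qed.

Lemma CkMV f : (forall p, f p != 0) -> CkM S 1 f -> CkM S 1 (fun p => (f p)^-1).
Proof.
by move=> f0 cf c Sc; apply: C1V; [exact: chart_im_open|move=> x _; exact: f0|exact: cf].
Qed.

Lemma gradient_sum (I : Type) (s : seq I) (F : I -> M -> R) X p : (forall i, CkM S 1 (F i)) ->
  inner g (gradient g (fun p => \sum_(i <- s) F i p)) X p =
  \sum_(i <- s) inner g (gradient g (F i)) X p.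
Proof.
move=> cF; set c := chart_at S p; have Sc := chart_at_atlas S p; have cp := chart_at_dom S p.
rewrite (inner_gradient g Sc cp _ (CkM_sum s cF)).
under [RHS]eq_bigr do rewrite (inner_gradient g Sc cp _ (cF _)).
rewrite exchange_big/=; apply: eq_bigr => j _; rewrite -mulr_suml; congr (_ * _).
rewrite mxE; under [RHS]eq_bigr do rewrite mxE.
elim: s => [|a s IH].
  rewrite big_nil (_ : _ \o _ = fun=> 0); first by rewrite /partial; exact: derive_cst.
  by apply/funext => x /=; rewrite big_nil.
rewrite big_cons -IH -partialD.
- by congr partial; apply/funext => x /=; rewrite big_cons.
- by apply: (cF a c Sc).1; exact: chart_map_im.
- by apply: (CkM_sum s cF Sc).1; exact: chart_map_im.
Qed.

Lemma inner_gradient_continuous f h : smoothM S f -> CkM S 1 h ->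
  continuous (inner g (gradient g h) (gradient g f)).
Proof.
move=> sf ch p; set c := chart_at S p; have Sc := chart_at_atlas S p; have cp := chart_at_dom S p.
apply: (continuous_at_chart cp); set x := chart_map c p.
have cx : chart_im c x by exact: chart_map_im.
have cr := vol_density_C1 g Sc.
have r0 y : chart_im c y -> vol_density g c y != 0.
  by move=> cy; rewrite gt_eqF// vol_density_gt0.
pose F i x := field_in S c (gradient g f) (chart_inv c x) ord0 i.
pose V i x := vol_density g c x * F i x.
have cV i : Ck 1 (chart_im c) (V i) by exact: gradient_density_C1.
apply: (near_eq_continuous_at (f := fun y =>
   \sum_(i < d) partial i (h \o chart_inv c) y * (V i y * (vol_density g c y)^-1))).
  apply: filterS (near_chart_im cx) => y cy /=.
  rewrite (inner_gradient g Sc (chart_inv_dom cy) _ ch); apply: eq_bigr => i _.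
  by rewrite [X in _ = X * _]mxE chart_invK// /V -/(F i y) mulrAC mulfV ?r0// mul1r.
have cri : {for x, continuous (fun y => (vol_density g c y)^-1)}.
  exact: (cvgV (r0 x cx) (C1_continuous cr cx)).
apply: continuous_at_sum => i.
have h1 : {for x, continuous (partial i (h \o chart_inv c))}.
  by have [_ hh] := ch c Sc; exact: hh.
exact: (cvgM h1 (cvgM (C1_continuous (cV i) cx) cri)).
Qed.

(** The test function h is cut into finitely many C^1 pieces [k q], each supported in a single
    chart, and the local formulas are added. *)
Lemma green f h : smoothM S f -> CkM S 1 h ->
  \int[pi]_(p in [set: borel M]) (drift_laplacian g U f p * h p) =
  - \int[pi]_(p in [set: borel M]) inner g (gradient g h) (gradient g f) p.
Proof.
move=> sf ch.
have /choice [b hb] : forall p0, exists hC : (M -> R) * set M,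
    [/\ CkM S 1 hC.1, closed hC.2, hC.2 `<=` chart_dom (chart_at S p0),
       (forall p, ~ hC.2 p -> hC.1 p = 0) & (forall p, 0 <= hC.1 p) /\ 0 < hC.1 p0].
  move=> p0; have [k [C hC]] := exists_bump (chart_at_atlas S p0)
    (@chart_dom_open _ _ _ (chart_at S p0)) (fun q h => h) (chart_at_dom S p0).
  by exists (k, C).
have [s hs] : exists s : seq M, forall p, exists2 q, q \in s & 0 < (b q).1 p.
  have := M_compact; rewrite compact_cover => /(_ M setT (fun q => [set p | 0 < (b q).1 p])).
  case.
  - move=> q _; have [cb _ _ _ _] := hb q.
    apply: (@open_comp _ _ (b q).1 [set t | 0 < t]); last exact: open_gt.
    by move=> p _; exact: (CkM_continuous cb).
  - by move=> p _; exists p => //; have [_ _ _ _ []] := hb p.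
  - move=> D _ hD; exists (finmap.enum_fset D) => p.
    by have [q /= qD bq] := hD p I; exists q.
(* Positive everywhere, because the sets where the selected bumps are positive cover M; dividing by
   it normalises the bumps to a partition of unity. *)
pose Psi p := \sum_(q <- s) (b q).1 p.
have Psi0 p : 0 < Psi p.
  have [q qs bq] := hs p; rewrite /Psi (big_rem q)//= ltr_wpDr//.
  by apply: sumr_ge0 => r _; have [_ _ _ _ []] := hb r.
have cPsi : CkM S 1 Psi by apply: CkM_sum => q; have [] := hb q.
pose k q p := h p * ((b q).1 p * (Psi p)^-1).
have ck q : CkM S 1 (k q).
  have [cb _ _ _ _] := hb q.
  have cV : CkM S 1 (fun p => (Psi p)^-1).
    by apply: (CkMV _ cPsi) => p; rewrite gt_eqF.
  exact: (CkMM ch (CkMM cb cV)).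
have hE : h = (fun p => \sum_(q <- s) k q p).
  apply/funext => p; rewrite /k -mulr_sumr -mulr_suml -/(Psi p) mulfV ?mulr1//.
  by rewrite gt_eqF.
pose phi q p := drift_laplacian g U f p * k q p + inner g (gradient g (k q)) (gradient g f) p.
have cT := drift_laplacian_continuous sf.
have cphi q : continuous (phi q).
  move=> p; have c1 := CkM_continuous (ck q); have c2 := inner_gradient_continuous sf (ck q).
  exact: (cvgD (cvgM (@cT p) (@c1 p)) (@c2 p)).
have iphi q : \int[pi]_(p in [set: borel M]) phi q p = 0.
  have [cb cC Cc b0 _] := hb q.
  have k0 p : ~ (b q).2 p -> k q p = 0 by move=> nC; rewrite /k b0// mul0r mulr0.
  rewrite -[RHS](local_green (chart_at_atlas S q) cC Cc sf (ck q) k0).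
  apply: eq_Rintegral => p _.
  suff e : drift_laplacian g U f p * k q p = drift_in (chart_at S q) f p * k q p.
    rewrite /phi; exact: (congr1 (+%R^~ (inner g (gradient g (k q)) (gradient g f) p)) e).
  have [Cp|nCp] := pselect ((b q).2 p); last first.
    have e := k0 _ nCp.
    exact: (etrans (congr1 ( *%R _) e) (etrans (mulr0 _)
      (esym (etrans (congr1 ( *%R _) e) (mulr0 _))))).
  by rewrite (drift_laplacianE (chart_at_atlas S q) sf (Cc _ Cp)).
have isum (t : seq M) : continuous (fun p => \sum_(q <- t) phi q p) /\
    \int[pi]_(p in [set: borel M]) (\sum_(q <- t) phi q p) = 0.
  elim: t => [|a t [c IH]].
    have -> : (fun p => \sum_(q <- [::]) phi q p) = (fun=> 0).
      by apply/funext => p; rewrite big_nil.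
    by split; [move=> p; exact: (@cst_continuous _ _ 0 p)|rewrite Rintegral_cst// mul0r].
  have -> : (fun p => \sum_(q <- a :: t) phi q p) = (fun p => phi a p + \sum_(q <- t) phi q p).
    by apply/funext => p; rewrite big_cons.
  split; first by move=> p; exact: (cvgD (@cphi a p) (@c p)).
  by rewrite RintegralD//; [rewrite iphi IH addr0|exact: continuous_integrable..].
have c1 : continuous (fun p => drift_laplacian g U f p * h p).
  by move=> p; exact: (cvgM (@cT p) (CkM_continuous ch (x := p))).
have c2 := inner_gradient_continuous sf ch.
apply/eqP; rewrite -addr_eq0 -RintegralD//; [|exact: continuous_integrable..].
apply/eqP; rewrite -[RHS](isum s).2; apply: eq_Rintegral => p _.
rewrite /phi big_split/= -mulr_sumr; congr (_ * _ + _); first by rewrite {1}hE.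
by rewrite -(gradient_sum s _ p ck) -hE.
Qed.

End Green.

(** * The Sobolev space *)

Section L2Space.
Context {R : realType} {M : ptopologicalType}.
Variable pi : probability (borel M) R.
Implicit Types u v w : M -> R.

(** A function seen as a field with one component and Gram matrix 1, so that the results on fields,
    completeness in particular, apply to L^2. *)
Definition scalar_field u : borel M -> 'rV[R]_1 := fun p => const_mx (u p).

Let G (p : borel M) : 'M[R]_1 := 1%:M.

Let meas : set (borel M -> 'rV[R]_1) :=
  [set X | measurable_fun setT (fun p => X p ord0 ord0)].

Let Gsym p : (G p)^T = G p. Proof. exact: trmx1. Qed.
Let Gunit p : G p \in unitmx. Proof. exact: unitmx1. Qed.
Let formE p (v w : 'rV[R]_1) : (v *m G p *m w^T) ord0 ord0 = v ord0 ord0 * w ord0 ord0.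
Proof. by rewrite /G mulmx1 mxE big_ord1 mxE. Qed.
Let Gge0 p (v : 'rV[R]_1) : 0 <= (v *m G p *m v^T) ord0 ord0.
Proof. by rewrite formE -expr2 sqr_ge0. Qed.

Let measZD (a : R) X Y : meas X -> meas Y -> meas (fun p => a *: X p + Y p).
Proof.
move=> mX mY; rewrite /meas/=; under eq_fun do rewrite !mxE.
by apply: measurable_funD => //; exact: measurable_funM.
Qed.

Let meas_form X Y : meas X -> meas Y ->
  measurable_fun setT (fun p => gram_form G p (X p) (Y p)).
Proof.
move=> mX mY; rewrite /gram_form; under eq_fun do rewrite formE.
exact: measurable_funM.
Qed.

Let meas_lim (Y : nat -> borel M -> 'rV[R]_1) (X : borel M -> 'rV[R]_1) A :
  (forall j, meas (Y j)) -> measurable A ->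
  (forall p i, A p -> Y j p ord0 i @[j --> \oo] --> X p ord0 i) ->
  (forall p, ~ A p -> X p = 0) -> meas X.
Proof.
move=> mY mA cY X0.
apply: (@measurable_fun_cvg _ _ _ setT (fun j p => \1_A p * Y j p ord0 ord0)).
  by move=> j; apply: measurable_funM => //; exact: mY.
move=> p _; have [Ap|nAp] := pselect (A p).
  by under eq_cvg do rewrite indicE mem_set// mul1r; exact: cY.
under eq_cvg do rewrite indicE memNset// mul0r.
by rewrite X0// mxE; exact: cvg_cst.
Qed.

Lemma L2_intro u : measurable_fun [set: borel M] (u : borel M -> R) ->
  pi.-integrable [set: borel M] (EFin \o (fun p : borel M => u p ^+ 2)) -> L2 pi u.
Proof.
move=> mu iu; rewrite /L2/= inE; apply/andP; split; rewrite inE//=.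
rewrite /finite_norm unlock /Lnorm; apply: poweR_lty.
move/integrableP : iu => [_]; apply: le_lt_trans.
apply: ge0_le_integral => //.
- by move=> p _; rewrite lee_fin powR_ge0.
- apply/measurable_EFinP.
  apply: (@measurableT_comp _ _ _ _ _ _ (fun x : R => x `^ 2)%R) => //.
  exact: measurableT_comp.
- apply: measurableT_comp => //; apply/measurable_EFinP; exact: measurable_funX.
- move=> p _ /=; rewrite lee_fin normrX powR_mulrn//.
Qed.

Let L2E u : L2 pi u <-> fieldL2 pi G meas (scalar_field u).
Proof.
have mE : meas (scalar_field u) <-> measurable_fun setT (u : borel M -> R).
  rewrite /meas/=; have -> // : (fun p => scalar_field u p ord0 ord0) = u.
  by apply/funext => p; rewrite mxE.
have fE : (fun p => (gram_form G p (scalar_field u p) (scalar_field u p))%:E) =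
    EFin \o (fun p => u p ^+ 2).
  by apply/funext => p /=; rewrite /gram_form formE !mxE expr2.
rewrite /fieldL2 fE; split=> [Lu|[/mE mu iu]].
  split; last exact: Lfun2_integrable_sqr.
  by apply/mE; move: Lu; rewrite /L2/= inE => /andP[/[!inE]].
exact: L2_intro.
Qed.

Let ipE u v : ip pi u v = field_ip pi G (scalar_field u) (scalar_field v).
Proof.
by apply: eq_Rintegral => p _; rewrite /gram_form formE !mxE.
Qed.

Let scalarZD a u v : scalar_field (fun p => a * u p + v p) =
  (fun p => a *: scalar_field u p + scalar_field v p).
Proof. by apply/funext => p; apply/matrixP => i j; rewrite !mxE. Qed.

Let scalarB u v : scalar_field (u \- v) =
  (fun p => scalar_field u p - scalar_field v p).
Proof. by apply/funext => p; apply/matrixP => i j; rewrite !mxE. Qed.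

Lemma L2_measurable u : L2 pi u -> measurable_fun [set: borel M] (u : borel M -> R).
Proof. by rewrite /L2/= inE => /andP[/[!inE]]. Qed.

Lemma L2_subspace : subspace (L2 pi).
Proof.
have LZD (a : R) u v : L2 pi u -> L2 pi v -> L2 pi (fun p => a * u p + v p).
  move=> /L2E Lu /L2E Lv; apply/L2E; rewrite scalarZD.
  exact: (fieldL2ZD Gsym Gge0 measZD meas_form).
split=> //; apply/L2E; split.
  by rewrite /meas/=; under eq_fun do rewrite mxE; exact: measurable_cst.
rewrite (_ : (fun p => _) = cst 0%E); first exact: integrable0.
by apply/funext => p; rewrite /gram_form formE !mxE mulr0.
Qed.

Lemma L2_semi_inner : semi_inner (L2 pi) (ip pi).
Proof.
split.
- by move=> u v _ _; rewrite !ipE (field_ipC pi Gsym).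
- move=> a u v w /L2E Lu /L2E Lv /L2E Lw; rewrite !ipE scalarZD.
  exact: (field_ipZD Gsym Gge0 meas_form).
- by move=> u _; rewrite ipE; exact: field_ip_ge0.
Qed.

Lemma L2_complete (f_ : nat -> M -> R) : (forall n, L2 pi (f_ n)) ->
  (forall e : R, 0 < e -> exists N, forall m n, (N <= m)%N -> (N <= n)%N ->
    ip pi (f_ m \- f_ n) (f_ m \- f_ n) < e) ->
  exists2 u, L2 pi u & cvgL2 pi f_ u.
Proof.
move=> Lf cf.
have [||X LX cX] := @fieldL2_complete _ _ _ pi 1 G Gsym Gunit Gge0 meas measZD meas_form
  meas_lim (fun n => scalar_field (f_ n)).
- by move=> n; apply/L2E; exact: Lf.
- move=> e e0; have [N hN] := cf e e0; exists N => m n Nm Nn.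
  by have := hN m n Nm Nn; rewrite ipE scalarB.
pose u p := X p ord0 ord0.
have XE : X = scalar_field u.
  by apply/funext => p; apply/matrixP => i j; rewrite (ord1 i) (ord1 j) mxE.
rewrite XE in LX cX; exists u; first exact/L2E.
by rewrite /cvgL2; under eq_cvg do rewrite ipE scalarB.
Qed.

Lemma ip_eq0 u : L2 pi u -> ip pi u u = 0 -> eqL2 pi u (fun=> 0).
Proof.
move=> Lu u0; have iu : pi.-integrable [set: borel M] (EFin \o (fun p => u p * u p)).
  by have := Lfun2_integrable_sqr Lu.
have : (\int[pi]_(p in [set: borel M]) `|(u p * u p)%:E| = 0)%E.
  under eq_integral do rewrite /= ger0_norm -?expr2 ?sqr_ge0//.
  rewrite -[LHS]fineK; last exact: (integrable_fin_num _ iu).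
  by have := u0; rewrite /ip /Rintegral => ->.
move/(ae_eq_integral_abs _ measurableT) => /(_ (measurable_int _ iu)).
apply: filterS => p /(_ I) /= [] /eqP; rewrite mulf_eq0 orbb => /eqP -> _ //.
Qed.

Lemma eqL2_ip u v : L2 pi u -> L2 pi v -> eqL2 pi u v -> ip pi (u \- v) (u \- v) = 0.
Proof.
move=> Lu Lv uv; have Luv := subspaceB L2_subspace Lu Lv.
rewrite /ip /Rintegral (ae_eq_integral (cst 0%E))//; first by rewrite integral0.
- apply/measurable_EFinP; have := L2_measurable Luv => m; exact: measurable_funM.
- by apply: filterS uv => p /(_ I) h _ /=; rewrite h subrr mulr0.
Qed.

End L2Space.

(** * Measurable vector fields *)

Section Fields.
Context {R : realType} {M : ptopologicalType} {d : nat}.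
Hypotheses (M_hausdorff : hausdorff_space M) (M_compact : compact [set: M]).
Variables (S : oriented_atlas R M d) (g : riemannian_metric S).
Variable pi : probability (borel M) R.

(** Compactness selects finitely many chart domains covering M, and measurability glues along a
    finite union of open sets. *)
Lemma chart_domain_measurable_fun (f : M -> R) :
  (forall p, measurable_fun (chart_dom (chart_at S p) : set (borel M)) (f : borel M -> R)) ->
  measurable_fun [set: borel M] (f : borel M -> R).
Proof.
move=> mf.
have [s hs] : exists s : seq M, forall p, exists2 q, q \in s & chart_dom (chart_at S q) p.
  have := M_compact; rewrite compact_cover => /(_ M setT (fun q => chart_dom (chart_at S q))).
  case.
  - by move=> q _; exact: chart_dom_open.
  - by move=> p _; exists p => //; exact: chart_at_dom.
  - move=> D _ hD; exists (finmap.enum_fset D) => p.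
    by have [q /= qD bq] := hD p I; exists q.
have h (t : seq M) :
    measurable (\big[setU/set0]_(q <- t) (chart_dom (chart_at S q) : set (borel M))) /\
    measurable_fun (\big[setU/set0]_(q <- t) (chart_dom (chart_at S q) : set (borel M)))
      (f : borel M -> R).
  elim: t => [|a t [m1 m2]].
    by rewrite big_nil; split=> //; exact: measurable_fun_set0.
  have m0 : measurable (chart_dom (chart_at S a) : set (borel M)).
    by apply: open_borel; exact: chart_dom_open.
  rewrite big_cons; split; first exact: measurableU.
  by apply/measurable_funU => //; split.
have -> : [set: borel M] = \big[setU/set0]_(q <- s) (chart_dom (chart_at S q) : set (borel M)).
  apply/seteqP; split=> // p _; have [q qs qp] := hs p.
  by rewrite -bigcup_seq; exists q.
exact: (h s).2.
Qed.

Definition field_meas : set (borel M -> 'rV[R]_d) := [set X | forall c, charts S c ->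
  forall i : 'I_d, measurable_fun (chart_dom c : set (borel M))
       (fun p : borel M => field_in S c X p ord0 i)].

Lemma field_inZD c (a : R) (X Y : vfield R M d) p :
  field_in S c (fun p => a *: X p + Y p) p = a *: field_in S c X p + field_in S c Y p.
Proof. by rewrite /field_in mulmxDl scalemxAl. Qed.

Lemma field_measZD (a : R) X Y : field_meas X -> field_meas Y ->
  field_meas (fun p => a *: X p + Y p).
Proof.
move=> mX mY c Sc i.
have -> : (fun p : borel M => field_in S c (fun p => a *: X p + Y p) p ord0 i) =
    (fun p => a * field_in S c X p ord0 i + field_in S c Y p ord0 i).
  by apply/funext => p; rewrite field_inZD !mxE.
apply: measurable_funD; last exact: mY.
by apply: measurable_funM => //; exact: mX.
Qed.

Lemma gram_in_continuous c i j p : charts S c -> chart_dom c p ->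
  {for p, continuous (fun p => gram_in S g c p i j)}.
Proof.
move=> Sc cp; apply: (continuous_at_chart cp).
exact: C1_continuous (gram_C1 g i j Sc) (chart_map_im cp).
Qed.

Lemma measurable_fun_bigsum (D : set (borel M)) (I : Type) (s : seq I) (F : I -> borel M -> R) :
  (forall i, measurable_fun D (F i)) -> measurable_fun D (fun p => \sum_(i <- s) F i p).
Proof. by move=> mF; apply: measurable_sum. Qed.

Lemma field_meas_form X Y : field_meas X -> field_meas Y ->
  measurable_fun setT (fun p => gram_form (gram g : borel M -> 'M[R]_d) p (X p) (Y p)).
Proof.
move=> mX mY; apply: (@chart_domain_measurable_fun (fun p => inner g X Y p)) => q.
set c := chart_at S q; have Sc := chart_at_atlas S q.
apply: (eq_measurable_fun (fun p : borel M => \sum_(k <- index_enum 'I_d)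
  (\sum_(l <- index_enum 'I_d) field_in S c X p ord0 l * gram_in S g c p l k) *
   field_in S c Y p ord0 k)).
  move=> p /[!inE] cp; rewrite (inner_in g Sc cp) [RHS]mxE; apply: eq_bigr => k _.
  by rewrite [X in _ = X * _]mxE [X in _ = _ * X]mxE.
apply: measurable_fun_bigsum => k; apply: measurable_funM; last exact: mY.
apply: measurable_fun_bigsum => l; apply: measurable_funM; first exact: mX.
apply: continuous_borel_measurable; first exact: chart_dom_open.
by move=> p cp; exact: gram_in_continuous.
Qed.

(** At a fixed p the change of chart is a fixed matrix, so convergence of the distinguished
    components passes to the components in c; the indicator of A settles the points without
    convergence. *)
Lemma field_meas_lim (Y : nat -> borel M -> 'rV[R]_d) (X : borel M -> 'rV[R]_d) A :
  (forall j, field_meas (Y j)) -> measurable A ->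
  (forall p i, A p -> Y j p ord0 i @[j --> \oo] --> X p ord0 i) ->
  (forall p, ~ A p -> X p = 0) -> field_meas X.
Proof.
move=> mY mA cY X0 c Sc i.
apply: (@measurable_fun_cvg _ _ _ (chart_dom c : set (borel M))
  (fun j p => \1_A p * field_in S c (Y j) p ord0 i)).
  move=> j; apply: measurable_funM; last exact: mY.
  exact: measurable_funTS.
move=> p _; have [Ap|nAp] := pselect (A p).
  under eq_cvg do rewrite indicE mem_set// mul1r /field_in mxE.
  rewrite /field_in mxE; apply: cvg_bigsum => k.
  by apply: cvgM; [exact: cY|exact: cvg_cst].
under eq_cvg do rewrite indicE memNset// mul0r.
by rewrite /field_in X0// mul0mx mxE; exact: cvg_cst.
Qed.

Lemma gram_symm p : (g p)^T = g p. Proof. exact: gram_sym. Qed.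

Lemma gram_unit p : g p \in unitmx.
Proof.
rewrite unitmxE unitfE gt_eqF//; apply: posdef_det_gt0; first exact: gram_sym.
by move=> v; exact: gram_posdef.
Qed.

Lemma gram_ge0 p (v : 'rV[R]_d) : 0 <= (v *m g p *m v^T) ord0 ord0.
Proof.
have [->|v0] := eqVneq v 0; first by rewrite !mul0mx mxE.
by apply: ltW; exact: gram_posdef.
Qed.

Lemma gradient_in_continuous c f i p : smoothM S f -> charts S c -> chart_dom c p ->
  {for p, continuous (fun p => field_in S c (gradient g f) p ord0 i)}.
Proof.
move=> sf Sc cp; apply: (continuous_at_chart cp); set x := chart_map c p.
have cx : chart_im c x by exact: chart_map_im.
have cr := vol_density_C1 g Sc.
have r0 y : chart_im c y -> vol_density g c y != 0.
  by move=> cy; rewrite gt_eqF// vol_density_gt0.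
pose V x := vol_density g c x * field_in S c (gradient g f) (chart_inv c x) ord0 i.
have cV : Ck 1 (chart_im c) V by exact: gradient_density_C1.
apply: (near_eq_continuous_at (f := fun y => V y * (vol_density g c y)^-1)).
  by apply: filterS (near_chart_im cx) => y cy /=; rewrite /V mulrAC mulfV ?r0// mul1r.
exact: (cvgM (C1_continuous cV cx) (cvgV (r0 x cx) (C1_continuous cr cx))).
Qed.

Lemma gradient_L2 f : smoothM S f -> L2_field g pi (gradient g f).
Proof.
move=> sf; split.
  move=> c Sc i; apply: (@continuous_borel_measurable _ _ (chart_dom c)
    (fun p => field_in S c (gradient g f) p ord0 i)).
    exact: chart_dom_open.
  by move=> p cp; exact: gradient_in_continuous.
have := continuous_integrable M_compact pi
  (inner_gradient_continuous (g := g) sf (smoothM_C1 sf)).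
exact.
Qed.

Lemma continuous_L2 (f : M -> R) : continuous f -> L2 pi f.
Proof.
move=> cf; apply: L2_intro; first exact: continuous_measurable.
have cf2 : continuous (fun p => f p * f p) by move=> p; exact: (cvgM (@cf p) (@cf p)).
exact: (continuous_integrable M_compact pi cf2).
Qed.

End Fields.

Section SmoothLinear.
Context {R : realType} {d : nat}.
Implicit Types (O : set 'rV[R]_d) (f h : 'rV[R]_d -> R).

Lemma Ck_eq k O f h : open O -> (forall x, O x -> f x = h x) -> Ck k O f -> Ck k O h.
Proof.
move=> oO; elim: k f h => [|k IH] f h fh.
  move=> cf x Ox; apply: (near_eq_continuous_at _ (cf x Ox)).
  by apply: filterS (open_nbhs_nbhs (conj oO Ox)) => y /fh.
have nfh x : O x -> \forall y \near x, f y = h y.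
  by move=> Ox; apply: filterS (open_nbhs_nbhs (conj oO Ox)) => y /fh.
move=> [df cf]; split=> [x Ox|i].
  exact: near_eq_differentiable (nfh x Ox) (df x Ox).
apply: (IH (partial i f)); last exact: cf.
by move=> x Ox; apply: near_eq_partial; exact: nfh.
Qed.

Lemma partialZD i (a : R) f h x : differentiable f x -> differentiable h x ->
  partial i (fun x => a * f x + h x) x = a * partial i f x + partial i h x.
Proof.
move=> df dh; have da : differentiable (fun=> a) x by exact: differentiable_cst.
rewrite (partialD _ _ dh); last exact: differentiableM.
rewrite (partialM i da df); congr (_ + _).
by rewrite /partial (derive_cst (a : R)) mulr0 addr0.
Qed.

Lemma CkZD k O (a : R) f h : open O -> Ck k O f -> Ck k O h ->
  Ck k O (fun x => a * f x + h x).
Proof.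
move=> oO; elim: k f h => [|k IH] f h.
  move=> cf ch x Ox.
  have ca : {for x, continuous (fun _ : 'rV[R]_d => a)} by exact: (@cst_continuous _ _ a x).
  exact: (cvgD (cvgM ca (cf x Ox)) (ch x Ox)).
move=> [df cf] [dh ch]; split=> [x Ox|i].
  apply: differentiableD; last exact: dh.
  by apply: differentiableM; [exact: differentiable_cst|exact: df].
apply: (Ck_eq (f := fun x => a * partial i f x + partial i h x)) => //.
  by move=> x Ox; rewrite partialZD//; [exact: df|exact: dh].
by apply: IH; [exact: cf|exact: ch].
Qed.

End SmoothLinear.

(** * Closability of the gradient and completeness *)

Section Sobolev.
Context {R : realType} {M : ptopologicalType} {d : nat}.
Hypotheses (M_hausdorff : hausdorff_space M) (M_compact : compact [set: M]).
Variables (S : oriented_atlas R M d) (g : riemannian_metric S).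
Variables (vol : {measure set (borel M) -> \bar R}) (vol_g : riemannian_volume g vol).
Variables (U : M -> R) (U_C1 : CkM S 1 U).
Variables (pi : probability (borel M) R) (pi_gibbs : gibbs pi vol U).

Local Notation gb := (gram g : borel M -> 'M[R]_d).
Local Notation L2F := (L2_field g pi).
Implicit Types (X Y Z : vfield R M d) (u v w f h : M -> R).

Definition fip X Y : R := \int[pi]_(p in [set: borel M]) inner g X Y p.

Let fsym := gram_symm g : forall p : borel M, (gb p)^T = gb p.
Let funit := gram_unit g : forall p : borel M, gb p \in unitmx.
Let fge0 := @gram_ge0 R M d S g :
  forall (p : borel M) (v : 'rV[R]_d), 0 <= (v *m gb p *m v^T) ord0 ord0.
Let fform := @field_meas_form R M d M_compact S g.

Lemma L2FZD (a : R) X Y : L2F X -> L2F Y -> L2F (fun p => a *: X p + Y p).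
Proof.
exact: (@fieldL2ZD _ _ _ pi d gb fsym fge0 (field_meas S) (@field_measZD _ _ _ S) fform).
Qed.

Lemma L2FB X Y : L2F X -> L2F Y -> L2F (X \- Y).
Proof. exact: (@fieldL2B _ _ _ pi d gb fsym fge0 (field_meas S) (@field_measZD _ _ _ S) fform). Qed.

Lemma fipC X Y : fip X Y = fip Y X.
Proof. exact: (@field_ipC _ _ _ pi d gb fsym). Qed.

Lemma fip_ge0 X : 0 <= fip X X.
Proof. exact: (@field_ip_ge0 _ _ _ pi d gb fge0). Qed.

Lemma fipZD (a : R) X Y Z : L2F X -> L2F Y -> L2F Z ->
  fip (fun p => a *: X p + Y p) Z = a * fip X Z + fip Y Z.
Proof. exact: (@field_ipZD _ _ _ pi d gb fsym fge0 (field_meas S) fform). Qed.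

Lemma fip_triangle X Y Z : L2F X -> L2F Y -> L2F Z ->
  fip (X \- Z) (X \- Z) <= 2 * fip (X \- Y) (X \- Y) + 2 * fip (Y \- Z) (Y \- Z).
Proof.
exact: (@field_ip_triangle _ _ _ pi d gb fsym fge0 (field_meas S) (@field_measZD _ _ _ S) fform).
Qed.

Lemma fip_cvg (X_ : nat -> vfield R M d) X Y : (forall k, L2F (X_ k)) -> L2F X -> L2F Y ->
  fip (X_ k \- X) (X_ k \- X) @[k --> \oo] --> 0 -> fip (X_ k) Y @[k --> \oo] --> fip X Y.
Proof.
exact: (@field_ip_cvg _ _ _ pi d gb fsym fge0 (field_meas S) (@field_measZD _ _ _ S) fform).
Qed.

Lemma L2F_complete (X_ : nat -> vfield R M d) : (forall k, L2F (X_ k)) ->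
  (forall e : R, 0 < e -> exists N, forall m k, (N <= m)%N -> (N <= k)%N ->
    fip (X_ m \- X_ k) (X_ m \- X_ k) < e) ->
  exists2 X, L2F X & fip (X_ k \- X) (X_ k \- X) @[k --> \oo] --> 0.
Proof.
exact: (@fieldL2_complete _ _ _ pi d gb fsym funit fge0 (field_meas S)
  (@field_measZD _ _ _ S) fform (@field_meas_lim _ _ _ S) X_).
Qed.

(** The constant sequence X converges to Y. *)
Lemma fip_null X Y Z : L2F X -> L2F Y -> L2F Z -> fip (X \- Y) (X \- Y) = 0 ->
  fip X Z = fip Y Z.
Proof.
move=> LX LY LZ XY0; have := @fip_cvg (fun=> X) Y Z (fun=> LX) LY LZ.
rewrite XY0 => /(_ (cvg_cst _)) h.
have h2 : fip X Z @[k --> \oo] --> fip X Z by exact: cvg_cst.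
exact: (cvg_unique _ h2 h).
Qed.

Lemma fipBB X Y : L2F X -> L2F Y ->
  fip (X \- Y) (X \- Y) = fip X X - 2 * fip X Y + fip Y Y.
Proof.
move=> LX LY; have LXY := L2FB LX LY.
have E Z : L2F Z -> fip (X \- Y) Z = fip X Z - fip Y Z.
  move=> LZ; rewrite (_ : X \- Y = (fun p => -1 *: Y p + X p)).
    by rewrite fipZD// mulN1r addrC.
  by apply/funext => p /=; rewrite scaleN1r addrC.
rewrite E// ![fip _ (X \- Y)]fipC !E// (fipC Y X); ring.
Qed.

Lemma fipZD_le (a : R) X Y : L2F X -> L2F Y ->
  fip (fun p => a *: X p + Y p) (fun p => a *: X p + Y p) <=
  2 * a ^+ 2 * fip X X + 2 * fip Y Y.
Proof.
move=> LX LY; have LZ := L2FZD a LX LY; have LZm := L2FZD (- a) LX LY.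
have := fip_ge0 (fun p => - a *: X p + Y p).
rewrite !fipZD// ![fip _ (fun p => _ *: X p + Y p)]fipC !fipZD// (fipC Y X); lra.
Qed.

Local Notation T := (drift_laplacian g U).

Lemma smooth_L2 f : smoothM S f -> L2 pi f.
Proof. by move=> sf; apply: continuous_L2 => //; apply: CkM_continuous; exact: smoothM_C1 sf. Qed.

Lemma drift_L2 f : smoothM S f -> L2 pi (T f).
Proof.
move=> sf; apply: continuous_L2 => //.
exact: (drift_laplacian_continuous M_hausdorff M_compact vol_g U_C1 pi_gibbs sf).
Qed.

Lemma smooth_green f h : smoothM S f -> smoothM S h ->
  ip pi (T f) h = - fip (gradient g h) (gradient g f).
Proof.
by move=> sf sh; exact: (green M_hausdorff M_compact vol_g U_C1 pi_gibbs sf (smoothM_C1 sh)).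
Qed.

Lemma smoothZD (a : R) f h : smoothM S f -> smoothM S h -> smoothM S (fun p => a * f p + h p).
Proof.
move=> sf sh k c Sc; apply: CkZD; [exact: chart_im_open|exact: sf|exact: sh].
Qed.

Lemma gradientZD (a : R) f h : smoothM S f -> smoothM S h ->
  gradient g (fun p => a * f p + h p) = (fun p => a *: gradient g f p + gradient g h p).
Proof.
move=> sf sh; apply/funext => p; rewrite /gradient scalemxAl -mulmxDl; congr (_ *m _).
apply/matrixP => k i; rewrite !mxE.
have cp := chart_map_im (chart_at_dom S p); have Sc := chart_at_atlas S p.
by rewrite -partialZD//; [apply: (smoothM_C1 sf Sc).1|apply: (smoothM_C1 sh Sc).1].
Qed.

Local Notation sob := (is_sobolev_gradient g pi).
Local Notation Lsub := (L2_subspace pi).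
Local Notation Lsi := (L2_semi_inner pi).

(** Green's formula passes to the limit because both second derivatives fall on the smooth h,
    leaving only L^2 convergence of the approximants on the right. *)
Lemma sob_green u X h : L2 pi u -> sob u X -> smoothM S h ->
  fip X (gradient g h) = - ip pi (T h) u.
Proof.
move=> Lu [LX [f_ [sf cf cg]]] sh.
have Lf n := smooth_L2 (sf n).
have c1 : fip (gradient g (f_ n)) (gradient g h) @[n --> \oo] --> fip X (gradient g h).
  by apply: fip_cvg => // [n|]; exact: gradient_L2.
have c2 : - ip pi (T h) (f_ n) @[n --> \oo] --> - ip pi (T h) u.
  apply: cvgN; apply: (semi_inner_cvg Lsub Lsi) => //; exact: drift_L2.
have e : (fun n => fip (gradient g (f_ n)) (gradient g h)) = (fun n => - ip pi (T h) (f_ n)).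
  by apply/funext => n; rewrite smooth_green// opprK.
by rewrite e in c1; exact: (cvg_unique _ c1 c2).
Qed.

(** Closability. The approximants of u serve as test functions: each gradient pairs with X to -<T
    f_n, u> = 0, while these pairings tend to <X, X>. *)
Lemma sob_null u X : L2 pi u -> ip pi u u = 0 -> sob u X -> fip X X = 0.
Proof.
move=> Lu u0 sX; have := sX => -[LX [f_ [sf cf cg]]].
have c1 : fip (gradient g (f_ n)) X @[n --> \oo] --> fip X X.
  by apply: fip_cvg => // n; exact: gradient_L2.
have c2 : (0 : R) @[n --> \oo] --> (0 : R) by exact: cvg_cst.
have e : (fun n => fip (gradient g (f_ n)) X) = (fun=> 0).
  apply/funext => n; rewrite fipC (sob_green Lu sX (sf n)).
  have LT := drift_L2 (sf n).
  by rewrite (semi_innerC Lsi LT Lu) (semi_inner_null Lsub Lsi Lu LT u0) oppr0.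
by rewrite e in c1; exact: (cvg_unique _ c1 c2).
Qed.

Lemma sobZD (a : R) u v X Y : L2 pi u -> L2 pi v -> sob u X -> sob v Y ->
  sob (fun p => a * u p + v p) (fun p => a *: X p + Y p).
Proof.
move=> Lu Lv [LX [f_ [sf cf cgf]]] [LY [h_ [sh ch cgh]]].
split; first exact: L2FZD.
exists (fun n p => a * f_ n p + h_ n p); split.
- by move=> n; exact: smoothZD.
- have Lf n := smooth_L2 (sf n); have Lh n := smooth_L2 (sh n).
  have c : 2 * a ^+ 2 * ip pi (f_ n \- u) (f_ n \- u) +
      2 * ip pi (h_ n \- v) (h_ n \- v) @[n --> \oo] --> 2 * a ^+ 2 * 0 + 2 * 0.
    by apply: cvgD; apply: cvgM => //; exact: cvg_cst.
  rewrite !mulr0 addr0 in c; apply: squeeze_cvgr (cvg_cst 0) c; apply: nearW => n.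
  have -> : (fun p => a * f_ n p + h_ n p) \- (fun p => a * u p + v p) =
      (fun p => a * (f_ n \- u) p + (h_ n \- v) p) by apply/funext => p /=; ring.
  have L1 := subspaceB Lsub (Lf n) Lu; have L2' := subspaceB Lsub (Lh n) Lv.
  rewrite (semi_innerZD_le Lsub Lsi)// andbT; apply: (semi_inner_ge0 Lsi).
  exact: Lsub.2.
- have Lf n := gradient_L2 M_compact g pi (sf n); have Lh n := gradient_L2 M_compact g pi (sh n).
  have c : 2 * a ^+ 2 * fip (gradient g (f_ n) \- X) (gradient g (f_ n) \- X) +
      2 * fip (gradient g (h_ n) \- Y) (gradient g (h_ n) \- Y) @[n --> \oo] -->
      2 * a ^+ 2 * 0 + 2 * 0.
    by apply: cvgD; apply: cvgM => //; exact: cvg_cst.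
  rewrite !mulr0 addr0 in c; apply: squeeze_cvgr (cvg_cst 0) c; apply: nearW => n.
  rewrite -/(fip _ _) gradientZD//.
  have -> : (fun p => a *: gradient g (f_ n) p + gradient g (h_ n) p) \-
      (fun p => a *: X p + Y p) =
      (fun p => a *: (gradient g (f_ n) \- X) p + (gradient g (h_ n) \- Y) p).
    by apply/funext => p /=; rewrite scalerBr opprD addrACA.
  by rewrite fip_ge0 fipZD_le//; exact: L2FB.
Qed.

Lemma sob_unique u v X Y : L2 pi u -> L2 pi v -> ip pi (u \- v) (u \- v) = 0 ->
  sob u X -> sob v Y -> fip (X \- Y) (X \- Y) = 0.
Proof.
move=> Lu Lv uv0 sX sY; have := sobZD (-1) Lv Lu sY sX.
have -> : (fun p => -1 * v p + u p) = u \- v.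
  by apply/funext => p /=; rewrite mulN1r addrC.
have -> : (fun p => -1 *: Y p + X p) = X \- Y.
  by apply/funext => p /=; rewrite scaleN1r addrC.
by apply: sob_null => //; exact: (subspaceB Lsub).
Qed.

Definition sobolev : set (M -> R) := [set u | L2 pi u /\ exists X, sob u X].

Lemma sobolev_nabla u : sobolev u -> sob u (nabla g pi u).
Proof. by move=> [_ [X sX]]; rewrite /nabla; exact: (xgetPex _ (ex_intro _ X sX)). Qed.

(** [nabla] selects an arbitrary Sobolev gradient; by closability every other choice gives the same
    form. *)
Lemma ipH1E u v X Y : L2 pi u -> L2 pi v -> sob u X -> sob v Y ->
  ipH1 g pi u v = fip X Y.
Proof.
move=> Lu Lv sX sY.
have su : sobolev u by split=> //; exists X.
have sv : sobolev v by split=> //; exists Y.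
have su' := sobolev_nabla su; have sv' := sobolev_nabla sv.
have uu0 w : L2 pi w -> ip pi (w \- w) (w \- w) = 0.
  by move=> Lw; rewrite (semi_innerBB Lsub Lsi Lw Lw); ring.
have h1 := sob_unique Lu Lu (uu0 _ Lu) su' sX.
have h2 := sob_unique Lv Lv (uu0 _ Lv) sv' sY.
rewrite /ipH1 -/(fip _ _) (fip_null su'.1 sX.1 sv'.1 h1) fipC.
by rewrite (fip_null sv'.1 sY.1 sX.1 h2) fipC.
Qed.

Lemma sobolev_subspace : subspace sobolev.
Proof.
split; last first.
  move=> a u v [Lu [X sX]] [Lv [Y sY]]; split; first exact: Lsub.2.
  by exists (fun p => a *: X p + Y p); exact: sobZD.
have s0 : smoothM S (fun=> 0).
  move=> k c Sc; have e : (fun=> 0) \o chart_inv c = (fun=> 0) :> ('rV[R]_d -> R) by [].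
  rewrite e; elim: k => [|k IH]; first by move=> x _; exact: (@cst_continuous _ _ (0 : R) x).
  split=> [x _|i]; first exact: differentiable_cst.
  have -> // : partial i (fun=> 0) = (fun=> 0) :> ('rV[R]_d -> R).
  by apply/funext => y; rewrite /partial; exact: derive_cst.
split; first exact: Lsub.1.
exists (gradient g (fun=> 0)); split; first exact: gradient_L2.
exists (fun=> fun=> 0); split => //.
  rewrite /cvgL2; under eq_cvg do rewrite (semi_innerBB Lsub Lsi Lsub.1 Lsub.1).
  have -> : ip pi (fun=> 0) (fun=> 0) - 2 * ip pi (fun=> 0) (fun=> 0) +
    ip pi (fun=> 0) (fun=> 0) = 0 by ring.
  exact: cvg_cst.
have L0 := gradient_L2 M_compact g pi s0.
rewrite -/(fip _ _) fipBB// (_ : _ + _ = 0); last by ring.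
exact: cvg_cst.
Qed.

Lemma ipH1_semi_inner : semi_inner sobolev (ipH1 g pi).
Proof.
split.
- move=> u v [Lu [X sX]] [Lv [Y sY]].
  by rewrite (ipH1E Lu Lv sX sY) (ipH1E Lv Lu sY sX) fipC.
- move=> a u v w [Lu [X sX]] [Lv [Y sY]] [Lw [Z sZ]].
  have Lauv := Lsub.2 a u v Lu Lv.
  rewrite (ipH1E Lauv Lw (sobZD a Lu Lv sX sY) sZ) (ipH1E Lu Lw sX sZ) (ipH1E Lv Lw sY sZ).
  by rewrite fipZD//; [exact: sX.1|exact: sY.1|exact: sZ.1].
- by move=> u [Lu [X sX]]; rewrite (ipH1E Lu Lu sX sX) fip_ge0.
Qed.

Local Notation Wsub := sobolev_subspace.
Local Notation Wsi := ipH1_semi_inner.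

Lemma ipH1_null z : sobolev z -> ip pi z z = 0 -> ipH1 g pi z z = 0.
Proof. by move=> [Lz [X sX]] z0; rewrite (ipH1E Lz Lz sX sX); exact: sob_null z0 sX. Qed.

(** The smooth functions approximating v also approximate u, with the same gradient. *)
Lemma sobolev_sat u v : L2 pi u -> sobolev v -> ip pi (u \- v) (u \- v) = 0 -> sobolev u.
Proof.
move=> Lu [Lv [X [LX [f_ [sf cf cg]]]]] uv0; split => //; exists X; split=> //.
exists f_; split=> //.
have c : 2 * ip pi (f_ n \- v) (f_ n \- v) + 0 @[n --> \oo] --> 2 * 0 + (0 : R).
  by apply: cvgD; [apply: cvgM => //; exact: cvg_cst|exact: cvg_cst].
rewrite mulr0 addr0 in c; apply: squeeze_cvgr (cvg_cst 0) c; apply: nearW => n.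
have Lf := smooth_L2 (sf n).
have := semi_inner_triangle Lsub Lsi Lf Lv Lu.
have -> : ip pi (v \- u) (v \- u) = ip pi (u \- v) (u \- v).
  exact: (semi_innerBBC Lsub Lsi).
rewrite uv0 mulr0 addr0 => ->; rewrite andbT; apply: (semi_inner_ge0 Lsi).
exact: (subspaceB Lsub).
Qed.

(** Diagonal argument: a Sobolev gradient is a limit of gradients of smooth functions, so each
    [u_ n] is replaced by a smooth function within 1 / (n + 1) in both squared distances. *)
Lemma sobolev_limit (u_ : nat -> M -> R) u X : (forall n, sobolev (u_ n)) -> L2 pi u -> L2F X ->
  cvgL2 pi u_ u ->
  fip (nabla g pi (u_ n) \- X) (nabla g pi (u_ n) \- X) @[n --> \oo] --> 0 -> sob u X.
Proof.
move=> Wu Lu LX cu cX; split=> //.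
have /choice [f_ hf] : forall n, exists f, [/\ smoothM S f,
    ip pi (f \- u_ n) (f \- u_ n) < n.+1%:R^-1 &
    fip (gradient g f \- nabla g pi (u_ n)) (gradient g f \- nabla g pi (u_ n)) < n.+1%:R^-1].
  move=> n; have [Ln [h_ [sh ch cgh]]] := sobolev_nabla (Wu n).
  have e0 : 0 < n.+1%:R^-1 :> R by rewrite invr_gt0 ltr0n.
  move/cvgrPdist_lt : ch => /(_ _ e0) [N1 _ h1].
  move/cvgrPdist_lt : cgh => /(_ _ e0) [N2 _ h2].
  exists (h_ (maxn N1 N2)); split => //.
    have := h1 _ (leq_maxl N1 N2); rewrite /= sub0r normrN.
    exact: le_lt_trans (ler_norm _).
  have := h2 _ (leq_maxr N1 N2); rewrite /= sub0r normrN.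
  exact: le_lt_trans (ler_norm _).
have c0 : n.+1%:R^-1 @[n --> \oo] --> (0 : R) by exact: cvg_harmonic.
exists f_; split=> [n||]; first by have [] := hf n.
- have c : 2 * n.+1%:R^-1 + 2 * ip pi (u_ n \- u) (u_ n \- u) @[n --> \oo] --> 2 * 0 + 2 * (0 : R).
    by apply: cvgD; apply: cvgM => //; exact: cvg_cst.
  rewrite !mulr0 addr0 in c; apply: squeeze_cvgr (cvg_cst 0) c; apply: nearW => n.
  have [sf hf1 _] := hf n; have Lf := smooth_L2 sf; have Ln := (Wu n).1.
  apply/andP; split; first by apply: (semi_inner_ge0 Lsi); exact: (subspaceB Lsub).
  apply: le_trans (semi_inner_triangle Lsub Lsi Lf Ln Lu) _.
  by rewrite lerD2r ler_pM2l// ltW.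
- have c : 2 * n.+1%:R^-1 + 2 * fip (nabla g pi (u_ n) \- X) (nabla g pi (u_ n) \- X)
      @[n --> \oo] --> 2 * 0 + 2 * (0 : R).
    by apply: cvgD; apply: cvgM => //; exact: cvg_cst.
  rewrite !mulr0 addr0 in c; apply: squeeze_cvgr (cvg_cst 0) c; apply: nearW => n.
  have [sf _ hf2] := hf n; have Lf := gradient_L2 M_compact g pi sf.
  have [Ln _] := sobolev_nabla (Wu n).
  rewrite -/(fip _ _) fip_ge0/=.
  apply: le_trans (fip_triangle Lf Ln LX) _.
  by rewrite lerD2r ler_pM2l// ltW.
Qed.

(** Functions and gradients converge separately in their L^2 spaces, and [sobolev_limit] shows that
    the second limit is a gradient of the first. *)
Lemma sobolev_complete (u_ : nat -> M -> R) : (forall n, sobolev (u_ n)) ->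
  cauchy_for (fun f => ipH1 g pi f f + ip pi f f) u_ ->
  exists2 u, sobolev u & ipH1 g pi (u_ n \- u) (u_ n \- u) + ip pi (u_ n \- u) (u_ n \- u)
    @[n --> \oo] --> 0.
Proof.
move=> Wu cu.
have Lu n := (Wu n).1; have su n := sobolev_nabla (Wu n).
have Wd m n := subspaceB Wsub (Wu m) (Wu n).
have EB u v X Y : sobolev u -> sobolev v -> sob u X -> sob v Y ->
    ipH1 g pi (u \- v) (u \- v) = fip (X \- Y) (X \- Y).
  move=> [Lu' _] [Lv' _] sX sY; have := sobZD (-1) Lv' Lu' sY sX.
  have -> : (fun p => -1 * v p + u p) = u \- v.
    by apply/funext => p /=; rewrite mulN1r addrC.
  have -> : (fun p => -1 *: Y p + X p) = X \- Y.
    by apply/funext => p /=; rewrite scaleN1r addrC.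
  by move=> s; have Luv := subspaceB Lsub Lu' Lv'; rewrite (ipH1E Luv Luv s s).
have [u Lu' cvu] : exists2 u, L2 pi u & cvgL2 pi u_ u.
  apply: L2_complete => // e e0; have [N hN] := cu e e0; exists N => m n Nm Nn.
  by have := hN m n Nm Nn; have := semi_inner_ge0 Wsi (Wd m n); lra.
have [X LX cX] : exists2 X, L2F X & fip (nabla g pi (u_ n) \- X) (nabla g pi (u_ n) \- X)
    @[n --> \oo] --> 0.
  apply: (@L2F_complete (fun n => nabla g pi (u_ n))) => [n|e e0]; first exact: (su n).1.
  have [N hN] := cu e e0; exists N => m n Nm Nn.
  rewrite -(EB _ _ _ _ (Wu m) (Wu n) (su m) (su n)).
  have := hN m n Nm Nn; have := semi_inner_ge0 Lsi (Wd m n).1; lra.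
have sX := sobolev_limit Wu Lu' LX cvu cX.
have Wlim : sobolev u by split=> //; exists X.
exists u => //; rewrite -[X in _ --> X](addr0 (0 : R)); apply: cvgD => //.
by under eq_cvg do rewrite (EB _ _ _ _ (Wu _) Wlim (su _) sX).
Qed.

(** By Green's formula the Friedrichs condition says that the gradients of the approximants are
    Cauchy, which puts r in the Sobolev space. The adjoint relation then identifies the pairing with
    smooth functions, and density extends it to v. *)
Lemma friedrichs_green r w v : generator g pi U r w -> sobolev r /\
  (sobolev v -> ipH1 g pi r v = - ip pi w v).
Proof.
move=> [Lr Lw [f_ [sf cf cT]] adj].
have Lf n := smooth_L2 (sf n); have Lgf n := gradient_L2 M_compact g pi (sf n).
have [X LX cX] : exists2 X, L2F X & fip (gradient g (f_ n) \- X) (gradient g (f_ n) \- X)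
    @[n --> \oo] --> 0.
  apply: (@L2F_complete (fun n => gradient g (f_ n))) => // e e0.
  have [N hN] := cT e e0; exists N => m n Nm Nn; have := hN m n Nm Nn.
  have -> : f_ m \- f_ n = (fun p => -1 * f_ n p + f_ m p).
    by apply/funext => p /=; rewrite mulN1r addrC.
  have sd := smoothZD (-1) (sf n) (sf m).
  rewrite smooth_green// opprK gradientZD//.
  by rewrite (_ : (fun p => -1 *: _ + _) = gradient g (f_ m) \- gradient g (f_ n))//;
    apply/funext => p /=; rewrite scaleN1r addrC.
have sX : sob r X by split=> //; exists f_.
have Wr : sobolev r by split=> //; exists X.
split=> // -[Lv [Y sY]]; have := sY => -[LY [h_ [sh ch cgh]]].
rewrite (ipH1E Lr Lv sX sY).
have Lh n := smooth_L2 (sh n); have Lgh n := gradient_L2 M_compact g pi (sh n).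
have c1 : fip (gradient g (h_ n)) X @[n --> \oo] --> fip Y X by exact: fip_cvg.
have c2 : - ip pi w (h_ n) @[n --> \oo] --> - ip pi w v.
  by apply: cvgN; exact: (semi_inner_cvg Lsub Lsi).
have e : (fun n => fip (gradient g (h_ n)) X) = (fun n => - ip pi w (h_ n)).
  apply/funext => n; rewrite fipC (sob_green Lr sX (sh n)) -(adj _ (sh n)).
  by rewrite (semi_innerC Lsi (drift_L2 (sh n)) Lr).
by rewrite e in c1; rewrite fipC; exact: (cvg_unique _ c1 c2).
Qed.

End Sobolev.

(** * Identification of the form *)

Section Assembly.
Context {R : realType} {M : ptopologicalType} {d : nat}.
Hypotheses (M_hausdorff : hausdorff_space M) (M_compact : compact [set: M]).
Variables (S : oriented_atlas R M d) (g : riemannian_metric S).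
Variables (vol : {measure set (borel M) -> \bar R}) (vol_g : riemannian_volume g vol).
Variables (U : M -> R) (U_C1 : CkM S 1 U).
Variables (pi : probability (borel M) R) (pi_gibbs : gibbs pi vol U).
Variables (lam : nat -> R) (phi : nat -> M -> R).
Hypothesis A_eigen : eigenbasis pi (generator g pi U) lam phi.

Local Notation Lsub := (L2_subspace pi).
Local Notation Lsi := (L2_semi_inner pi).
Local Notation W := (sobolev g pi).
Local Notation H1 := (Hm pi lam phi 1).
Local Notation E := (ipH1 g pi).

Let Wsub : subspace W := sobolev_subspace M_compact g pi.
Let Wsi : semi_inner W E := ipH1_semi_inner M_hausdorff M_compact vol_g U_C1 pi_gibbs.
Let Wnull := ipH1_null M_hausdorff M_compact vol_g U_C1 pi_gibbs.
Let Wsat := @sobolev_sat R M d M_compact S g pi.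
Let Wcomplete := sobolev_complete M_hausdorff M_compact vol_g U_C1 pi_gibbs.
Let Wfried := friedrichs_green M_hausdorff M_compact vol_g U_C1 pi_gibbs.

Let WL u : W u -> L2 pi u. Proof. by case. Qed.

Lemma lam_ge0 k : 0 <= lam k.
Proof.
have [[l0 _ lS _] _ _ _ _] := A_eigen.
by elim: k => [|k IH]; [rewrite l0|exact: le_trans (lS k)].
Qed.

Lemma eigen_sobolev k : W (phi k).
Proof.
have [_ hA _ _ _] := A_eigen.
by have [] := Wfried (phi 0%N) (hA k).
Qed.

Lemma eigen_form k v : W v -> E (phi k) v = lam k * ip pi (phi k) v.
Proof.
move=> Wv; have [_ hA _ _ _] := A_eigen.
have [_ /(_ Wv) ->] := Wfried v (hA k).
by rewrite (semi_innerZl Lsub Lsi) ?mulNr ?opprK//; apply: WL => //; exact: eigen_sobolev.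
Qed.

Definition eigen_sum u n : M -> R := fun p => \sum_(k < n) ip pi u (phi k) * phi k p.

Definition eigen_energy u n : R := \sum_(k < n) lam k * ip pi u (phi k) ^+ 2.

Lemma eigen_sumS u n :
  eigen_sum u n.+1 = (fun p => ip pi u (phi n) * phi n p + eigen_sum u n p).
Proof. by apply/funext => p; rewrite /eigen_sum big_ord_recr/= addrC. Qed.

Lemma eigen_sum_sobolev u n : W (eigen_sum u n).
Proof.
elim: n => [|n IH]; last by rewrite eigen_sumS; apply: Wsub.2 => //; exact: eigen_sobolev.
have -> : eigen_sum u 0 = (fun=> 0); last exact: Wsub.1.
by apply/funext => p; rewrite /eigen_sum big_ord0.
Qed.

Let phiL k : L2 pi (phi k). Proof. exact: WL (eigen_sobolev k). Qed.
Let sumL u n : L2 pi (eigen_sum u n). Proof. exact: WL (eigen_sum_sobolev u n). Qed.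

Lemma eigen_sum_form u n v : W v ->
  E (eigen_sum u n) v = \sum_(k < n) ip pi u (phi k) * (lam k * ip pi (phi k) v).
Proof.
move=> Wv; elim: n => [|n IH].
  have -> : eigen_sum u 0 = (fun p => 0 * v p).
    by apply/funext => p; rewrite /eigen_sum big_ord0 mul0r.
  by rewrite (semi_innerZl Wsub Wsi)// mul0r big_ord0.
have [_ lin _] := Wsi.
rewrite eigen_sumS lin//; [|exact: eigen_sobolev|exact: eigen_sum_sobolev].
by rewrite IH big_ord_recr/= addrC eigen_form.
Qed.

Lemma eigen_sum_ip u n j : ip pi (eigen_sum u n) (phi j) =
  \sum_(k < n) ip pi u (phi k) * (k == j :> nat)%:R.
Proof.
have [_ _ ortho _ _] := A_eigen.
elim: n => [|n IH].
  have -> : eigen_sum u 0 = (fun p => 0 * phi j p).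
    by apply/funext => p; rewrite /eigen_sum big_ord0 mul0r.
  by rewrite (semi_innerZl Lsub Lsi)// mul0r big_ord0.
have [_ lin _] := Lsi.
by rewrite eigen_sumS lin// IH big_ord_recr/= addrC ortho.
Qed.

Lemma eigen_sum_form_sum u n m : (n <= m)%N ->
  E (eigen_sum u n) (eigen_sum u m) = eigen_energy u n.
Proof.
move=> nm; rewrite eigen_sum_form; last exact: eigen_sum_sobolev.
apply: eq_bigr => k _.
have km : (k < m)%N := leq_trans (ltn_ord k) nm.
rewrite (semi_innerC Lsi (phiL k) (sumL u m)) eigen_sum_ip (bigD1 (Ordinal km))//= eqxx mulr1.
rewrite big1 ?addr0 => [|i ik]; first by rewrite expr2; ring.
by rewrite -val_eqE/= in ik; rewrite (negbTE ik) mulr0.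
Qed.

Lemma eigen_sum_form_self u n : W u -> E (eigen_sum u n) u = eigen_energy u n.
Proof.
move=> Wu; rewrite eigen_sum_form//; apply: eq_bigr => k _.
by rewrite (semi_innerC Lsi (phiL k) (WL Wu)) expr2; ring.
Qed.

Lemma eigen_sum_diff u n m : (n <= m)%N ->
  E (eigen_sum u m \- eigen_sum u n) (eigen_sum u m \- eigen_sum u n) =
  eigen_energy u m - eigen_energy u n.
Proof.
move=> nm; have Wn := eigen_sum_sobolev u n; have Wm := eigen_sum_sobolev u m.
rewrite (semi_innerBB Wsub Wsi Wm Wn) (semi_innerC Wsi Wm Wn).
by rewrite !eigen_sum_form_sum//; ring.
Qed.

Lemma eigen_energy_mono u n m : (n <= m)%N -> eigen_energy u n <= eigen_energy u m.
Proof.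
move=> nm; rewrite -subr_ge0 -eigen_sum_diff//; apply: (semi_inner_ge0 Wsi).
by apply: (subspaceB Wsub); exact: eigen_sum_sobolev.
Qed.

Lemma eigen_energy_le u n : W u -> eigen_energy u n <= E u u.
Proof.
move=> Wu; have Wn := eigen_sum_sobolev u n.
have := semi_inner_ge0 Wsi (subspaceB Wsub Wu Wn).
rewrite (semi_innerBB Wsub Wsi Wu Wn) (semi_innerC Wsi Wu Wn) eigen_sum_form_self//.
by rewrite eigen_sum_form_sum//; lra.
Qed.

Let energyE u n : (\sum_(0 <= k < n) (`|ip pi u (phi k)| ^+ 2 * lam k ^+ 1)%:E =
  (eigen_energy u n)%:E)%E.
Proof.
rewrite sumEFin; congr EFin; rewrite /eigen_energy big_mkord; apply: eq_bigr => k _.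
by rewrite real_normK ?num_real// expr1 mulrC.
Qed.

Let term_ge0 u k : (0 <= (`|ip pi u (phi k)| ^+ 2 * lam k ^+ 1)%:E)%E.
Proof. by rewrite lee_fin mulr_ge0// ?exprn_ge0// lam_ge0. Qed.

(** Links the spectral definition of H^1 with the space on which the gradient form is controlled. A
    finite spectral sum makes the eigenvector expansion Cauchy in the form norm; its limit in W
    equals u only almost everywhere, so [Wsat] is needed to conclude. *)
Lemma Hm1_sobolev : H1 = W.
Proof.
apply/seteqP; split=> [u [Lu su]|u Wu]; last first.
  split; first exact: WL.
  apply: (@le_lt_trans _ _ (E u u)%:E); last exact: ltry.
  apply: lime_le; first by apply: is_cvg_nneseries => k _ _; exact: term_ge0.
  by apply: nearW => n; rewrite energyE lee_fin; exact: eigen_energy_le.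
have [C hC] : exists C, forall n, eigen_energy u n <= C.
  exists (fine (\sum_(0 <= k <oo) (`|ip pi u (phi k)| ^+ 2 * lam k ^+ 1)%:E)%E) => n.
  rewrite -lee_fin -energyE fineK; first by apply: nneseries_lim_ge => *; exact: term_ge0.
  by rewrite ge0_fin_numE//; apply: nneseries_ge0 => k _ _; exact: term_ge0.
have cE : cvgn (eigen_energy u).
  apply: nondecreasing_is_cvgn; first by move=> n m; exact: eigen_energy_mono.
  by exists C => _ [n _ <-]; exact: hC.
have [_ _ _ complete _] := A_eigen.
have cs : cvgL2 pi (eigen_sum u) u by exact: complete.
have Ws := eigen_sum_sobolev u.
have cvg_small (e : R) : 0 < e -> exists N, forall n, (N <= n)%N ->
    ip pi (eigen_sum u n \- u) (eigen_sum u n \- u) < e.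
  move=> e0; move/cvgrPdist_lt : cs => /(_ _ e0) [N _ hN]; exists N => n Nn.
  by have := hN n Nn; rewrite /= sub0r normrN; exact: le_lt_trans (ler_norm _).
have [|u' Wu' cu'] := Wcomplete (u_ := eigen_sum u) Ws.
  move=> e e0; have e8 : 0 < e / 8 by rewrite divr_gt0.
  have [N1 h1] := cvg_small _ e8.
  move/cvgrPdist_lt : cE => /(_ _ e8) [N2 _ h2].
  exists (maxn N1 N2) => m n; rewrite !geq_max => /andP[m1 m2] /andP[n1 n2].
  have hE : E (eigen_sum u m \- eigen_sum u n) (eigen_sum u m \- eigen_sum u n) < e / 4.
    have d1 := h2 m m2; have d2 := h2 n n2; rewrite /= !ltr_norml in d1 d2.
    move/andP : d1 => [d1 d1']; move/andP : d2 => [d2 d2'].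
    have [nm|/ltnW mn] := leqP n m; first by rewrite eigen_sum_diff//; lra.
    have -> : E (eigen_sum u m \- eigen_sum u n) (eigen_sum u m \- eigen_sum u n) =
        E (eigen_sum u n \- eigen_sum u m) (eigen_sum u n \- eigen_sum u m).
      exact: (semi_innerBBC Wsub Wsi (Ws m) (Ws n)).
    by rewrite eigen_sum_diff//; lra.
  have := semi_inner_triangle Lsub Lsi (sumL u m) Lu (sumL u n).
  have -> : ip pi (u \- eigen_sum u n) (u \- eigen_sum u n) =
      ip pi (eigen_sum u n \- u) (eigen_sum u n \- u).
    exact: (semi_innerBBC Lsub Lsi Lu (sumL u n)).
  have := h1 _ m1; have := h1 _ n1; lra.
apply: (Wsat Lu Wu'); apply/eqP; rewrite eq_le; apply/andP; split; last first.
  by apply: (semi_inner_ge0 Lsi); apply: (subspaceB Lsub) => //; exact: WL.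
apply/ler_addgt0Pr => e e0; rewrite add0r.
have e4 : 0 < e / 4 by rewrite divr_gt0.
have [N1 h1] := cvg_small _ e4.
move/cvgrPdist_lt : cu' => /(_ _ e4) [N2 _ h2].
set n := maxn N1 N2; have := h1 n (leq_maxl _ _); have := h2 n (leq_maxr _ _).
rewrite /= sub0r normrN => /(le_lt_trans (ler_norm _)).
have := semi_inner_ge0 Wsi (subspaceB Wsub (Ws n) Wu').
have := semi_inner_triangle Lsub Lsi Lu (sumL u n) (WL Wu').
have -> : ip pi (u \- eigen_sum u n) (u \- eigen_sum u n) =
    ip pi (eigen_sum u n \- u) (eigen_sum u n \- u).
  exact: (semi_innerBBC Lsub Lsi Lu (sumL u n)).
lra.
Qed.

(** * The kernel of the transport operator *)

Variables (b : vfield R M d) (B : (M -> R) -> M -> R).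
Hypothesis B_ext : transport_extension g pi b H1 B.

Local Notation K := (kerB pi H1 B).

Let KW u : K u -> W u. Proof. by move=> [+ _]; rewrite Hm1_sobolev. Qed.

Let BL u : W u -> L2 pi (B u).
Proof. by have [+ _ _ _] := B_ext; rewrite Hm1_sobolev; exact. Qed.

Let B_lin (a : R) u v : W u -> W v ->
  eqL2 pi (B (fun p => a * u p + v p)) (fun p => a * B u p + B v p).
Proof. by have [_ + _ _] := B_ext; rewrite Hm1_sobolev; exact. Qed.

Let B_bound : exists2 C, 0 <= C & forall u, W u ->
  ip pi (B u) (B u) <= C * (E u u + ip pi u u).
Proof.
(* The given constant carries no sign condition. *)
have [_ _ [C hC] _] := B_ext; exists `|C| => // u Wu.
apply: (@le_trans _ _ (C * ip1 g pi 1 u u)); first by apply: hC; rewrite Hm1_sobolev.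
rewrite /ip1 mul1r; apply: ler_wpM2r; last exact: ler_norm.
by rewrite addr_ge0 ?(semi_inner_ge0 Wsi)// (semi_inner_ge0 Lsi)//; exact: WL.
Qed.

(** B acts on representatives. A null function has no energy by closability, so the bound on B makes
    its image null, and B is well defined on classes. *)
Let B_null u : W u -> ip pi u u = 0 -> eqL2 pi (B u) (fun=> 0).
Proof.
move=> Wu u0; have [C C0 hC] := B_bound; apply: ip_eq0; first exact: BL.
apply/eqP; rewrite eq_le (semi_inner_ge0 Lsi) ?andbT; last exact: BL.
by have := hC u Wu; rewrite Wnull// u0 addr0 mulr0.
Qed.

Let ip_eqL2 u v : L2 pi u -> L2 pi v -> eqL2 pi u v -> ip pi u u = ip pi v v.
Proof.
move=> Lu Lv uv; have Luv := subspaceB Lsub Lu Lv.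
have h w : L2 pi w -> ip pi (u \- v) w = 0.
  by move=> Lw; apply: (semi_inner_null Lsub Lsi) => //; exact: eqL2_ip.
have := h u Lu; have := h v Lv; rewrite !(semi_innerBl Lsi)// (semi_innerC Lsi Lv Lu); lra.
Qed.

Let K_subspace : subspace K.
Proof.
split.
  split; first by rewrite Hm1_sobolev; exact: Wsub.1.
  apply: B_null; first exact: Wsub.1.
  by rewrite /ip; under eq_Rintegral do rewrite mul0r; rewrite Rintegral_cst// mul0r.
move=> a u v Ku Kv; split; first by rewrite Hm1_sobolev; apply: Wsub.2; exact: KW.
have := B_lin a (KW Ku) (KW Kv); apply: filterS2 (filterI Ku.2 Kv.2) => p [hu hv] h _.
by rewrite (h I) (hu I) (hv I) mulr0 addr0.
Qed.

(** In the decomposition u = (u - w) + w, B annihilates the first term because it is null and the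
    second because w lies in K. *)
Let K_sat u w : L2 pi u -> K w -> ip pi (u \- w) (u \- w) = 0 -> K u.
Proof.
move=> Lu Kw uw0; have Ww := KW Kw; have Wu := Wsat Lu Ww uw0.
split; first by rewrite Hm1_sobolev.
have Wz := subspaceB Wsub Wu Ww.
have := B_lin 1 Wz Ww; have -> : (fun p => 1 * (u \- w) p + w p) = u.
  by apply/funext => p /=; rewrite mul1r subrK.
apply: filterS2 (filterI (B_null Wz uw0) Kw.2) => p [hz hw] h _.
by rewrite (h I) (hz I) (hw I) mulr0 addr0.
Qed.

Let K_complete f_ : (forall n, K (f_ n)) ->
  cauchy_for (fun f => E f f + ip pi f f) f_ ->
  exists2 u, K u & E (f_ n \- u) (f_ n \- u) + ip pi (f_ n \- u) (f_ n \- u)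
    @[n --> \oo] --> 0.
Proof.
move=> Kf cf; have [u Wu cu] := Wcomplete (fun n => KW (Kf n)) cf.
exists u => //; split; first by rewrite Hm1_sobolev.
apply: ip_eq0; first exact: BL.
have [C C0 hC] := B_bound.
have LBu := BL Wu.
(* Since [B (f_ n)] is null, [B (f_ n \- u)] is -B u almost everywhere, and the bound on B applies
   to the difference. *)
have key n : ip pi (B u) (B u) <=
    C * (E (f_ n \- u) (f_ n \- u) + ip pi (f_ n \- u) (f_ n \- u)).
  have Wf := KW (Kf n); have Wz := subspaceB Wsub Wf Wu.
  apply: le_trans (hC _ Wz).
  have e : eqL2 pi (B (f_ n \- u)) (fun p => -1 * B u p).
    have := B_lin (-1) Wu Wf; have -> : (fun p => -1 * u p + f_ n p) = f_ n \- u.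
      by apply/funext => p /=; rewrite mulN1r addrC.
    by apply: filterS2 (Kf n).2 => p hf h _; rewrite (h I) (hf I) addr0.
  have LN := subspaceZ (-1) Lsub LBu.
  rewrite (ip_eqL2 (BL Wz) LN e) (semi_innerZl Lsub Lsi (-1) LBu LN).
  by rewrite (semi_innerC Lsi LBu LN) (semi_innerZl Lsub Lsi (-1) LBu LBu); lra.
apply/eqP; rewrite eq_le (semi_inner_ge0 Lsi LBu) andbT.
have c : C * (E (f_ n \- u) (f_ n \- u) + ip pi (f_ n \- u) (f_ n \- u))
    @[n --> \oo] --> C * 0 by apply: cvgM => //; exact: cvg_cst.
rewrite mulr0 in c; apply: (cvgr_to_ge c); apply: nearW => n; exact: key.
Qed.

(** * The variational equation of the resolvent *)

Variable Rstar : R -> (M -> R) -> M -> R.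
Hypothesis Rstar_def : forall l f, 0 < l -> L2 pi f ->
  is_resolvent_star g pi (generator g pi U) K l f (Rstar l f).

(** With A r = f + l r and p the projection of r, orthogonality gives E p v + l <p, v> = E r v + l
    <r, v> = -<f, v>. The resolvent is -p almost everywhere, and exchanging the two changes neither
    form. *)
Let Rstar_spec l f : 0 < l -> L2 pi f -> K (Rstar l f) /\
  forall v, K v -> E (Rstar l f) v + l * ip pi (Rstar l f) v = ip pi f v.
Proof.
move=> l0 Lf; have [Lw [r [p [Ar [Kp proj] wp]]]] := Rstar_def l0 Lf.
have Wp := KW Kp; have Lp := WL Wp.
have KN : K (\- p).
  have := subspaceZ (-1) K_subspace Kp; congr K.
  by apply/funext => x /=; rewrite mulN1r.
have WN := KW KN; have LN := WL WN.
have z0 := eqL2_ip Lw LN wp.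
have Kw := K_sat Lw KN z0; have Ww := KW Kw.
split=> // v Kv; have Wv := KW Kv; have Lv := WL Wv.
have [Wr /(_ Wv) Erv] := Wfried v Ar; have Lr := WL Wr.
have := proj v Kv; rewrite /ip1 (semi_innerBl Wsi Wr Wp Wv) (semi_innerBl Lsi Lr Lp Lv) Erv.
have -> : ip pi (fun x => f x + l * r x) v = ip pi f v + l * ip pi r v.
  have [_ lin _] := Lsi; rewrite addrC -lin//; congr ip.
  by apply/funext => x; rewrite addrC.
have Wz := subspaceB Wsub Ww WN; have Lz := WL Wz.
have := semi_inner_null Wsub Wsi Wz Wv (Wnull Wz z0).
have := semi_inner_null Lsub Lsi Lz Lv z0.
rewrite (semi_innerBl Wsi Ww WN Wv) (semi_innerBl Lsi Lw LN Lv).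
have NE : \- p = (fun x => -1 * p x) by apply/funext => x; rewrite mulN1r.
rewrite NE (semi_innerZl Wsub Wsi (-1) Wp Wv) (semi_innerZl Lsub Lsi (-1) Lp Lv).
(* Only linear relations between these six numbers remain. *)
move: (E (Rstar l f) v) (E p v) (ip pi (Rstar l f) v) (ip pi p v) (ip pi r v) (ip pi f v).
move=> x1 x2 x3 x4 x5 x6 h1 h2 h3.
have {h1} -> : x3 = - x4 by lra.
have {h2} -> : x1 = - x2 by lra.
lra.
Qed.

Lemma resolvent_star_form : let H := closureL2 pi K in
  [/\ form_dom pi H Rstar = K,
      (forall u v, K u -> K v ->
         approx_form pi Rstar u v l @[l --> +oo] --> E u v),
      (forall u v, K u -> K v -> form_of pi Rstar u v = E u v) &
      closed_form pi H (form_dom pi H Rstar) (form_of pi Rstar)].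
Proof.
apply: (form_of_resolvent Lsub Lsi _ K_subspace).
- by move=> u /KW; exact: WL.
- have [EC EZD E0] := Wsi; split.
  + by move=> u v /KW Wu /KW Wv; exact: EC.
  + by move=> a u v w /KW Wu /KW Wv /KW Ww; exact: EZD.
  + by move=> u /KW; exact: E0.
- by move=> l u l0 Lu; exact: (Rstar_spec l0 Lu).1.
- by move=> l u v l0 Lu; exact: (Rstar_spec l0 Lu).2.
- exact: K_complete.
- exact: K_sat.
- by move=> z /KW; exact: Wnull.
Qed.

End Assembly.

Theorem theorem5 (R : realType) (M : ptopologicalType) (d : nat)
    (M_hausdorff : hausdorff_space M) (M_compact : compact [set: M])
    (S : oriented_atlas R M d) (g : riemannian_metric S)
    (vol : {measure set (borel M) -> \bar R}) (vol_g : riemannian_volume g vol)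
    (U : M -> R) (U_C1 : CkM S 1 U)
    (pi : probability (borel M) R) (pi_gibbs : gibbs pi vol U)
    (lam : nat -> R) (phi : nat -> M -> R)
    (A_eigen : eigenbasis pi (generator g pi U) lam phi)
    (b : vfield R M d) (b_C1 : Ck_field S 1 b)
    (b_div : forall p, divergence g (fun q => expR (- U q) *: b q) p = 0)
    (b_dom : Hm pi lam phi 1 `<=` transport_dom g pi b)
    (B : (M -> R) -> M -> R)
    (B_ext : transport_extension g pi b (Hm pi lam phi 1) B)
    (Rstar : R -> (M -> R) -> M -> R)
    (Rstar_def : forall l f, 0 < l -> L2 pi f ->
      is_resolvent_star g pi (generator g pi U)
        (kerB pi (Hm pi lam phi 1) B) l f (Rstar l f)) :
  let K := kerB pi (Hm pi lam phi 1) B in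
  let H := closureL2 pi K in
  [/\ form_dom pi H Rstar = K,
      (forall u v, K u -> K v ->
         approx_form pi Rstar u v l @[l --> +oo] --> ipH1 g pi u v),
      (forall u v, K u -> K v -> form_of pi Rstar u v = ipH1 g pi u v) &
      closed_form pi H (form_dom pi H Rstar) (form_of pi Rstar)].
Proof.
exact: (resolvent_star_form M_hausdorff M_compact vol_g U_C1 pi_gibbs A_eigen B_ext Rstar_def).
Qed.
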